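(* Let $n\ge1$, $p>0$, let $X\subset\mathbb{R}^n$ be compact, and let $v:X\to\mathbb{R}$ be Lipschitz, convex, and of class $C^2_+$ in $\operatorname{int}(X)$. Let $\omega:\mathbb{R}^{n+1}\to\mathbb{R}$ be continuous and positive. Then there exists a constant $\delta_{p,n}$, depending only on $n$ and $p$, such that \[ \lim_{m\to+\infty} m^{\frac{2p}{n}}\,\triangle_p(v,P^c_{(m)},\omega)=\frac{\delta_{p,n}}{2^p}\left(\int_X(\det D^2v(x))^{\frac{p}{n+2p}}\,\omega(x,v(x))^{\frac{n}{n+2p}}\,\mathrm{d}x\right)^{\frac{n+2p}{n}}. \]
   Context: $C^2_+$ means twice continuously differentiable with positive definite Hessian $D^2v$. $P^c_{(m)}=P^c_{(m)}(v)$ is the class of functions $l_m(x)=\max_{1\le j\le m}\psi_j(x)$ for at most $m$ affine functions $\psi_j:\mathbb{R}^n\to\mathbb{R}$ with $l_m(x)\le v(x)$ for all $x\in X$, and for sufficiently large $m$, \[ \triangle_p(v,P^c_{(m)},\omega)=\inf\Big\{\int_X(v(x)-l_m(x))^p\,\omega(x,v(x))\,\mathrm{d}x:\ l_m\in P^c_{(m)}\Big\}. \] (The constant $\delta_{p,n}$ is the one arising from Zador's quantization theorem: for every Jordan measurable compact $J\subset\mathbb{R}^n$ of positive volume, $\lim_{m\to\infty}m^{2p/n}\inf_{S\subset J,\#S=m}\int_J\min_{s\in S}\|x-s\|^{2p}\,\mathrm{d}x=\delta_{p,n}V_n(J)^{(n+2p)/n}$.) *)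

(* Defs.v *)
From HB Require Import structures.
From mathcomp Require Import all_boot all_order all_algebra.
From mathcomp Require Import all_classical all_reals all_analysis.

Set Implicit Arguments.
Unset Strict Implicit.
Unset Printing Implicit Defensive.

Import Order.TTheory GRing.Theory Num.Theory.
Import numFieldNormedType.Exports.

Local Open Scope classical_set_scope.
Local Open Scope ring_scope.

Section Defs.
Variable R : realType.

Definition cons_row (k : nat) (t : R) (y : 'rV[R]_k) : 'rV[R]_k.+1 :=
  \row_(i < k.+1) (if unlift ord0 i is Some j then y ord0 j else t).

(** Lebesgue integral on R^n of a function with values in \bar R, computed
    as the iterated one-dimensional Lebesgue integral (Fubini--Tonelli).  On R^0 (a point) the measure is the unit mass. *)
Fixpoint lebint (n : nat) : ('rV[R]_n -> \bar R) -> \bar R :=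
  match n return ('rV[R]_n -> \bar R) -> \bar R with
  | 0 => fun f => f 0
  | k.+1 => fun f =>
      (\int[@lebesgue_measure R]_(t in setT)
         lebint (fun y : 'rV[R]_k => f (cons_row t y)))%E
  end.

Definition ebasis (n : nat) (i : 'I_n) : 'rV[R]_n := delta_mx 0 i.

Definition partial (n : nat) (i : 'I_n) (f : 'rV[R]_n -> R) (x : 'rV[R]_n) : R :=
  'D_(ebasis i) f x.

Definition hessian (n : nat) (f : 'rV[R]_n -> R) (x : 'rV[R]_n) : 'M[R]_n :=
  \matrix_(i < n, j < n) partial i (partial j f) x.

Definition C2plus_on (n : nat) (U : set 'rV[R]_n) (f : 'rV[R]_n -> R) : Prop :=
  [/\ {in U, continuous f},
      (forall i : 'I_n, forall x, U x -> derivable f x (ebasis i)) /\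
      (forall i : 'I_n, {in U, continuous (partial i f)}),
      (forall i j : 'I_n, forall x, U x ->
          derivable (partial j f) x (ebasis i)),
      (forall i j : 'I_n, {in U, continuous (partial i (partial j f))}) &
      (forall x, U x -> forall u : 'rV[R]_n, u != 0 ->
          0 < (u *m hessian f x *m u^T) ord0 ord0)].

Definition affine_fun (n : nat) (ab : 'rV[R]_n * R) (x : 'rV[R]_n) : R :=
  (x *m (ab.1)^T) ord0 ord0 + ab.2.

Definition max_affine (n k : nat) (F : 'I_k.+1 -> 'rV[R]_n * R) (x : 'rV[R]_n) : R :=
  \big[Num.max/affine_fun (F ord0) x]_(j < k.+1) affine_fun (F j) x.

Definition Pc (n m : nat) (X : set 'rV[R]_n) (v : 'rV[R]_n -> R)
    (l : 'rV[R]_n -> R) : Prop :=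
  exists k : nat, exists F : 'I_k.+1 -> 'rV[R]_n * R,
    [/\ (k.+1 <= m)%N, l = max_affine F & forall x, X x -> l x <= v x].

Definition triangle_p (n : nat) (p : R) (X : set 'rV[R]_n) (v : 'rV[R]_n -> R)
    (omega : 'rV[R]_n * R -> R) (m : nat) : \bar R :=
  ereal_inf [set I | exists l, Pc m X v l /\
     I = lebint (fun x => if x \in X then
                   (powR (v x - l x) p * omega (x, v x))%:E else 0%E)].

End Defs.

(* Main.v *)
(** Near an interior point, [v] is its tangent plane plus half the quadratic form of its
    Hessian, up to a factor close to [1].  Hence on a small cube an affine minorant of
    [v] leaves an error comparable to [q (x - s) / 2], where [q] is the Hessian form and
    [s] the point where the minorant is closest to [v], and approximation by [k] affine
    pieces amounts to quantizing the cube by [k] points with respect to [q].  Tiling by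
    small copies of a quantizer shows that the infimum [quantc] over all sizes of the
    normalized quantization error is also its limit, and a Cholesky factor of [q] then
    gives [quantc q = det q ^ (p / n) * quantc 1].

    Upper bound: allot to each cube a number of tangents proportional to the integral of
    the density over the cube; the thin layer along the boundary of [X] is handled by
    Dudley's tangents, whose uniform error is [O(m ^ (- 2 / n))].

    Lower bound: by strict convexity, an affine minorant is close to [v] on at most one
    of finitely many disjoint closed cubes, so the pieces are shared among the cubes,
    and Hoelder's inequality bounds the total error for every way of sharing them. *)

Require Import Defs.
From HB Require Import structures.
From mathcomp Require Import all_boot all_order all_algebra.
From mathcomp Require Import all_classical all_reals all_analysis.
From mathcomp Require Import measurable_realfun ring lra.
Import Order.TTheory GRing.Theory Num.Theory.
Import numFieldNormedType.Exports.
Local Open Scope classical_set_scope.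
Local Open Scope ring_scope.
Set Implicit Arguments.
Unset Strict Implicit.
Unset Printing Implicit Defensive.

(** The exponents come from an allocation problem. With [al = 2 p / n], a cube holding [k] pieces
    has an error of order [a^(1 + al) k^(- al)], where [a] is the mass of the density on it; under
    [sum k = m] the least total is [(sum a)^(1 + al) m^(- al)], reached for [k] proportional to [a].
    Linear changes of variables are obtained directly for triangular maps only, since these respect
    an iterated integral coordinate by coordinate; this is why the Hessian is reduced by a Cholesky
    factor. Near the boundary the Hessian is uncontrolled, so the integral of the density is kept in
    the extended reals, and compact subsets of the interior are produced by homothety towards an
    interior point, which also measures the layer left over. Closed cubes of a grid share faces,
    whereas the sharing argument wants them disjoint, so they are shrunk. All multiplicative losses
    are powers of one factor [theta > 1]; a strict inequality about the limit leaves room for a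
    fixed power of it. *)

Definition borel (R : realType) (n : nat) := g_sigma_algebraType (@open 'rV[R]_n).

(** * Borel sets of row vectors and the measure behind [lebint] *)

Section BorelRow.
Context {R : realType}.
Notation borel := (borel R).

Lemma row_ballP (n : nat) (x y : 'rV[R]_n) (e : R) :
  0 < e -> ball x e y <-> (forall i, `|x ord0 i - y ord0 i| < e).
Proof.
move=> e0; split=> [[_ h] i|h]; first exact: h.
by split=> // i j; rewrite ord1; exact: h.
Qed.

Lemma open_borel {n : nat} (U : set 'rV[R]_n) : open U -> measurable (U : set (borel n)).
Proof. by move=> oU; exact: sub_sigma_algebra. Qed.

Lemma closed_borel {n : nat} (U : set 'rV[R]_n) : closed U -> measurable (U : set (borel n)).
Proof. by move=> cU; rewrite -(setCK U); apply: measurableC; apply: open_borel; exact: closed_openC. Qed.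

Lemma cons_row0 {k} (t : R) (y : 'rV[R]_k) : cons_row t y ord0 ord0 = t.
Proof. by rewrite mxE unlift_none. Qed.

Lemma cons_row_lift {k} (t : R) (y : 'rV[R]_k) j :
  cons_row t y ord0 (lift ord0 j) = y ord0 j.
Proof. by rewrite mxE liftK. Qed.

Lemma ball_cons_row {k} (t t' : R) (y y' : 'rV[R]_k) e : 0 < e ->
  ball (cons_row t y) e (cons_row t' y') <-> ball t e t' /\ ball y e y'.
Proof.
move=> e0; split=> [/row_ballP-/(_ e0) h|[h1 /row_ballP-/(_ e0) h2]].
  split; first by have := h ord0; rewrite !cons_row0.
  by apply/row_ballP => // i; have := h (lift ord0 i); rewrite !cons_row_lift.
apply/row_ballP => // i; case: (unliftP ord0 i) => [j ->|->].
  by rewrite !cons_row_lift.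
by rewrite !cons_row0.
Qed.

Lemma rat_approx (x e : R) : 0 < e -> exists q : rat, `|ratr q - x| < e.
Proof.
move=> e0; have /rat_in_itvoo[q] : x - e < x + e by lra.
by rewrite in_itv/= => /andP[? ?]; exists q; rewrite ltr_norml; apply/andP; split; lra.
Qed.

(** Second countability puts the open sets of the product topology into the product sigma-algebra:
    [W] is a union of products of balls with rational centres and radii. [F] replaces those not
    contained in [W] by the empty set, so that the union runs over a whole countable type. *)
Lemma open_rectangle_measurable k (W : set (R * 'rV[R]_k)) : open W ->
  measurable (W : set (measurableTypeR R * borel k)).
Proof.
move=> oW.
pose c (i : rat * 'rV[rat]_k * rat) : R * 'rV[R]_k := (ratr i.1.1, map_mx ratr i.1.2).
pose B i : set (R * 'rV[R]_k) := ball (c i).1 (ratr i.2) `*` ball (c i).2 (ratr i.2).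
pose F i := if `[< B i `<=` W >] then B i else set0.
have -> : W = \bigcup_i F i.
  apply/seteqP; split=> [[t y] Wty|z [i _]]; last first.
    by rewrite /F; case: ifPn => // /asboolP BW /BW.
  have /nbhs_ballP[e /= e0 eW] : nbhs (t, y) W by exact: open_nbhs_nbhs.
  have /rat_in_itvoo[r] : 0 < e / 2 by lra.
  rewrite in_itv/= => /andP[r0 re].
  have [q hq] := rat_approx t r0.
  have /choice[w hw] : forall i : 'I_k, exists q : rat, `|ratr q - y ord0 i| < ratr r.
    by move=> i; exact: rat_approx.
  exists (q, \row_i w i, r) => //; rewrite /F.
  have -> : `[< B (q, \row_i w i, r) `<=` W >].
    apply/asboolP => -[t' y'] [/= h1 h2]; apply: eW; split => /=.
      by move: h1; rewrite /ball/= => h1; apply: (le_lt_trans (ler_distD (ratr q) _ _)); rewrite distrC; lra.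
    apply/row_ballP => // i; move/(row_ballP _ _ r0): h2 => /(_ i); rewrite !mxE => h2.
    by have := hw i => h3; apply: (le_lt_trans (ler_distD (ratr (w i)) _ _)); rewrite distrC; lra.
  split => //=; apply/row_ballP => // i; rewrite !mxE; exact: hw.
apply: countable_bigcupT_measurable => [|i]; first exact: countableP.
rewrite /F; case: ifP => // _; apply: measurableX; first by rewrite ball_itv; exact: measurable_itv.
by apply: open_borel; exact: ball_open.
Qed.

Lemma measurable_cons_row k :
  measurable_fun setT (fun z : measurableTypeR R * borel k => cons_row z.1 z.2 : borel k.+1).
Proof.
refine (@measurability _ _ _ (borel k.+1) _ _ (@open 'rV[R]_k.+1 : set (set (borel k.+1))) _ _) => // _ [U oU <-]; rewrite setTI.
apply: open_rectangle_measurable; rewrite openE => -[t y] Uty.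
have /nbhs_ballP[e /= e0 eW] : nbhs (cons_row t y) U by exact: open_nbhs_nbhs.
apply/nbhs_ballP; exists e => //= -[t' y'] [/= h1 h2]; apply: eW.
by apply/ball_cons_row.
Qed.

Lemma measurable_borel_continuous m n (f : 'rV[R]_m -> 'rV[R]_n) : continuous f ->
  measurable_fun setT (f : borel m -> borel n).
Proof.
move=> cf; refine (@measurability _ _ _ (borel n) _ _ (@open 'rV[R]_n : set (set (borel n))) _ _) => // _ [U oU <-]; rewrite setTI.
by apply: open_borel; apply: open_comp => // x _; exact: cf.
Qed.

Lemma ball_sigma_finite n (mu : {measure set (borel n) -> \bar R}) :
  (forall r, (mu (ball (0%R : 'rV[R]_n) r) < +oo)%E) -> sigma_finite setT mu.
Proof.
move=> h; exists (fun i : nat => ball (0 : 'rV[R]_n) i%:R) => [|i]; last first.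
  by split=> //; apply: open_borel; exact: ball_open.
apply/seteqP; split => // x _; exists (Num.truncn `|x|).+1 => //=.
by rewrite -ball_normE /ball_/= sub0r normrN truncnS_gt.
Qed.

(* [lebint] is only an iterated integral; covers, changes of variables and monotone
   convergence need a measure that represents it. *)
Lemma lebint_measure n : exists mu : {measure set (borel n) -> \bar R},
  (forall r, (mu (ball (0%R : 'rV[R]_n) r) < +oo)%E) /\
  (forall f : borel n -> \bar R, measurable_fun setT f -> (forall x, 0 <= f x)%E ->
     lebint f = (\int[mu]_x f x)%E).
Proof.
(* Finiteness on balls is part of the induction because it yields sigma-finiteness, which Tonelli's
   theorem requires at the next coordinate. *)
elim: n => [|k [mu [mub muE]]].
  exists (\d_ (0 : borel 0)); split => [r|f mf f0].
    apply: (@le_lt_trans _ _ 1%E); last exact: ltry.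
    exact: probability_le1 (open_borel (ball_open _ _)).
  by rewrite integral_dirac//= diracE in_setT mul1e.
have sg := ball_sigma_finite mub.
pose mu' : {sigma_finite_measure set (borel k) -> \bar R} :=
  HB.pack (Measure.sort mu) mu
   (isSFinite.Build _ _ _ mu (sfinite_measure_sigma_finite sg)) (isSigmaFinite.Build _ _ _ mu sg).
pose cr (z : measurableTypeR R * borel k) : borel k.+1 := cons_row z.1 z.2.
have mcr : measurable_fun setT cr := measurable_cons_row (k := k).
pose lam : {sigma_finite_measure set (measurableTypeR R) -> \bar R} := @lebesgue_measure R.
(* The measure in dimension [k.+1] is the image of the product under [cons_row]; Tonelli unfolds its
   integrals in the order prescribed by [lebint]. *)
pose pf : {measure set (borel k.+1) -> \bar R} :=
  measure_function_pushforward__canonical__measure_function_Measure (lam \x mu')%E mcr.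
have pfE (f : borel k.+1 -> \bar R) : measurable_fun setT f -> (forall x, 0 <= f x)%E ->
    (\int[pf]_x f x = \int[lam]_t \int[mu']_y f (cons_row t y))%E.
  move=> mf f0; rewrite ge0_integral_pushforward//.
  rewrite preimage_setT fubini_tonelli1//; first exact: measurableT_comp.
  by move=> x; exact: f0.
exists pf; split => [r|f mf f0].
  have [r0|r0] := ltP 0 r; last first.
    have -> : ball (0 : 'rV[R]_k.+1) r = set0 by apply/seteqP; split=> // x [] /=; rewrite ltNge r0.
    by rewrite measure0 ltry.
  have -> : pf (ball (0 : 'rV[R]_k.+1) r) = (lam (ball 0%R r) * mu' (ball (0%R : 'rV[R]_k) r))%E.
    have m1 : measurable (ball (0 : R) r : set (measurableTypeR R)).
      by rewrite ball_itv; exact: measurable_itv.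
    have m2 : measurable (ball (0 : 'rV[R]_k) r : set (borel k)).
      by apply: open_borel; exact: ball_open.
    have c00 : cons_row 0 0 = 0 :> 'rV[R]_k.+1.
      by apply/rowP => i; rewrite !mxE; case: unlift => // j; rewrite mxE.
    rewrite -(product_measure1E lam mu' m1 m2).
    suff <- : cr @^-1` ball (0 : 'rV[R]_k.+1) r = ball (0 : R) r `*` ball (0 : 'rV[R]_k) r by [].
    by rewrite -c00; apply/seteqP; split => -[t y]; move/ball_cons_row; exact.
  rewrite ltey_eq fin_numM// ge0_fin_numE//.
    by rewrite /lam/= lebesgue_measure_ball ?ltW// ltry.
  exact: mub.
rewrite pfE//=; apply: eq_integral => t _; apply: muE => //.
exact: (measurable_fun_pair2 t (measurableT_comp mf mcr)).
Qed.

Definition leb n : {measure set (borel n) -> \bar R} := proj1_sig (cid (lebint_measure n)).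

Lemma lebintE n (f : borel n -> \bar R) : measurable_fun setT f -> (forall x, 0 <= f x)%E ->
  lebint f = (\int[leb n]_x f x)%E.
Proof. by rewrite /leb; case: cid => /= mu [_ h]; exact: h. Qed.

Lemma leb_ball_fin n r : (leb n (ball (0%R : 'rV[R]_n) r) < +oo)%E.
Proof. by rewrite /leb; case: cid => /= mu [h _]; exact: h. Qed.

Definition sigma_leb n : {sigma_finite_measure set (borel n) -> \bar R} :=
  HB.pack (Measure.sort (leb n)) (leb n)
   (isSFinite.Build _ _ _ (leb n) (sfinite_measure_sigma_finite (ball_sigma_finite (@leb_ball_fin n))))
   (isSigmaFinite.Build _ _ _ (leb n) (ball_sigma_finite (@leb_ball_fin n))).

Lemma integral_leb_cons k (f : borel k.+1 -> \bar R) :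
  measurable_fun setT f -> (forall x, 0 <= f x)%E ->
  (\int[leb k.+1]_x f x = \int[lebesgue_measure]_t \int[leb k]_y f (cons_row t y))%E.
Proof.
move=> mf f0; rewrite -lebintE//=; apply: eq_integral => t _; apply: lebintE => //.
exact: (measurable_fun_pair2 t (measurableT_comp mf (measurable_cons_row (k := k)))).
Qed.

End BorelRow.

(** * Change of variables along triangular maps *)

Definition row_tail (R : realType) (k : nat) (x : 'rV[R]_k.+1) : 'rV[R]_k :=
  \row_j x ord0 (lift ord0 j).

Definition unit_cube (R : realType) (n : nat) : set 'rV[R]_n :=
  [set x | forall i, 0 <= x ord0 i < 1].

Definition unit_cubec (R : realType) (n : nat) : set 'rV[R]_n :=
  [set x | forall i, 0 <= x ord0 i <= 1].

Section Scaling.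
Context {R : realType}.
Notation borel := (borel R).

Lemma cvg_row n (T : topologicalType) (F : set_system T) {FF : Filter F}
   (f : T -> 'rV[R]_n) (l : 'rV[R]_n) :
  (forall i, (fun y => f y ord0 i) @ F --> l ord0 i) -> f @ F --> l.
Proof.
move=> h; apply/cvg_ballP => e e0.
have : \forall y \near F, forall i, `|l ord0 i - f y ord0 i| < e.
  by apply: filter_forall => i; have /cvgrPdist_lt := h i; exact.
by apply: filterS => y hy; apply/row_ballP.
Qed.

Lemma continuous_row n (T : topologicalType) (f : T -> 'rV[R]_n) :
  (forall i, continuous (fun y => f y ord0 i)) -> continuous f.
Proof. by move=> h x; apply: cvg_row => i; exact: h. Qed.

Lemma continuous_add (T : topologicalType) (f g : T -> R) :
  continuous f -> continuous g -> continuous (fun x => f x + g x).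
Proof. by move=> cf cg x; apply: cvgD; [exact: cf|exact: cg]. Qed.

Lemma continuous_mul (T : topologicalType) (f g : T -> R) :
  continuous f -> continuous g -> continuous (fun x => f x * g x).
Proof. by move=> cf cg x; apply: cvgM; [exact: cf|exact: cg]. Qed.

Lemma continuous_coord n (T : topologicalType) (f : T -> 'rV[R]_n) i :
  continuous f -> continuous (fun y => f y ord0 i).
Proof.
move=> cf x; apply: (@continuous_comp _ _ _ f (fun z : 'rV[R]_n => z ord0 i)); first exact: cf.
exact: coord_continuous.
Qed.

Lemma row_tail_cons k (t : R) (y : 'rV[R]_k) : row_tail (cons_row t y) = y.
Proof. by apply/rowP => i; rewrite mxE cons_row_lift. Qed.

Lemma row_tail_continuous k : continuous (@row_tail R k).
Proof.
apply: continuous_row => i x.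
rewrite (_ : (fun y => _) = (fun y : 'rV_k.+1 => y ord0 (lift ord0 i))).
  exact: coord_continuous.
by apply/funext => y; rewrite mxE.
Qed.

(** [a] times the image of Lebesgue measure under [t |-> a t + c] gives half-open intervals their
    length, hence is Lebesgue measure by uniqueness. *)
Lemma lebesgue_integral_affine (a c : R) (G : R -> \bar R) : 0 < a ->
  measurable_fun setT G -> (forall t, 0 <= G t)%E ->
  (a%:E * \int[lebesgue_measure]_t G (a * t + c)%R = \int[lebesgue_measure]_t G t)%E.
Proof.
move=> a0 mG G0.
pose phi : measurableTypeR R -> measurableTypeR R := fun t => a * t + c.
have mphi : measurable_fun setT phi.
  by apply: continuous_measurable_fun => x; apply: cvgD; [apply: cvgM; [exact: cvg_cst|exact: cvg_id]|exact: cvg_cst].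
pose lam : {measure set (measurableTypeR R) -> \bar R} := @lebesgue_measure R.
pose pf : {measure set (measurableTypeR R) -> \bar R} :=
  measure_function_pushforward__canonical__measure_function_Measure lam mphi.
pose a' : {nonneg R} := NngNum (ltW a0).
have E : forall A, measurable A -> lam A = mscale a' pf A.
  apply: lebesgue_measure_unique => _ [[u v] _ <-] /=.
  rewrite /mscale/= /pushforward.
  have -> : phi @^-1` `]u, v] = `](u - c) / a, (v - c) / a]%classic.
    apply/seteqP; split => x /=; rewrite !in_itv/= /phi => /andP[h1 h2]; apply/andP; split.
    - by rewrite ltr_pdivrMr// mulrC; lra.
    - by rewrite ler_pdivlMr// mulrC; lra.
    - by move: h1; rewrite ltr_pdivrMr// mulrC; lra.
    - by move: h2; rewrite ler_pdivlMr// mulrC; lra.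
  rewrite /lam/= !lebesgue_measure_itv/= !lte_fin.
  rewrite ltr_pM2r ?invr_gt0// ltrD2r; case: ifP => _; last by rewrite mule0.
  by rewrite -!EFinD -EFinM; congr (_%:E); field; rewrite gt_eqF.
rewrite [RHS](eq_measure_integral (mscale a' pf)); last by move=> A mA _; exact: E.
rewrite ge0_integral_mscale//= ge0_integral_pushforward//=.
Qed.

Lemma measurable_integral_cons k (f : borel k.+1 -> \bar R) :
  measurable_fun setT f -> (forall x, 0 <= f x)%E ->
  measurable_fun setT (fun t : measurableTypeR R => \int[leb k]_y f (cons_row t y))%E.
Proof.
move=> mf f0.
have mfc : measurable_fun setT (fun z : measurableTypeR R * borel k => f (cons_row z.1 z.2)).
  exact: (measurableT_comp mf (@measurable_cons_row R k)).
have h := @measurable_fun_fubini_tonelli_F _ _ (measurableTypeR R) (borel k) R (sigma_leb k) _ mfc (fun z => f0 _).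
exact: h.
Qed.

(** [d] is the absolute Jacobian determinant of [T], specified by its effect on integrals. In this
    form it composes and inverts formally, without differentiating [T]. *)
Definition scales n (T : 'rV[R]_n -> 'rV[R]_n) (d : R) :=
  [/\ continuous T, 0 < d &
  forall f : borel n -> \bar R, measurable_fun setT f -> (forall x, 0 <= f x)%E ->
    (d%:E * \int[leb n]_x f (T x) = \int[leb n]_x f x)%E].

Lemma scales_id n : @scales n id 1.
Proof. by split => // [x|f _ _]; [exact: cvg_id|rewrite mul1e]. Qed.

Lemma scales_ext n (S T : 'rV[R]_n -> 'rV[R]_n) d : S =1 T -> scales S d -> scales T d.
Proof. by move=> /funext ->. Qed.

Lemma scales_comp n (S T : 'rV[R]_n -> 'rV[R]_n) c d :
  scales S c -> scales T d -> scales (S \o T) (c * d).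
Proof.
move=> [cS c0 hS] [cT d0 hT]; split.
- by move=> x; apply: continuous_comp; [exact: cT|exact: cS].
- exact: mulr_gt0.
move=> f mf f0; rewrite EFinM -muleA; rewrite (hT (f \o S)) ?hS//.
  exact: (measurableT_comp mf (measurable_borel_continuous cS)).
by move=> x; exact: f0.
Qed.

Lemma scales_inv n (S T : 'rV[R]_n -> 'rV[R]_n) d : cancel S T -> continuous T ->
  scales S d -> scales T d^-1.
Proof.
move=> ST cT [cS d0 hS]; split => //; first by rewrite invr_gt0.
move=> f mf f0.
have mfT : measurable_fun setT (f \o T : borel n -> \bar R).
  exact: (measurableT_comp mf (measurable_borel_continuous cT)).
rewrite -(hS (f \o T) mfT); last by move=> x; exact: f0.
rewrite muleA -EFinM mulVf ?gt_eqF// mul1e.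
by apply: eq_integral => x _ /=; rewrite ST.
Qed.

(** Tonelli handles this shape one coordinate at a time: for a fixed first coordinate the others
    undergo [L] and a translation, then the first undergoes an affine map. Translations, homotheties
    and triangular matrices are all instances. Translation invariance in dimension [k] is assumed
    because it is itself proved by induction through this lemma. *)
Lemma scales_cons k (L : 'rV[R]_k -> 'rV[R]_k) (d a c : R) (g : R -> 'rV[R]_k) :
  (forall b, scales (fun y : 'rV[R]_k => y + b) 1) -> continuous g -> 0 < a -> scales L d ->
  scales (fun x : 'rV[R]_k.+1 => cons_row (a * x ord0 ord0 + c) (g (x ord0 ord0) + L (row_tail x))) (a * d).
Proof.
move=> trk cg a0 [cL d0 hL].
set T := (fun x : 'rV[R]_k.+1 => _).
have cT : continuous T.
  apply: continuous_row => i.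
  case: (unliftP ord0 i) => [j ->|->].
    rewrite (_ : (fun _ => _) = (fun y : 'rV[R]_k.+1 => g (y ord0 ord0) ord0 j + L (row_tail y) ord0 j)); last first.
      by apply/funext => y; rewrite cons_row_lift mxE.
    have c1 : continuous (fun y : 'rV[R]_k.+1 => g (y ord0 ord0) ord0 j).
      apply: continuous_coord => y.
      by apply: (@continuous_comp _ _ _ (fun y : 'rV[R]_k.+1 => y ord0 ord0) g); [exact: coord_continuous|exact: cg].
    have c2 : continuous (fun y : 'rV[R]_k.+1 => L (row_tail y) ord0 j).
      apply: continuous_coord => y.
      by apply: continuous_comp; [exact: row_tail_continuous|exact: cL].
    exact: continuous_add.
  rewrite (_ : (fun _ => _) = (fun y : 'rV[R]_k.+1 => a * y ord0 ord0 + c)); last first.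
    by apply/funext => y; rewrite cons_row0.
  apply: continuous_add; last exact: cst_continuous.
  by apply: continuous_mul; [exact: cst_continuous|exact: coord_continuous].
split => //; first exact: mulr_gt0.
move=> f mf f0.
have mfT : measurable_fun setT (f \o T : borel k.+1 -> \bar R).
  exact: (measurableT_comp mf (measurable_borel_continuous cT)).
have mfc : measurable_fun setT (fun z : measurableTypeR R * borel k => f (cons_row z.1 z.2)).
  exact: (measurableT_comp mf (@measurable_cons_row R k)).
rewrite (integral_leb_cons mfT) ?(integral_leb_cons mf)//; last by move=> x; exact: f0.
rewrite EFinM -muleA.
rewrite -ge0_integralZl//; last 3 first.
- by apply: measurable_integral_cons => // x; exact: f0.
- by move=> t _; apply: integral_ge0 => y _; exact: f0.
- by rewrite lee_fin ltW.
rewrite -(lebesgue_integral_affine c a0); last 2 first.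
- exact: measurable_integral_cons.
- by move=> t; apply: integral_ge0.
congr (_ * _)%E; apply: eq_integral => t _.
have mf2 s : measurable_fun setT ((fun y => f (cons_row s y)) : borel k -> \bar R).
  exact: (measurable_fun_pair2 s mfc).
have [ctr _ htr] := trk (g t).
have := htr _ (mf2 (a * t + c)); rewrite mul1e => <- //.
rewrite -[RHS](hL (fun y => f (cons_row (a * t + c) (y + g t))))//; last first.
  exact: (measurableT_comp (mf2 (a * t + c)) (measurable_borel_continuous ctr)).
congr (_ * _)%E; apply: eq_integral => y _ /=.
by rewrite /T cons_row0 row_tail_cons (addrC (L y)).
Qed.

Lemma scales_shift n (a : 'rV[R]_n) : scales (fun x => x + a) 1.
Proof.
elim: n a => [|k IH] a.
  rewrite (_ : (fun x => _) = id); first exact: scales_id.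
  by apply/funext => x; apply/rowP => -[].
have h := scales_cons (a ord0 ord0) IH (g := fun=> row_tail a) (a := 1)
  (@cst_continuous _ _ _) ltr01 (scales_id k).
rewrite mul1r in h; apply: (scales_ext _ h) => x; apply/rowP => i.
case: (unliftP ord0 i) => [j ->|->]; first by rewrite cons_row_lift !mxE addrC.
by rewrite cons_row0 !mxE mul1r.
Qed.

Lemma scales_mul n (h : R) : 0 < h -> scales (fun x : 'rV[R]_n => h *: x) (h ^+ n).
Proof.
move=> h0; elim: n => [|k IH].
  rewrite (_ : (fun x => _) = id) ?expr0; first exact: scales_id.
  by apply/funext => x; apply/rowP => -[].
have := scales_cons 0 (@scales_shift k) (g := fun=> 0) (@cst_continuous _ _ _) h0 IH.
rewrite -exprS; apply: scales_ext => x; apply/rowP => i.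
case: (unliftP ord0 i) => [j ->|->]; first by rewrite cons_row_lift !mxE add0r.
by rewrite cons_row0 !mxE addr0.
Qed.

Lemma scales_affine n (h : R) (a : 'rV[R]_n) : 0 < h -> scales (fun x => a + h *: x) (h ^+ n).
Proof.
move=> h0; have := scales_comp (scales_shift a) (scales_mul n h0).
by rewrite mul1r; apply: scales_ext => x /=; rewrite addrC.
Qed.

Lemma scales_integral n (T : 'rV[R]_n -> 'rV[R]_n) d (B : set 'rV[R]_n) (f : borel n -> \bar R) :
  scales T d -> measurable (B : set (borel n)) ->
  measurable_fun setT f -> (forall x, 0 <= f x)%E ->
  (\int[leb n]_(x in B) f x = d%:E * \int[leb n]_(x in T @^-1` B) f (T x))%E.
Proof.
move=> [cT d0 hT] mB mf f0; rewrite integral_mkcond -hT.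
- congr (_ * _)%E; rewrite [RHS]integral_mkcond; apply: eq_integral => x _.
  by rewrite !patchE.
- by apply/(measurable_restrictT _ mB); exact: measurable_funTS.
- by move=> x; rewrite patchE; case: ifP.
Qed.

Lemma scales_measure n (T : 'rV[R]_n -> 'rV[R]_n) d (B : set 'rV[R]_n) :
  scales T d -> measurable (B : set (borel n)) ->
  (leb n B = d%:E * leb n (T @^-1` B))%E.
Proof.
move=> sT mB; have [cT _ _] := sT.
have mTB : measurable (T @^-1` B : set (borel n)).
  by rewrite -[X in measurable X]setTI; apply: (measurable_borel_continuous cT).
have := scales_integral sT mB (measurable_cst 1%E) (fun=> @lee01 R).
by rewrite !integral_cst// !mul1e.
Qed.

Lemma measurable_unit_cube n : measurable (@unit_cube R n : set (borel n)).
Proof.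
rewrite (_ : @unit_cube R n = \bigcap_(i in [set: 'I_n]) ((fun x : borel n => x ord0 i) @^-1` `[0, 1[)).
  apply: fin_bigcap_measurable => // i _.
  have -> : (fun x : borel n => x ord0 i) @^-1` `[0, 1[ =
     [set x : 'rV[R]_n | 0 <= x ord0 i] `&` [set x : 'rV[R]_n | x ord0 i < 1].
    by apply/seteqP; split => x /=; rewrite in_itv/= => /andP.
  apply: measurableI.
    apply: closed_borel; apply: (@preimage_closed _ _ (fun x : 'rV[R]_n => x ord0 i) [set t | 0 <= t]); last exact: closed_ge.
    by move=> x _; exact: coord_continuous.
  apply: open_borel; apply: (@open_comp _ _ (fun x : 'rV[R]_n => x ord0 i) [set t | t < 1]); last exact: open_lt.
  by move=> x _; exact: coord_continuous.
apply/seteqP; split => x h i; first by move=> _ /=; rewrite in_itv/=; exact: h.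
by have := h i I; rewrite /= in_itv.
Qed.

Lemma leb_lebint n (A : set (borel n)) : measurable A -> leb n A = lebint (fun x => (\1_A x)%:E).
Proof.
move=> mA; rewrite lebintE//; first by rewrite integral_indic// setIT.
exact/measurable_EFinP.
Qed.

Lemma leb_unit_cube n : leb n (@unit_cube R n) = 1%E.
Proof.
elim: n => [|k IH].
  by rewrite leb_lebint/= ?indicE ?mem_set//; [case|exact: measurable_unit_cube].
rewrite (leb_lebint (@measurable_unit_cube k.+1))/=.
transitivity (\int[@lebesgue_measure R]_t (\1_(`[0, 1[%classic : set R) t)%:E)%E; last first.
  rewrite integral_indic//= setIT.
  by have := @lebesgue_measure_itv R `[0, 1[; rewrite /= lte_fin ltr01 oppr0 adde0.
apply: eq_integral => t _.
have [ht|ht] := boolP (0 <= t < 1); last first.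
  rewrite [in RHS]indicE memNset/=; last by rewrite in_itv/=; exact/negP.
  rewrite (_ : (fun _ => _) = (fun=> 0%E)); last first.
    apply/funext => y; rewrite indicE memNset// => /(_ ord0).
    by rewrite cons_row0; exact/negP.
  by rewrite lebintE//= integral0.
rewrite [in RHS]indicE mem_set/=; last by rewrite in_itv.
rewrite -{}IH (leb_lebint (@measurable_unit_cube k)); congr (lebint _).
apply/funext => y; rewrite !indicE; congr ((nat_of_bool _)%:R%:E).
apply/idP/idP; rewrite !inE => h i.
  by have := h (lift ord0 i); rewrite cons_row_lift.
case: (unliftP ord0 i) => [j ->|->]; first by rewrite cons_row_lift; exact: h.
by rewrite cons_row0.
Qed.

End Scaling.

(** * Differential calculus on row vectors *)

Definition dot (R : realType) (n : nat) (x y : 'rV[R]_n) : R := (x *m y^T) ord0 ord0.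

Definition qform (R : realType) (n : nat) (H : 'M[R]_n) (u : 'rV[R]_n) : R :=
  (u *m H *m u^T) ord0 ord0.

Definition grad (R : realType) (n : nat) (f : 'rV[R]_n -> R) (x : 'rV[R]_n) : 'rV[R]_n :=
  \row_i partial i f x.

Section Calculus.
Context {R : realType}.

Lemma dotE n (x y : 'rV[R]_n) : dot x y = \sum_i x ord0 i * y ord0 i.
Proof. by rewrite /dot mxE; apply: eq_bigr => i _; rewrite mxE. Qed.

Lemma qformE n (H : 'M[R]_n) (u : 'rV[R]_n) :
  qform H u = \sum_j (\sum_i u ord0 i * H i j) * u ord0 j.
Proof. by rewrite /qform mxE; apply: eq_bigr => j _; rewrite !mxE. Qed.

Lemma row_norm_le n (x : 'rV[R]_n) (e : R) : 0 <= e ->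
  (`|x| <= e) <-> (forall i, `|x ord0 i| <= e).
Proof.
move=> e0; rewrite [`|x|]/Num.norm /= mx_normrE; split.
  move=> h i; apply: le_trans h; apply/bigmax_geP; right => /=; by exists (ord0, i).
by move=> h; apply/bigmax_leP; split => // -[i j] _ /=; rewrite (ord1 i).
Qed.

Lemma coord_le_norm n (x : 'rV[R]_n) i : `|x ord0 i| <= `|x|.
Proof. by have /row_norm_le := lexx `|x|; apply. Qed.

(** A mean value theorem based at [0] for increments of either sign, so that coordinate steps need
    no case distinction. *)
Lemma MVT_abs (g dg : R -> R) (c : R) :
  (forall t : R, `|t| <= `|c| -> is_derive t (1 : R) g (dg t)) ->
  exists2 t : R, `|t| <= `|c| & g c - g 0 = dg t * c.
Proof.
move=> hg.
have hc (t : R) : `|t| <= `|c| -> {for t, continuous g}.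
  by move=> /hg ht; apply/differentiable_continuous/derivable1_diffP; exact: ex_derive.
have [c0|c0] := leP 0 c.
  have [||t] := @MVT_segment R g dg 0 c c0.
  - by move=> t; rewrite in_itv/= => /andP[? ?]; apply: hg; rewrite !ger0_norm// ltW.
  - apply: continuous_in_subspaceT => t; rewrite inE/= in_itv/= => /andP[? ?].
    by apply: hc; rewrite !ger0_norm.
  rewrite in_itv/= => /andP[t0 tc]; rewrite subr0 => E; exists t => //.
  by rewrite !ger0_norm.
have [||t] := @MVT_segment R g dg c 0 (ltW c0).
- move=> t; rewrite in_itv/= => /andP[? ?]; apply: hg; rewrite !ltr0_norm//; lra.
- apply: continuous_in_subspaceT => t; rewrite inE/= in_itv/= => /andP[? ?].
  by apply: hc; rewrite !ler0_norm ?lerN2// ltW.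
rewrite in_itv/= => /andP[t0 tc] E; exists t; last by lra.
by rewrite !ler0_norm ?lerN2// ltW.
Qed.

Lemma is_derive_line n (f : 'rV[R]_n -> R) (x v : 'rV[R]_n) (t : R) :
  derivable f (x + t *: v) v ->
  is_derive t (1 : R) (fun s => f (x + s *: v)) ('D_v f (x + t *: v)).
Proof.
move=> df; set g := (fun s => _).
have E : (fun h : R => h^-1 *: ((g \o shift t) (h *: (1 : R)) - g t)) =
   (fun h : R => h^-1 *: ((f \o shift (x + t *: v)) (h *: v) - f (x + t *: v))).
  apply/funext => h; congr (_ *: (_ - _)); rewrite /g/=; congr f.
  by rewrite [h%:A]mulr1 scalerDl addrCA.
by apply: DeriveDef; [rewrite /derivable E|rewrite /derive E].
Qed.

Lemma derive_ge_quot n (f : 'rV[R]_n -> R) (x u : 'rV[R]_n) (c r : R) : 0 < r ->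
  derivable f x u -> (forall t, 0 < t < r -> c * t <= f (x + t *: u) - f x) -> c <= 'D_u f x.
Proof.
move=> r0 df h; rewrite leNgt; apply/negP => hc.
have /cvgrPdist_lt/(_ ((c - 'D_u f x) / 2)) : (fun h => h^-1 *: ((f \o shift x) (h *: u) - f x)) @ 0^' --> 'D_u f x by exact: df.
have c0 : 0 < (c - 'D_u f x) / 2 by lra.
move=> /(_ c0) /nbhs_ballP[e /= e0 he].
pose t := Num.min (e / 2) (r / 2).
have t0 : 0 < t by rewrite lt_min; apply/andP; split; lra.
have te : t <= e / 2 by rewrite ge_min lexx.
have tr : t <= r / 2 by rewrite ge_min lexx orbT.
have : `|'D_u f x - t^-1 *: (f (x + t *: u) - f x)| < (c - 'D_u f x) / 2.
  by rewrite [x + _]addrC; apply: he; rewrite ?gt_eqF// /ball/= sub0r normrN gtr0_norm//; lra.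
have /h : 0 < t < r by apply/andP; split => //; lra.
rewrite -ler_pdivlMr// => h1.
rewrite [_ *: _]mulrC ltr_norml => /andP[h2 _].
lra.
Qed.

Lemma derive_le_quot n (f : 'rV[R]_n -> R) (x u : 'rV[R]_n) (c r : R) : 0 < r ->
  derivable f x u -> (forall t, 0 < t < r -> f (x + t *: u) - f x <= c * t) -> 'D_u f x <= c.
Proof.
move=> r0 df h; rewrite leNgt; apply/negP => hc.
have /cvgrPdist_lt/(_ (('D_u f x - c) / 2)) : (fun h => h^-1 *: ((f \o shift x) (h *: u) - f x)) @ 0^' --> 'D_u f x by exact: df.
have c0 : 0 < ('D_u f x - c) / 2 by lra.
move=> /(_ c0) /nbhs_ballP[e /= e0 he].
pose t := Num.min (e / 2) (r / 2).
have t0 : 0 < t by rewrite lt_min; apply/andP; split; lra.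
have te : t <= e / 2 by rewrite ge_min lexx.
have tr : t <= r / 2 by rewrite ge_min lexx orbT.
have : `|'D_u f x - t^-1 *: (f (x + t *: u) - f x)| < ('D_u f x - c) / 2.
  by rewrite [x + _]addrC; apply: he; rewrite ?gt_eqF// /ball/= sub0r normrN gtr0_norm//; lra.
have /h : 0 < t < r by apply/andP; split => //; lra.
rewrite -ler_pdivrMr// => h1.
rewrite [_ *: _]mulrC ltr_norml => /andP[_ h2].
lra.
Qed.

Lemma near_forall_ord n (T : topologicalType) (x : T) (P : 'I_n -> T -> Prop) :
  (forall i, \forall y \near x, P i y) -> \forall y \near x, forall i, P i y.
Proof. by move=> h; apply: filter_forall. Qed.

Lemma near_and (T : topologicalType) (x : T) (P Q : T -> Prop) :
  (\forall y \near x, P y) -> (\forall y \near x, Q y) -> \forall y \near x, P y /\ Q y.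
Proof. exact: filterI. Qed.

(** The increment of [f] along [h *: u] is cut into steps parallel to the axes; the mean value
    theorem turns each step into a partial derivative at a point near [x], and continuity of the
    partials moves it to [x]. *)
Lemma C1_directional n (f : 'rV[R]_n -> R) (x u : 'rV[R]_n) :
  (forall i, \forall y \near x, derivable f y (ebasis R i)) ->
  (forall i, {for x, continuous (partial i f)}) ->
  derivable f x u /\ 'D_u f x = dot u (grad f x).
Proof.
move=> df cf.
have key : (fun h => h^-1 *: ((f \o shift x) (h *: u) - f x)) @ 0^' --> dot u (grad f x).
  apply/cvgrPdist_le => e e0.
  (* Each partial is controlled up to [e / M], so all the steps together cost at most [e]; the [+ 1]
     keeps [M] positive when [u = 0]. *)
  pose M := \sum_i `|u ord0 i| + 1.
  have M0 : 0 < M by rewrite ltr_wpDl ?sumr_ge0.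
  have : \forall y \near x, forall i, derivable f y (ebasis R i) /\ `|partial i f x - partial i f y| < e / M.
    apply: (@near_forall_ord _ _ _ (fun i y => derivable f y (ebasis R i) /\ `|partial i f x - partial i f y| < e / M)) => i.
    have /cvgrPdist_lt/(_ (e / M) (divr_gt0 e0 M0)) hh := cf i.
    by apply: near_and; [exact: df|exact: hh].
  move=> /nbhs_ballP[r /= r0 hr].
  apply/nbhs_ballP; exists (r / (`|u| + 1)) => /=; first by rewrite divr_gt0// ltr_wpDl.
  move=> h; rewrite /ball/= sub0r normrN => hr' h0.
  have hu : `|h| * `|u| < r.
    move: hr'; rewrite ltr_pdivlMr ?ltr_wpDl// mulrDr mulr1 => ?.
    by have := normr_ge0 h; lra.
  (* In [W k] the first [k] coordinates have already moved; [W 0 = x] and [W n = x + h u] make the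
     sum of the steps telescope. *)
  pose W k := x + h *: (\row_j (if (j < k)%N then u ord0 j else 0)).
  have W0 : W 0%N = x.
    rewrite /W (_ : \row_j _ = 0) ?scaler0 ?addr0//.
    by apply/rowP => j; rewrite !mxE.
  have Wn : W n = h *: u + x.
    rewrite /W addrC; congr (_ *: _ + _); apply/rowP => j; by rewrite !mxE ltn_ord.
  have step (i : 'I_n) : `|f (W i.+1) - f (W i) - h * (u ord0 i * partial i f x)| <=
      `|h| * (`|u ord0 i| * (e / M)).
    have WS : W i.+1 = W i + (h * u ord0 i) *: ebasis R i.
      apply/rowP => j; rewrite !mxE eqxx/= ltnS leq_eqVlt [j == i]eq_sym -(inj_eq val_inj) eq_sym.
      case: ltngtP => //= ji; rewrite ?mulr0 ?mulr1 ?addr0//.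
      by have -> : j = i by exact: val_inj.
    have near_x t : `|t| <= `|h * u ord0 i| -> ball x r (W i + t *: ebasis R i).
      move=> ht; rewrite -ball_normE /ball_/=; apply: le_lt_trans hu.
      apply/row_norm_le; first by rewrite mulr_ge0.
      move=> j; rewrite !mxE eqxx/= [j == i]eq_sym.
      have huj : `|h * u ord0 j| <= `|h| * `|u|.
        by rewrite normrM ler_wpM2l// coord_le_norm.
      rewrite opprD addrA opprD addrA subrr add0r.
      have [<-|ij] := eqVneq i j.
        by rewrite ltnn mulr0 oppr0 add0r mulr1 normrN (le_trans ht)// normrM ler_wpM2l// coord_le_norm.
      rewrite mulr0 subr0 normrN; case: ifP => // _; rewrite mulr0 normr0 mulr_ge0//.
    have [|t ht E] := @MVT_abs (fun s => f (W i + s *: ebasis R i))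
        (fun s => partial i f (W i + s *: ebasis R i)) (h * u ord0 i).
      by move=> t ht; apply: is_derive_line; exact: (hr _ (near_x _ ht) i).1.
    rewrite WS; move: E; rewrite scale0r addr0 => ->.
    have [_ hp] := hr _ (near_x _ ht) i.
    rewrite (_ : _ - _ = - (h * u ord0 i * (partial i f x - partial i f (W i + t *: ebasis R i)))); last by ring.
    by rewrite normrN normrM normrM -mulrA ler_wpM2l// ler_wpM2l// ltW.
  have -> : h^-1 *: ((f \o shift x) (h *: u) - f x) =
      h^-1 * \sum_(i < n) (f (W i.+1) - f (W i)).
    rewrite -(big_mkord xpredT (fun i => f (W i.+1) - f (W i))) telescope_sumr//.
    by rewrite W0 Wn.
  have -> : dot u (grad f x) = h^-1 * \sum_(i < n) (h * (u ord0 i * partial i f x)).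
    rewrite dotE -mulr_sumr mulrA mulVf// mul1r.
    by apply: eq_bigr => i _; rewrite mxE.
  have hn0 : 0 < `|h| by rewrite normr_gt0.
  rewrite -mulrBr -sumrB normrM normfV mulrC ler_pdivrMr//.
  apply: (le_trans (ler_norm_sum _ _ _)).
  apply: (@le_trans _ _ (\sum_(i < n) `|h| * (`|u ord0 i| * (e / M)))).
    by apply: ler_sum => i _; rewrite distrC; exact: step.
  rewrite -mulr_sumr -mulr_suml mulrC ler_wpM2r//.
  rewrite mulrA ler_pdivrMr// mulrC ler_wpM2l// ?ltW//.
  by rewrite /M ltrDl.
split; first by apply/cvg_ex; exists (dot u (grad f x)).
exact: cvg_lim.
Qed.

(** The mean value theorem is used twice: first for [g1 s - g1 0 >= a s], then for the difference of
    [g] and the comparison parabola, a function whose derivative is thereby nonnegative. *)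
Lemma taylor2_ge (g g1 g2 : R -> R) (a : R) :
  (forall s : R, 0 <= s <= 1 -> is_derive s (1 : R) g (g1 s)) ->
  (forall s : R, 0 <= s <= 1 -> is_derive s (1 : R) g1 (g2 s)) ->
  (forall s : R, 0 <= s <= 1 -> a <= g2 s) ->
  a / 2 <= g 1 - g 0 - g1 0.
Proof.
move=> h1 h2 ha.
have cont (F dF : R -> R) (b : R) : b <= 1 -> (forall s : R, 0 <= s <= 1 -> is_derive s (1 : R) F (dF s)) ->
    {within `[0, b], continuous F}.
  move=> b1 hF; apply: continuous_in_subspaceT => s; rewrite inE/= in_itv/= => /andP[? ?].
  have ? := hF s; apply/differentiable_continuous/derivable1_diffP.
  by apply: (@ex_derive _ _ _ _ _ _ (dF s)); apply: hF; apply/andP; split => //; lra.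
have hg1 (s : R) : 0 <= s <= 1 -> a * s <= g1 s - g1 0.
  move=> /andP[s0 s1].
  have [||c] := @MVT_segment R g1 g2 0 s s0.
  - by move=> y; rewrite in_itv/= => /andP[? ?]; apply: h2; apply/andP; split; lra.
  - exact: (cont _ _ _ s1 h2).
  rewrite in_itv/= subr0 => /andP[? ?] ->; rewrite ler_wpM2r//; apply: ha.
  by apply/andP; split => //; lra.
pose k s := g s - (g1 0 * s + a / 2 * (s * s)).
have hk (s : R) : 0 <= s <= 1 -> is_derive s (1 : R) k (g1 s - (g1 0 + a * s)).
  move=> hs; have ? := h1 s hs.
  have -> : g1 s - (g1 0 + a * s) = g1 s - ((g1 0 *: (1 : R) + a / 2 *: (s *: (1 : R) + s *: (1 : R)))).
    by rewrite /GRing.scale/=; field.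
  rewrite /k; apply: is_deriveB; apply: is_deriveD.
have [||c] := @MVT_segment R k (fun s => g1 s - (g1 0 + a * s)) 0 1 ler01.
- by move=> s; rewrite in_itv/= => /andP[? ?]; apply: hk; apply/andP; split; lra.
- exact: (cont _ _ _ (lexx 1) hk).
rewrite in_itv/= => hc; have := hg1 c hc; rewrite /k; lra.
Qed.

Lemma taylor2_le (g g1 g2 : R -> R) (b : R) :
  (forall s : R, 0 <= s <= 1 -> is_derive s (1 : R) g (g1 s)) ->
  (forall s : R, 0 <= s <= 1 -> is_derive s (1 : R) g1 (g2 s)) ->
  (forall s : R, 0 <= s <= 1 -> g2 s <= b) ->
  g 1 - g 0 - g1 0 <= b / 2.
Proof.
move=> h1 h2 hb.
have := @taylor2_ge (fun s => - g s) (fun s => - g1 s) (fun s => - g2 s) (- b).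
have H s F dF : is_derive s (1 : R) F dF -> is_derive s (1 : R) (fun s : R => - F s : R) (- dF).
  by move=> ?; apply: is_deriveN.
move=> /(_ (fun s hs => H _ _ _ (h1 s hs)) (fun s hs => H _ _ _ (h2 s hs))).
have hb' s : 0 <= s <= 1 -> - b <= - g2 s by move=> /hb; rewrite lerN2.
move=> /(_ hb'); lra.
Qed.

End Calculus.

(** * Symmetry of the Hessian, tangents and strict convexity *)

Section ConvexCalculus.
Context {R : realType}.

Lemma norm_ebasis_le n (i : 'I_n) : `|ebasis R i| <= 1.
Proof.
apply/row_norm_le => // j; rewrite !mxE eqxx/=.
by case: (j == i); rewrite ?normr1 ?normr0.
Qed.

Lemma open_ball_sub n (U : set 'rV[R]_n) x : open U -> U x ->
  exists2 r, 0 < r & forall y, `|y - x| < r -> U y.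
Proof.
move=> oU Ux; have /nbhs_ballP[r /= r0 h] : nbhs x U by exact: open_nbhs_nbhs.
by exists r => // y yx; apply: h; rewrite -ball_normE /ball_/= distrC.
Qed.

Lemma cvg_ball n (f : 'rV[R]_n -> R) x e : {for x, continuous f} -> 0 < e ->
  exists2 r, 0 < r & forall y, `|y - x| < r -> `|f x - f y| < e.
Proof.
move=> cf e0; have /cvgrPdist_lt/(_ e e0)/nbhs_ballP[r /= r0 h] := cf.
by exists r => // y yx; apply: h; rewrite -ball_normE /ball_/= distrC.
Qed.

Section C2.
Context (n : nat) (U : set 'rV[R]_n) (v : 'rV[R]_n -> R).
Context (oU : open U) (C2 : C2plus_on U v).

Lemma C2_derive x u : U x -> derivable v x u /\ 'D_u v x = dot u (grad v x).
Proof.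
case: C2 => _ [dv cv] _ _ _ Ux; apply: C1_directional => i; last exact/cv/mem_set.
have : nbhs x U by exact: open_nbhs_nbhs.
by apply: filterS => y; exact: dv.
Qed.

Lemma C2_derive2 j x u : U x ->
  derivable (partial j v) x u /\ 'D_u (partial j v) x = dot u (grad (partial j v) x).
Proof.
case: C2 => _ _ dv cv _ Ux; apply: C1_directional => i; last exact/cv/mem_set.
have : nbhs x U by exact: open_nbhs_nbhs.
by apply: filterS => y; exact: dv.
Qed.

Lemma is_derive_C2 (x u : 'rV[R]_n) (s : R) : U (x + s *: u) ->
  is_derive s (1 : R) (fun s => v (x + s *: u)) (dot u (grad v (x + s *: u))).
Proof. by move=> Us; have [h <-] := C2_derive u Us; exact: is_derive_line. Qed.

Lemma is_derive2_C2 (x u : 'rV[R]_n) (s : R) : U (x + s *: u) ->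
  is_derive s (1 : R) (fun s => dot u (grad v (x + s *: u))) (qform (hessian v (x + s *: u)) u).
Proof.
move=> Us.
have -> : (fun s => dot u (grad v (x + s *: u))) =
    \sum_(j < n) (u ord0 j *: (fun s => partial j v (x + s *: u)) : R -> R).
  apply/funext => t; rewrite fct_sumE dotE; apply: eq_bigr => j _.
  by rewrite mxE.
have -> : qform (hessian v (x + s *: u)) u =
    \sum_(j < n) u ord0 j *: (dot u (grad (partial j v) (x + s *: u)) : R).
  rewrite qformE; apply: eq_bigr => j _; rewrite [RHS]mulrC dotE; congr (_ * _).
  by apply: eq_bigr => i _; rewrite !mxE.
apply: is_derive_sum => j; apply: is_deriveZ.
by have [h <-] := C2_derive2 j u Us; exact: is_derive_line.
Qed.

Lemma C2_taylor_ge x u a :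
  (forall s, 0 <= s <= 1 -> U (x + s *: u) /\ a <= qform (hessian v (x + s *: u)) u) ->
  a / 2 <= v (x + u) - v x - dot u (grad v x).
Proof.
move=> h; have := @taylor2_ge R (fun s => v (x + s *: u)) (fun s => dot u (grad v (x + s *: u)))
   (fun s => qform (hessian v (x + s *: u)) u) a.
rewrite !scale1r !scale0r !addr0; apply => s hs.
- by apply: is_derive_C2; have [] := h s hs.
- by apply: is_derive2_C2; have [] := h s hs.
- by have [] := h s hs.
Qed.

Lemma C2_taylor_le x u b :
  (forall s, 0 <= s <= 1 -> U (x + s *: u) /\ qform (hessian v (x + s *: u)) u <= b) ->
  v (x + u) - v x - dot u (grad v x) <= b / 2.
Proof.
move=> h; have := @taylor2_le R (fun s => v (x + s *: u)) (fun s => dot u (grad v (x + s *: u)))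
   (fun s => qform (hessian v (x + s *: u)) u) b.
rewrite !scale1r !scale0r !addr0; apply => s hs.
- by apply: is_derive_C2; have [] := h s hs.
- by apply: is_derive2_C2; have [] := h s hs.
- by have [] := h s hs.
Qed.

(** Two mean value steps write the gap as the Hessian form at an intermediate point times the
    positive number [c]. *)
Lemma C2_strict x u : u != 0 -> (forall s, 0 <= s <= 1 -> U (x + s *: u)) ->
  v x + dot u (grad v x) < v (x + u).
Proof.
move=> u0 h.
have cont (F dF : R -> R) (b : R) : b <= 1 -> (forall s : R, 0 <= s <= 1 -> is_derive s (1 : R) F (dF s)) ->
    {within `[0, b], continuous F}.
  move=> b1 hF; apply: continuous_in_subspaceT => s; rewrite inE/= in_itv/= => /andP[? ?].
  apply/differentiable_continuous/derivable1_diffP.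
  by apply: (@ex_derive _ _ _ _ _ _ (dF s)); apply: hF; apply/andP; split => //; lra.
have d1 (s : R) : 0 <= s <= 1 -> is_derive s (1 : R) (fun s => v (x + s *: u)) (dot u (grad v (x + s *: u))).
  by move=> hs; apply: is_derive_C2; exact: h.
have d2 (s : R) : 0 <= s <= 1 -> is_derive s (1 : R) (fun s => dot u (grad v (x + s *: u))) (qform (hessian v (x + s *: u)) u).
  by move=> hs; apply: is_derive2_C2; exact: h.
have [||c] := MVT ltr01 (f := fun s => v (x + s *: u)) (df := fun s => dot u (grad v (x + s *: u))).
- by move=> s; rewrite in_itv/= => /andP[? ?]; apply: d1; apply/andP; split; lra.
- exact: cont (lexx _) d1.
rewrite in_itv/= => /andP[c0 c1]; rewrite scale1r scale0r addr0 subr0 mulr1 => E.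
have [||c'] := MVT c0 (f := fun s => dot u (grad v (x + s *: u))) (df := fun s => qform (hessian v (x + s *: u)) u).
- by move=> s; rewrite in_itv/= => /andP[? ?]; apply: d2; apply/andP; split; lra.
- by apply: cont d2; lra.
rewrite in_itv/= => /andP[c'0 c'1]; rewrite scale0r addr0 subr0 => E'.
have : 0 < qform (hessian v (x + c' *: u)) u * c.
  rewrite mulr_gt0//; case: C2 => _ _ _ _; apply => //; apply: h.
  by apply/andP; split; lra.
by rewrite -E'; lra.
Qed.

(** The mixed second difference is symmetric in [i] and [j], whereas two mean value steps evaluate
    it as [h^2] times a mixed partial at a nearby point. Exchanging the indices compares both mixed
    partials, which yields Schwarz's theorem in [hessian_sym]. *)
Lemma second_difference (i j : 'I_n) x (h : R) :
  (forall a b : R, `|a| <= `|h| -> `|b| <= `|h| -> U (x + a *: ebasis R i + b *: ebasis R j)) ->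
  exists a b : R, [/\ `|a| <= `|h|, `|b| <= `|h| &
    v (x + h *: ebasis R i + h *: ebasis R j) - v (x + h *: ebasis R i)
      - (v (x + h *: ebasis R j) - v x) =
    partial j (partial i v) (x + a *: ebasis R i + b *: ebasis R j) * h * h].
Proof.
move=> hU; have [_ [dv _] dv2 _ _] := C2.
have [a ha E] := @MVT_abs R (fun a => v ((x + h *: ebasis R j) + a *: ebasis R i) - v (x + a *: ebasis R i))
   (fun a => partial i v ((x + h *: ebasis R j) + a *: ebasis R i) - partial i v (x + a *: ebasis R i)) h
   (fun a ha => is_deriveB
      (is_derive_line (dv i ((x + h *: ebasis R j) + a *: ebasis R i) ltac:(by rewrite addrAC; apply: hU)))
      (is_derive_line (dv i (x + a *: ebasis R i)
        ltac:(by have := hU a 0 ha; rewrite normr0 scale0r addr0; apply)))).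
have [b hb E'] := @MVT_abs R (fun b => partial i v ((x + a *: ebasis R i) + b *: ebasis R j))
   (fun b => partial j (partial i v) ((x + a *: ebasis R i) + b *: ebasis R j)) h
   (fun b hb => is_derive_line (dv2 j i _ (hU a b ha hb))).
exists a, b; split => //.
move: E E'; rewrite !scale0r !addr0 => E E'.
by rewrite -E' (addrAC x (h *: ebasis R i)) E (addrAC x (h *: ebasis R j)).
Qed.

Lemma hessian_sym x : U x -> (hessian v x)^T = hessian v x.
Proof.
have half_absurd (a : R) : a < a / 2 + a / 2 -> False by lra.
move=> Ux; apply/matrixP => i j; rewrite !mxE.
have [_ _ _ cv _] := C2.
apply/eqP; rewrite -subr_eq0 -normr_le0 leNgt; apply/negP => h0.
set e := `|_| in h0; pose e2 := e / 2.
have e0 : 0 < e2 by rewrite /e2; lra.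
have [r1 r10 h1] := cvg_ball (cv j i x (mem_set Ux)) e0.
have [r2 r20 h2] := cvg_ball (cv i j x (mem_set Ux)) e0.
have [r3 r30 h3] := open_ball_sub oU Ux.
(* Two displacements of length at most [h] must add up to less than the least radius; hence a third
   of it. *)
pose h := Num.min r1 (Num.min r2 r3) / 3.
have m0 : 0 < Num.min r1 (Num.min r2 r3) by rewrite !lt_min r10 r20 r30.
have [m1 m2 m3] : [/\ Num.min r1 (Num.min r2 r3) <= r1, Num.min r1 (Num.min r2 r3) <= r2 & Num.min r1 (Num.min r2 r3) <= r3].
  by rewrite !ge_min !lexx !orbT.
have hh0 : 0 < h by rewrite /h; lra.
have dist (k l : 'I_n) (a b : R) : `|a| <= `|h| -> `|b| <= `|h| ->
    `|x + a *: ebasis R k + b *: ebasis R l - x| < Num.min r1 (Num.min r2 r3).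
  move=> ha hb; rewrite addrAC [x + _]addrC addrK.
  apply: (le_lt_trans (ler_normD _ _)); rewrite !normrZ.
  have hk := norm_ebasis_le k; have hl := norm_ebasis_le l.
  have h1' : `|a| * `|ebasis R k| <= h by rewrite -[leRHS]mulr1 ler_pM// (le_trans ha)// gtr0_norm.
  have h2' : `|b| * `|ebasis R l| <= h by rewrite -[leRHS]mulr1 ler_pM// (le_trans hb)// gtr0_norm.
  by apply: (le_lt_trans (lerD h1' h2')); rewrite /h; lra.
have [a [b [ha hb E]]] := @second_difference i j x h
   (fun a b ha hb => h3 _ (lt_le_trans (dist i j a b ha hb) m3)).
have [a' [b' [ha' hb' E']]] := @second_difference j i x h
   (fun a b ha hb => h3 _ (lt_le_trans (dist j i a b ha hb) m3)).
have A1 := h1 _ (lt_le_trans (dist i j a b ha hb) m1).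
have A2 := h2 _ (lt_le_trans (dist j i a' b' ha' hb') m2).
(* Both sides times [h * h] are the same second difference. The two mixed partials at [x] are then
   less than [e / 2 + e / 2] apart, although [e] is their distance. *)
have EE : partial j (partial i v) (x + a *: ebasis R i + b *: ebasis R j) =
    partial i (partial j v) (x + a' *: ebasis R j + b' *: ebasis R i).
  apply: (@mulIf _ h); first by rewrite gt_eqF.
  apply: (@mulIf _ h); first by rewrite gt_eqF.
  have swap (A B C D : R) : A - B - (C - D) = A - C - (B - D) by ring.
  apply: (etrans (esym E)); apply: (etrans _ E'); apply: (etrans (swap _ _ _ _)).
  by congr (_ - _ - _); congr v; exact: addrAC.
apply: (half_absurd e); rewrite -/e2.
apply: le_lt_trans (ltrD A1 A2).
rewrite /e.
by rewrite EE -[X in _ <= _ + X]distrC; apply: ler_distD.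
Qed.

End C2.

Lemma convex_functionE n (X : set 'rV[R]_n) (v : 'rV[R]_n -> R) :
  convex_function (X : set (convex_lmodType 'rV[R]_n)) v ->
  forall x y t, X x -> X y -> 0 <= t <= 1 ->
    v (t *: x + (1 - t) *: y) <= t * v x + (1 - t) * v y.
Proof.
move=> cv x y t Xx Xy /andP[t0 t1].
exact: (cv (Itv01 t0 t1) x y (mem_set Xx) (mem_set Xy)).
Qed.

Lemma convex_setE n (X : set 'rV[R]_n) :
  convex_set (X : set (convex_lmodType 'rV[R]_n)) ->
  forall x y t, X x -> X y -> 0 <= t <= 1 -> X (t *: x + (1 - t) *: y).
Proof.
move=> cv x y t Xx Xy /andP[t0 t1].
exact: set_mem (cv x y (Itv01 t0 t1) (mem_set Xx) (mem_set Xy)).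
Qed.

Lemma interior_ball n (X : set 'rV[R]_n) x : interior X x <->
  exists2 r, 0 < r & forall y, `|y - x| < r -> X y.
Proof.
split=> [/nbhs_ballP[r /= r0 h]|[r r0 h]].
  by exists r => // y yx; apply: h; rewrite -ball_normE /ball_/= distrC.
apply/nbhs_ballP; exists r => // y; rewrite -ball_normE /ball_/= distrC; exact: h.
Qed.

Lemma interior_convex_comb n (X : set 'rV[R]_n) :
  convex_set (X : set (convex_lmodType 'rV[R]_n)) ->
  forall x y t, interior X x -> X y -> 0 < t <= 1 -> interior X (t *: x + (1 - t) *: y).
Proof.
move=> cX x y t /interior_ball[r r0 hr] Xy /andP[t0 t1]; apply/interior_ball.
exists (t * r); first exact: mulr_gt0.
move=> z hz.
have -> : z = t *: (t^-1 *: (z - (1 - t) *: y)) + (1 - t) *: y.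
  by rewrite scalerA divff ?gt_eqF// scale1r subrK.
apply: convex_setE => //; last by rewrite t1 ltW.
apply: hr.
have -> : t^-1 *: (z - (1 - t) *: y) - x = t^-1 *: (z - (t *: x + (1 - t) *: y)).
  by rewrite opprD addrA addrAC [in RHS]scalerBr scalerA mulVf ?gt_eqF// scale1r.
by rewrite normrZ gtr0_norm ?invr_gt0// ltr_pdivrMl.
Qed.

Lemma convex_tangent n (X : set 'rV[R]_n) (v : 'rV[R]_n -> R) :
  convex_function (X : set (convex_lmodType 'rV[R]_n)) v -> C2plus_on (interior X) v ->
  forall x y, interior X x -> X y -> v x + dot (y - x) (grad v x) <= v y.
Proof.
move=> cv C2 x y Xx Xy.
have [dv <-] := C2_derive (@open_interior _ X) C2 (y - x) Xx.
rewrite addrC -lerBrDr; apply: (derive_le_quot ltr01) => // t /andP[t0 t1].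
have := convex_functionE cv Xy (interior_subset Xx) (t := t).
rewrite (ltW t0) (ltW t1) => /(_ isT).
have -> : t *: y + (1 - t) *: x = x + t *: (y - x).
  by rewrite scalerBl scale1r scalerBr addrCA.
lra.
Qed.

Lemma segment_comb n (z w : 'rV[R]_n) (s : R) : s *: (z + w) + (1 - s) *: z = z + s *: w.
Proof. by apply/rowP => k; rewrite !mxE; ring. Qed.

(** Both endpoints are compared with the tangent at their midpoint, in the opposite directions [u]
    and [- u]; adding cancels the gradient terms. *)
Lemma strict_midpoint n (X : set 'rV[R]_n) (v : 'rV[R]_n -> R) :
  convex_set (X : set (convex_lmodType 'rV[R]_n)) -> C2plus_on (interior X) v ->
  forall x y, interior X x -> interior X y -> x != y ->
    v (2^-1 *: x + 2^-1 *: y) < (v x + v y) / 2.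
Proof.
move=> cX C2 x y Xx Xy xy.
set z := 2^-1 *: x + 2^-1 *: y; pose u := 2^-1 *: (x - y).
have ez : 1 - 2^-1 = 2^-1 :> R by field.
have u0 : u != 0 by rewrite scaler_eq0 invr_eq0 pnatr_eq0/= subr_eq0.
have zx : z + u = x.
  by apply/rowP => k; rewrite /z /u !mxE; field.
have zy : z + (- u) = y.
  by apply/rowP => k; rewrite /z /u !mxE; field.
have zI : interior X z.
  have := interior_convex_comb cX Xx (interior_subset Xy) (t := 2^-1); rewrite ez; apply.
  by rewrite invr_gt0 ltr0n invf_le1 ?ler1n ?ltr0n.
have seg w s : interior X (z + w) -> 0 <= s <= 1 -> interior X (z + s *: w).
  move=> Iw /andP[]; rewrite le_eqVlt => /predU1P[<- _|s0 s1]; first by rewrite scale0r addr0.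
  have := interior_convex_comb cX Iw (interior_subset zI) (t := s); rewrite s0 s1 => /(_ isT).
  by rewrite segment_comb.
have h1 := C2_strict (@open_interior _ X) C2 u0 (seg u ^~ (eq_ind_r (interior X) Xx zx)).
have h2 := C2_strict (@open_interior _ X) C2 (eq_ind_r (fun b => ~~ b) u0 (oppr_eq0 u)) (seg (- u) ^~ (eq_ind_r (interior X) Xy zy)).
move: h1 h2; rewrite zx zy.
have -> : dot (- u) (grad v z) = - dot u (grad v z) by rewrite /dot mulNmx mxE.
lra.
Qed.

End ConvexCalculus.

(** * Quantization errors, grids, packing and covering of integrals *)

Definition qmin (R : realType) (n : nat) (H : 'M[R]_n) (S : seq 'rV[R]_n) (x : 'rV[R]_n) : R :=
  \big[Num.min/qform H (x - head 0 S)]_(s <- S) qform H (x - s).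

Section Quantizers.
Context {R : realType}.
Notation borel := (borel R).

Lemma nat_eq_of_close (a b : nat) : (a%:R : R) < b%:R + 1 -> (b%:R : R) < a%:R + 1 -> a = b.
Proof.
rewrite !natr1 !ltr_nat !ltnS => h1 h2; apply/eqP; by rewrite eqn_leq h1 h2.
Qed.

(** The corners are the integer points of [[- M, M]^n] with [M > b]. As the cubes are half-open, the
    integer parts of the coordinates of a point determine the corner. *)
Lemma grid n (b : R) : exists Z : seq 'rV[R]_n, [/\ uniq Z,
  (forall z z' x, z \in Z -> z' \in Z -> unit_cube (x - z) -> unit_cube (x - z') -> z = z') &
  (forall x, `|x| <= b -> exists2 z, z \in Z & unit_cube (x - z))].
Proof.
pose M := (Num.truncn b).+1.
have Mb : b < M%:R by exact: truncnS_gt.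
pose zf (f : {ffun 'I_n -> 'I_(M + M).+1}) : 'rV[R]_n := \row_i ((f i)%:R - M%:R).
have inj f f' x : unit_cube (x - zf f) -> unit_cube (x - zf f') -> f = f'.
  move=> h h'; apply/ffunP => i; apply: val_inj => /=.
  have := h i; have := h' i; rewrite !mxE.
  move: (x ord0 i) (nat_of_ord (f i)) (nat_of_ord (f' i)) (M%:R) => y k k' m.
  by move=> /andP[? ?] /andP[? ?]; apply: nat_eq_of_close; lra.
exists [seq zf f | f <- enum {: {ffun 'I_n -> 'I_(M + M).+1}}]; split.
- rewrite map_inj_uniq ?enum_uniq// => f f' ff'.
  have c0 : @unit_cube R n 0 by move=> i; rewrite mxE lexx ltr01.
  by apply: (inj f f' (zf f)); [rewrite subrr|rewrite ff' subrr].
- by move=> z z' x /mapP[f _ ->] /mapP[f' _ ->] h h'; rewrite (inj f f' x).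
- move=> x hx.
  have pos i : 0 <= x ord0 i + M%:R.
    by have := coord_le_norm x i; rewrite ler_norml => /andP[h1 h2]; lra.
  have lt i : (Num.truncn (x ord0 i + M%:R)%R < (M + M).+1)%N.
    rewrite truncn_lt_nat// -natr1 natrD.
    have := coord_le_norm x i; rewrite ler_norml => /andP[h1 h2]; lra.
  exists (zf [ffun i => Ordinal (lt i)]); first by apply/mapP; eexists; [rewrite mem_enum|].
  move=> i; rewrite !mxE ffunE/=; have /andP[h1 h2] := truncn_itv (pos i).
  move: h2; rewrite -natr1 => h2; apply/andP; split; lra.
Qed.

Lemma qform_le n (H : 'M[R]_n) (u : 'rV[R]_n) :
  qform H u <= (\sum_j \sum_i `|H i j|) * `|u| ^+ 2.
Proof.
rewrite qformE mulr_suml; apply: ler_sum => j _.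
apply: (le_trans (ler_norm _)); rewrite normrM expr2 mulrA.
apply: ler_pM => //; last exact: coord_le_norm.
apply: (le_trans (ler_norm_sum _ _ _)); rewrite mulr_suml; apply: ler_sum => i _.
by rewrite normrM mulrC ler_wpM2l// coord_le_norm.
Qed.

Lemma qformZ n (H : 'M[R]_n) (h : R) (u : 'rV[R]_n) : qform H (h *: u) = h ^+ 2 * qform H u.
Proof. by rewrite /qform linearZ/= -!scalemxAr -!scalemxAl scalerA mxE expr2. Qed.

Lemma qformM n (H A : 'M[R]_n) (u : 'rV[R]_n) : qform H (u *m A) = qform (A *m H *m A^T) u.
Proof. by rewrite /qform trmx_mul !mulmxA. Qed.

Lemma continuous_sum n (T : topologicalType) (F : 'I_n -> T -> R) :
  (forall i, continuous (F i)) -> continuous (fun x => \sum_i F i x).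
Proof.
move=> cF; elim: (index_enum _) => [|i r IH].
  rewrite (_ : (fun _ => _) = (fun=> 0)); first exact: cst_continuous.
  by apply/funext => x; rewrite big_nil.
rewrite (_ : (fun _ => _) = (fun x => F i x + \sum_(j <- r) F j x)); last first.
  by apply/funext => x; rewrite big_cons.
exact: continuous_add.
Qed.

Lemma continuous_qform n (T : topologicalType) (H : 'M[R]_n) (f : T -> 'rV[R]_n) :
  continuous f -> continuous (fun x => qform H (f x)).
Proof.
move=> cf; rewrite (_ : (fun _ => _) = fun x => \sum_j (\sum_i f x ord0 i * H i j) * f x ord0 j).
  apply: continuous_sum => j; apply: continuous_mul; last exact: continuous_coord.
  apply: continuous_sum => i; apply: continuous_mul; last exact: cst_continuous.
  exact: continuous_coord.
by apply/funext => x; rewrite qformE.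
Qed.

Lemma continuous_sub_cst n (a : 'rV[R]_n) : continuous (fun x : 'rV[R]_n => x - a).
Proof. by have [] := scales_shift (- a). Qed.

Lemma qmin_le n (H : 'M[R]_n) S x s : s \in S -> qmin H S x <= qform H (x - s).
Proof.
rewrite /qmin; move: (qform H (x - head 0 S)) => a.
elim: S => // t S IH; rewrite inE big_cons => /predU1P[->|/IH h].
  by rewrite ge_min lexx.
by rewrite ge_min h orbT.
Qed.

(** The seed of the minimum is [head 0 S], which belongs to [S] once [S] is nonempty, so it adds no
    value of its own. *)
Lemma qmin_ex n (H : 'M[R]_n) S x : S != [::] ->
  exists2 s, s \in S & qmin H S x = qform H (x - s).
Proof.
case: S => // t S _; rewrite /qmin/=.
have : exists2 s, s \in t :: t :: S & \big[Num.min/qform H (x - t)]_(s <- t :: S) qform H (x - s) = qform H (x - s).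
  elim: (t :: S) => [|a r [s hs E]]; first by exists t; rewrite ?inE ?eqxx// big_nil.
  rewrite big_cons E /Num.min; case: ifP => _.
    by exists a => //; rewrite !inE eqxx orbT.
  exists s => //; move: hs; rewrite !inE => /orP[->//|->]; by rewrite !orbT.
by move=> [s hs E]; exists s => //; move: hs; rewrite inE => /predU1P[->|//]; rewrite inE eqxx.
Qed.

Lemma qmin_ge0 n (H : 'M[R]_n) S x : (forall u, 0 <= qform H u) -> 0 <= qmin H S x.
Proof. by move=> h; apply: le_bigmin. Qed.

Lemma continuous_minr (T : topologicalType) (f g : T -> R) :
  continuous f -> continuous g -> continuous (fun x => Num.min (f x) (g x)).
Proof. by move=> cf cg x; apply: continuous_min; [exact: cf|exact: cg]. Qed.

Lemma continuous_qmin n (H : 'M[R]_n) S : continuous (qmin H S).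
Proof.
rewrite /qmin; move: (head 0 S) => a; elim: S => [|t S IH].
  rewrite (_ : (fun _ => _) = (fun x => qform H (x - a))); last by apply/funext => x; rewrite big_nil.
  exact/continuous_qform/continuous_sub_cst.
rewrite (_ : (fun _ => _) = (fun x => Num.min (qform H (x - t))
    (\big[Num.min/qform H (x - a)]_(s <- S) qform H (x - s)))); last first.
  by apply/funext => x; rewrite big_cons.
apply: continuous_minr; last exact: IH.
exact: (continuous_qform (@continuous_sub_cst _ t)).
Qed.

Lemma borel_measurable_gt n (f : borel n -> R) :
  (forall a, measurable ([set x | a < f x] : set (borel n))) -> measurable_fun setT f.
Proof.
move=> h; apply: (measurability _ (RGenOInfty.measurableE R)) => // _ [_ [a ->] <-].
rewrite setTI; have := h a; congr (measurable _).
by apply/seteqP; split => x /=; rewrite in_itv/= andbT.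
Qed.

Lemma borel_continuous n (f : 'rV[R]_n -> R) : continuous f ->
  measurable_fun setT (f : borel n -> R).
Proof.
move=> cf; apply: borel_measurable_gt => a; apply: open_borel.
apply: (@open_comp _ _ f [set t | a < t]); last exact: open_gt.
by move=> x _; exact: cf.
Qed.

Lemma measurable_qmin n (p : R) (H : 'M[R]_n) S :
  measurable_fun setT ((fun x => (qmin H S x `^ p)%:E) : borel n -> \bar R).
Proof.
apply/measurable_EFinP; apply: (measurableT_comp (measurable_powR p)).
by apply: borel_continuous; exact: continuous_qmin.
Qed.

Definition qerr (p : R) n (H : 'M[R]_n) (S : seq 'rV[R]_n) : R :=
  fine (\int[leb n]_(x in @unit_cube R n) (qmin H S x `^ p)%:E)%E.

Lemma qerrE (p : R) n (H : 'M[R]_n) S : 0 <= p -> S != [::] -> (forall u, 0 <= qform H u) ->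
  (\int[leb n]_(x in @unit_cube R n) (qmin H S x `^ p)%:E = (qerr p H S)%:E)%E.
Proof.
move=> p0 S0 H0; rewrite /qerr fineK// ge0_fin_numE; last first.
  by apply: integral_ge0 => x _; rewrite lee_fin powR_ge0.
pose K := (\sum_j \sum_i `|H i j|) * (1 + `|head 0 S|) ^+ 2.
have mC := @measurable_unit_cube R n.
have K0 : 0 <= \sum_j \sum_i `|H i j| by apply: sumr_ge0 => j _; exact: sumr_ge0.
apply: (@le_lt_trans _ _ (\int[leb n]_(x in @unit_cube R n) (K `^ p)%:E)%E).
  apply: ge0_le_integral => //.
  - by move=> x _; rewrite lee_fin powR_ge0.
  - exact: measurable_funTS (measurable_qmin _ _ _).
  move=> x Cx; rewrite lee_fin; apply: ge0_ler_powR => //; rewrite ?nnegrE ?qmin_ge0//.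
    by rewrite mulr_ge0// sqr_ge0.
  have hs : head 0 S \in S by case: (S) S0 => // a r _; rewrite inE eqxx.
  apply: (le_trans (qmin_le _ _ hs)); apply: (le_trans (qform_le _ _)).
  rewrite ler_wpM2l// lerXn2r ?nnegrE ?addr_ge0//.
  apply: (le_trans (ler_normB _ _)); rewrite lerD2r; apply/row_norm_le => // i.
  by have /andP[h1 h2] := Cx i; rewrite ger0_norm// ltW.
by rewrite integral_cst//= leb_unit_cube mule1 ltry.
Qed.

Lemma qerr_ge0 (p : R) n (H : 'M[R]_n) S : 0 <= qerr p H S.
Proof. by apply: fine_ge0; apply: integral_ge0 => x _; rewrite lee_fin powR_ge0. Qed.

Lemma qform_id n (u : 'rV[R]_n) : qform 1%:M u = dot u u.
Proof. by rewrite /qform mulmx1. Qed.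

Lemma dot_ge0 n (u : 'rV[R]_n) : 0 <= dot u u.
Proof. by rewrite dotE; apply: sumr_ge0 => i _; rewrite -expr2 sqr_ge0. Qed.

(** Packing estimate, the source of lower bounds: the pieces may leave part of [D] uncovered. *)
Lemma sum_integral_disjoint n (I : eqType) (Z : seq I) (B : I -> set 'rV[R]_n)
    (D : set 'rV[R]_n) (f : borel n -> \bar R) :
  uniq Z -> (forall z, measurable (B z : set (borel n))) -> measurable (D : set (borel n)) ->
  (forall z z' x, z \in Z -> z' \in Z -> B z x -> B z' x -> z = z') ->
  (forall z, z \in Z -> B z `<=` D) ->
  measurable_fun setT f -> (forall x, 0 <= f x)%E ->
  (\sum_(z <- Z) \int[leb n]_(x in B z) f x <= \int[leb n]_(x in D) f x)%E.
Proof.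
move=> uZ mB mD dj BD mf f0.
have mr (E : set 'rV[R]_n) : measurable (E : set (borel n)) -> measurable_fun setT (f \_ E : borel n -> \bar R).
  by move=> mE; apply/(measurable_restrictT _ mE); exact: measurable_funTS.
have r0 (E : set 'rV[R]_n) x : (0 <= (f \_ E) x)%E by rewrite patchE; case: ifP.
under eq_bigr do rewrite integral_mkcond.
rewrite -ge0_integral_sum//; last by move=> z; exact: mr.
rewrite [leRHS]integral_mkcond; apply: ge0_le_integral => //.
- by move=> x _; exact: sume_ge0.
- by apply: emeasurable_sum => z; exact: mr.
- exact: mr.
move=> x _; have [[z0 zZ Bz0]|hno] := pselect (exists2 z, z \in Z & B z x); last first.
  rewrite big1_seq ?r0// => z /andP[_ zZ]; rewrite patchE memNset// => Bz.
  by apply: hno; exists z.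
rewrite (bigD1_seq z0)//= big1_seq ?adde0.
  rewrite !patchE !mem_set//; exact: BD Bz0.
move=> z /andP[zz0 zZ']; rewrite patchE memNset// => Bz.
by move/eqP: zz0; apply; exact: dj Bz Bz0.
Qed.

(** Covering estimate, the source of upper bounds: the pieces may overlap or stick out of [D], and
    each has its own majorant, which has to dominate [f] only at the points assigned to that
    piece. *)
Lemma integral_le_cover n (I : eqType) (Z : seq I) (B : I -> set 'rV[R]_n)
    (D : set 'rV[R]_n) (f : borel n -> \bar R) (g : I -> borel n -> \bar R) :
  (forall z, measurable (B z : set (borel n))) -> measurable (D : set (borel n)) ->
  measurable_fun (D : set (borel n)) f -> (forall x, 0 <= f x)%E ->
  (forall z, measurable_fun setT (g z)) -> (forall z x, 0 <= g z x)%E ->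
  (forall x, D x -> exists z, [/\ z \in Z, B z x & (f x <= g z x)%E]) ->
  (\int[leb n]_(x in D) f x <= \sum_(z <- Z) \int[leb n]_(x in B z) g z x)%E.
Proof.
move=> mB mD mf f0 mg g0 h.
have mr z : measurable_fun setT (g z \_ (B z) : borel n -> \bar R).
  by apply/(measurable_restrictT _ (mB z)); exact: measurable_funTS.
have r0 z x : (0 <= (g z \_ (B z)) x)%E by rewrite patchE; case: ifP.
under [leRHS]eq_bigr do rewrite integral_mkcond.
rewrite -ge0_integral_sum//.
rewrite [leLHS]integral_mkcond; apply: ge0_le_integral => //.
- by move=> x _; rewrite patchE; case: ifP.
- exact/(measurable_restrictT _ mD).
- exact: emeasurable_sum.
move=> x _; rewrite patchE; case: ifPn => [/set_mem Dx|_]; last exact: sume_ge0.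
have [z [zZ Bz fg]] := h x Dx.
have -> : (\sum_(z <- Z) (g z \_ (B z)) x = (g z \_ (B z)) x + \sum_(z <- rem z Z) (g z \_ (B z)) x)%E.
  by rewrite (perm_big _ (perm_to_rem zZ)) big_cons.
rewrite {1}patchE mem_set//; apply: (le_trans fg).
by rewrite leeDl//; exact: sume_ge0.
Qed.

Lemma mulmx_norm_le n (A : 'M[R]_n) (x : 'rV[R]_n) :
  `|x *m A| <= (\sum_i \sum_j `|A i j|) * `|x|.
Proof.
have h0 : 0 <= \sum_i \sum_j `|A i j| by apply: sumr_ge0 => j _; exact: sumr_ge0.
apply/row_norm_le; first exact: mulr_ge0.
move=> j; rewrite mxE; apply: (le_trans (ler_norm_sum _ _ _)).
rewrite mulr_suml; apply: ler_sum => i _.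
rewrite normrM mulrC ler_pM//; last exact: coord_le_norm.
by rewrite (bigD1 j)//= lerDl; exact: sumr_ge0.
Qed.

Lemma continuous_mulmx n (A : 'M[R]_n) : continuous (fun x : 'rV[R]_n => x *m A).
Proof.
apply: continuous_row => j.
rewrite (_ : (fun _ => _) = (fun y : 'rV[R]_n => \sum_i y ord0 i * A i j)); last first.
  by apply/funext => y; rewrite mxE.
apply: continuous_sum => i; apply: continuous_mul; last exact: cst_continuous.
exact: coord_continuous.
Qed.

Lemma unit_cube_norm n (u : 'rV[R]_n) : unit_cube u -> `|u| <= 1.
Proof.
move=> Cu; apply/row_norm_le => // i.
by have /andP[h1 h2] := Cu i; rewrite ger0_norm// ltW.
Qed.

Lemma unit_cube_dist n (u u' : 'rV[R]_n) : unit_cube u -> unit_cube u' -> `|u - u'| <= 1.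
Proof.
move=> Cu Cu'; apply/row_norm_le => // i; rewrite !mxE ler_norml.
by have /andP[? ?] := Cu i; have /andP[? ?] := Cu' i; apply/andP; split; lra.
Qed.

End Quantizers.

(** * Tiling by small quantizers and the quantization constant *)

Section Zador.
Context {R : realType}.
Notation borel := (borel R).

Lemma qform_psdM n (H A : 'M[R]_n) : (forall u, 0 <= qform H u) ->
  forall u, 0 <= qform (A *m H *m A^T) u.
Proof. by move=> h u; rewrite -qformM. Qed.

Lemma leb_affine_cube n (a : 'rV[R]_n) (r : R) : 0 < r ->
  measurable ([set x | unit_cube (r^-1 *: (x - a))] : set (borel n)) /\
  leb n [set x | unit_cube (r^-1 *: (x - a))] = (r ^+ n)%:E.
Proof.
move=> r0.
have m : measurable ([set x | unit_cube (r^-1 *: (x - a))] : set (borel n)).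
  have rV : 0 < r^-1 by rewrite invr_gt0.
  have [c _ _] := scales_comp (scales_mul n rV) (scales_shift (- a)).
  have := measurable_borel_continuous c measurableT (@measurable_unit_cube R n).
  by rewrite setTI.
split=> //; rewrite (scales_measure (scales_affine a r0) m).
rewrite (_ : _ @^-1` _ = @unit_cube R n) ?leb_unit_cube ?mule1//.
apply/seteqP; split => x; rewrite /preimage/=;
  by rewrite [a + _]addrC addrK scalerA mulVf ?gt_eqF// scale1r.
Qed.

(** The unit cube is covered by parallelepipeds, images of the unit cube under the maps [T z], and
    each receives a copy of [S0]. Such a map multiplies volume by [h^n d] and pulls [H] back to
    [h^2] times [A H A^T], which gives the error of one tile; the number of tiles is bounded through
    volume. Allowing a general [A] is what later relates the constants of different forms. *)
Lemma tile_cover (p : R) n (H A : 'M[R]_n) (d h : R) (S0 : seq 'rV[R]_n) :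
  0 < p -> 0 < h -> (forall u, 0 <= qform H u) -> A \in unitmx ->
  scales (fun x => x *m A) d -> S0 != [::] ->
  exists N S, [/\ (0 < N)%N, size S = (N * size S0)%N,
    N%:R * (h ^+ n * d) <= (1 + 2 * (h * \sum_i \sum_j `|A i j|)) ^+ n &
    qerr p H S <= N%:R * (h ^+ n * d * h `^ (2 * p)) * qerr p (A *m H *m A^T) S0].
Proof.
move=> p0 h0 H0 uA sA S00.
pose T (z u : 'rV[R]_n) : 'rV[R]_n := h *: ((u + z) *m A).
have sT z : scales (T z) (h ^+ n * d).
  have := scales_comp (scales_mul n h0) (scales_comp sA (scales_shift z)).
  by rewrite mulr1.
pose W (x : 'rV[R]_n) : 'rV[R]_n := (h^-1 *: x) *m invmx A.
have hV : 0 < h^-1 by rewrite invr_gt0.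
have WT z u : W (T z u) - z = u.
  by rewrite /W /T scalerA mulVf ?gt_eqF// scale1r mulmxK// addrK.
have TW z x : T z (W x - z) = x.
  by rewrite /T subrK /W mulmxKV// scalerA mulfV ?gt_eqF// scale1r.
have cW z : continuous (fun x => W x - z).
  have [c1 _ _] := scales_mul n hV.
  move=> x; apply: (@continuous_comp _ _ _ (fun x : 'rV[R]_n => (h^-1 *: x) *m invmx A) (fun x => x - z)); last exact: continuous_sub_cst.
  apply: (@continuous_comp _ _ _ (fun x : 'rV[R]_n => h^-1 *: x) (fun x => x *m invmx A)); last exact: continuous_mulmx.
  exact: c1.
pose tile z : set 'rV[R]_n := [set x | unit_cube (W x - z)].
have mtile z : measurable (tile z : set (borel n)).
  have := measurable_borel_continuous (cW z) measurableT (@measurable_unit_cube R n).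
  by rewrite setTI.
have Ttile z : T z @^-1` tile z = @unit_cube R n.
  by apply/seteqP; split => x; rewrite /preimage/= /tile/= WT.
have [Z [uZ dZ cZ]] := @grid R n ((\sum_i \sum_j `|invmx A i j|) * h^-1).
have coverC x : unit_cube x -> exists2 z, z \in Z & tile z x.
  move=> Cx; apply: cZ; rewrite /W; apply: (le_trans (mulmx_norm_le _ _)).
  rewrite ler_wpM2l//; first by apply: sumr_ge0 => j _; exact: sumr_ge0.
  by rewrite normrZ gtr0_norm//; apply: ler_piMr; [exact: ltW|exact: unit_cube_norm].
(* Tiles that miss the cube are discarded; the remaining ones lie close to it, as the volume count
   requires. *)
pose Z' := [seq z <- Z | `[< exists x, unit_cube x /\ tile z x >]].
have uZ' : uniq Z' by rewrite filter_uniq.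
have Z'Z z : z \in Z' -> z \in Z by rewrite mem_filter => /andP[].
have coverC' x : unit_cube x -> exists2 z, z \in Z' & tile z x.
  move=> Cx; have [z zZ tz] := coverC x Cx; exists z => //.
  by rewrite mem_filter zZ andbT; apply/asboolP; exists x.
pose S := [seq T z s | z <- Z', s <- S0].
have mS z s : z \in Z' -> s \in S0 -> T z s \in S by move=> *; exact: allpairs_f.
have C0 : @unit_cube R n 0 by move=> i; rewrite mxE lexx ltr01.
have [z0 z0Z' _] := coverC' _ C0.
have S0' : S != [::].
  case: (S0) S00 mS => // s r _ /(_ z0 s z0Z'); rewrite inE eqxx => /(_ isT).
  by case: (S).
have hnd : 0 < h ^+ n * d by have [_ ] := sT 0.
exists (size Z'), S; split.
- by case: (Z') z0Z'.
- exact: size_allpairs.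
- set c := \sum_i \sum_j _.
  have c0 : 0 <= c by apply: sumr_ge0 => j _; exact: sumr_ge0.
  have r0 : 0 < 1 + 2 * (h * c) by rewrite ltr_wpDr// mulr_ge0// mulr_ge0// ltW.
  (* A tile has sup-norm diameter at most [h * c], so the tiles meeting the unit cube lie in a cube
     of side [1 + 2 h c] whose corner has all coordinates [- h c]. Being disjoint, their volumes add
     up to at most its volume. *)
  have [mbox lbox] := @leb_affine_cube n (const_mx (- (h * c))) _ r0.
  set box := [set x | _] in mbox lbox.
  have sub z : z \in Z' -> tile z `<=` box.
    rewrite mem_filter => /andP[/asboolP[x0 [Cx0 tx0]] _] x tx i; rewrite !mxE opprK.
    have : `|x - x0| <= h * c.
      rewrite -(TW z x) -(TW z x0) /T -scalerBr -mulmxBl opprD addrACA subrr addr0.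
      rewrite normrZ gtr0_norm// ler_pM2l//; apply: (le_trans (mulmx_norm_le _ _)).
      by rewrite ler_piMr//; exact: unit_cube_dist.
    have hc0 : 0 <= h * c by rewrite mulr_ge0// ltW.
    move=> /row_norm_le-/(_ hc0 i); rewrite !mxE ler_norml => /andP[e1 e2].
    have /andP[e3 e4] := Cx0 i.
    rewrite mulrC; apply/andP; split.
      by apply: divr_ge0; last exact: ltW; lra.
    by rewrite ltr_pdivrMr// mul1r; lra.
  have := @sum_integral_disjoint R n _ Z' tile box (fun=> 1%E) uZ' mtile mbox
    (fun z z' x zz zz' => dZ z z' (W x) (Z'Z _ zz) (Z'Z _ zz')) sub (measurable_cst _) (fun=> @lee01 R).
  under eq_bigr => z _.
    rewrite integral_cst// mul1e (scales_measure (sT z) (mtile z)) Ttile leb_unit_cube mule1.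
    over.
  rewrite integral_cst// mul1e lbox sumEFin lee_fin; congr (_ <= _).
  by rewrite big_const_seq count_predT iter_addr_0 mulr_natl.
set H' := A *m H *m A^T.
have H'0 : forall u, 0 <= qform H' u by exact: qform_psdM.
pose g z x : \bar R := ((h ^+ 2 * qmin H' S0 (W x - z)) `^ p)%:E.
have mg z : measurable_fun setT (g z : borel n -> \bar R).
  apply/measurable_EFinP; apply: (measurableT_comp (measurable_powR p)).
  apply: borel_continuous; apply: continuous_mul; first exact: cst_continuous.
  move=> x; apply: (@continuous_comp _ _ _ (fun x => W x - z) (qmin H' S0)); first exact: cW.
  exact: continuous_qmin.
rewrite -lee_fin -qerrE//; last exact: ltW.
have mC := @measurable_unit_cube R n.
apply: (le_trans (@integral_le_cover R n _ Z' tile (@unit_cube R n) _ g mtile mC _ _ mg _ _)).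
- by apply: measurable_funTS; exact: measurable_qmin.
- by move=> x; rewrite lee_fin powR_ge0.
- by move=> z x; rewrite lee_fin powR_ge0.
- move=> x Cx; have [z zZ tz] := coverC' x Cx; exists z; split => //.
  have q1 : 0 <= qmin H S x by exact: qmin_ge0.
  have q2 : 0 <= h ^+ 2 * qmin H' S0 (W x - z) by rewrite mulr_ge0 ?sqr_ge0 ?qmin_ge0.
  rewrite lee_fin; apply: ge0_ler_powR; rewrite ?nnegrE//; first exact: ltW.
  have [s sS0 ->] := @qmin_ex R n H' S0 (W x - z) S00.
  apply: (le_trans (qmin_le _ _ (mS z s zZ sS0))).
  rewrite -{1}(TW z x) /T -scalerBr -mulmxBl opprD addrACA subrr addr0.
  by rewrite qformZ qformM.
have E z : (\int[leb n]_(x in tile z) g z x = (h ^+ n * d * h `^ (2 * p) * qerr p H' S0)%:E)%E.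
  rewrite (scales_integral (sT z) (mtile z) (mg z)); last by move=> x; rewrite lee_fin powR_ge0.
  rewrite Ttile.
  under eq_integral => u _.
    rewrite /g WT powRM ?sqr_ge0 ?qmin_ge0// -powR_mulrn ?(ltW h0)// -powRrM EFinM.
    over.
  rewrite ge0_integralZl//.
  - by rewrite qerrE ?(ltW p0)// -!EFinM !mulrA.
  - by apply: measurable_funTS; exact: measurable_qmin.
  - by move=> x _; rewrite lee_fin powR_ge0.
  - by rewrite lee_fin powR_ge0.
under eq_bigr do rewrite E.
rewrite sumEFin lee_fin big_const_seq count_predT iter_addr_0.
by rewrite -[leLHS]mulr_natl !mulrA.
Qed.

End Zador.

(** For [H = 1%:M] this is the witness for [delta] in the theorem. The exponent [2 p / n] is the one
    that leaves the normalized error unchanged when a quantizer is replaced by rescaled copies of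
    itself on a subdivided cube. *)
Definition quantc (R : realType) (p : R) (n : nat) (H : 'M[R]_n) : R :=
  inf [set (size S)%:R `^ (2 * p / n%:R) * qerr p H S | S in [set S | S != [::]]].

Section QuantizationConstant.
Context {R : realType}.

Lemma powR_root (r : R) (n : nat) : (0 < n)%N -> 0 <= r -> (r `^ n%:R^-1) ^+ n = r.
Proof.
move=> n0 r0; rewrite -powR_mulrn ?powR_ge0// -powRrM mulVf ?powRr1//.
by rewrite pnatr_eq0 -lt0n.
Qed.

(** For given [m] the mesh is set by [h^n = theta^n k / (d m)]: the count [N h^n d <= theta^n] from
    [tile_cover] then reads [N k <= m]. The powers of [theta] pay for the tiles crossing the
    boundary of the cube. *)
Lemma tile_cover_asymptotic (p : R) n (H A : 'M[R]_n) (d theta : R) (S0 : seq 'rV[R]_n) :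
  0 < p -> (0 < n)%N -> 1 < theta -> (forall u, 0 <= qform H u) -> A \in unitmx ->
  scales (fun x => x *m A) d -> S0 != [::] ->
  exists m0 : nat, forall m, (m0 <= m)%N -> exists S, [/\ S != [::], (size S <= m)%N &
    m%:R `^ (2 * p / n%:R) * qerr p H S <=
    theta `^ (n%:R + 2 * p) * (d^-1 `^ (2 * p / n%:R) * ((size S0)%:R `^ (2 * p / n%:R) * qerr p (A *m H *m A^T) S0))].
Proof.
move=> p0 n0 th1 H0 uA sA S00.
have [_ d0 _] := sA.
have nR : 0 < n%:R :> R by rewrite ltr0n.
have th0 : 0 < theta by lra.
set k := (size S0)%:R : R.
have k0 : 0 < k by rewrite ltr0n lt0n size_eq0.
set c := \sum_i \sum_j `|A i j|.
have c0 : 0 <= c by apply: sumr_ge0 => j _; exact: sumr_ge0.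
(* Any mesh [h <= theta * eta] satisfies [1 + 2 h c <= theta]; writing [c + 1] avoids a division by
   zero. *)
pose eta := (theta - 1) / (2 * theta * (c + 1)).
have den0 : 0 < 2 * theta * (c + 1) by rewrite mulr_gt0 ?mulr_gt0//; lra.
have eta0 : 0 < eta by rewrite divr_gt0//; lra.
(* From this [m] on, [r = k / (d m)] satisfies [r^(1/n) <= eta]. *)
exists (Num.truncn (k / (d * eta ^+ n))).+1 => m hm.
have m1 : k / (d * eta ^+ n) < m%:R.
  by apply: (lt_le_trans (truncnS_gt _)); rewrite ler_nat.
have m0 : 0 < m%:R :> R by apply: le_lt_trans m1; rewrite ltW// divr_gt0// mulr_gt0// exprn_gt0.
pose r := k / (d * m%:R).
have r0 : 0 < r by rewrite divr_gt0// mulr_gt0.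
have reta : r `^ n%:R^-1 <= eta.
  rewrite -(@ler_pXn2r _ n)// ?nnegrE ?powR_ge0 ?(ltW eta0)// powR_root ?(ltW r0)//.
  rewrite /r ler_pdivrMr ?mulr_gt0// mulrCA mulrA.
  by move: m1; rewrite ltr_pdivrMr ?mulr_gt0 ?exprn_gt0// => /ltW; rewrite mulrC.
pose h := theta * r `^ n%:R^-1.
have rp : 0 < r `^ n%:R^-1 by exact: powR_gt0.
have h0 : 0 < h by rewrite mulr_gt0.
have hn : h ^+ n = theta ^+ n * r by rewrite exprMn powR_root// ltW.
have hc : 1 + 2 * (h * c) <= theta.
  have : h * c <= theta * eta * c.
    by rewrite ler_wpM2r// ler_pM2l.
  have : theta * eta * c <= theta * eta * (c + 1).
    by apply: ler_wpM2l; [rewrite mulr_ge0// ltW|rewrite lerDl].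
  have -> : theta * eta * (c + 1) = (theta - 1) / 2.
    rewrite /eta; field; apply/andP; split; apply: lt0r_neq0 => //; lra.
  move: (h * c) (theta * eta * c) => X Y; lra.
have [N [S [N0 sS hN hS]]] := @tile_cover R p n H A d h S0 p0 h0 H0 uA sA S00.
have hN' : N%:R * (h ^+ n * d) <= theta ^+ n.
  apply: (le_trans hN); rewrite lerXn2r// nnegrE ?ltW//.
  by rewrite ltr_wpDr// mulr_ge0// mulr_ge0// ltW.
have Nk : (N * size S0 <= m)%N.
  rewrite -(ler_nat R) natrM -/k.
  move: hN'; rewrite hn (_ : N%:R * (theta ^+ n * r * d) = theta ^+ n * (N%:R * k / m%:R)); last first.
    by rewrite /r; field; rewrite !gt_eqF.
  rewrite -[leRHS]mulr1 ler_pM2l ?exprn_gt0//.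
  by rewrite ler_pdivrMr// mul1r.
exists S; split.
- by rewrite -size_eq0 sS muln_eq0 negb_or -lt0n N0/= size_eq0.
- by rewrite sS.
set e0 := qerr p (A *m H *m A^T) S0 in hS *.
have e00 : 0 <= e0 by exact: qerr_ge0.
apply: (@le_trans _ _ (m%:R `^ (2 * p / n%:R) * (theta ^+ n * h `^ (2 * p) * e0))).
  rewrite ler_wpM2l ?powR_ge0//; apply: (le_trans hS).
  rewrite ler_wpM2r// mulrA ler_wpM2r ?powR_ge0//.
rewrite powRD ?(gt_eqF th0) ?implybT//.
rewrite powR_mulrn ?(ltW th0)// /h powRM ?(ltW th0) ?(ltW rp)// -powRrM.
have -> : n%:R^-1 * (2 * p) = 2 * p / n%:R by rewrite mulrC.
set al := 2 * p / n%:R.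
have E : m%:R `^ al * r `^ al = d^-1 `^ al * k `^ al.
  have dV : 0 < d^-1 by rewrite invr_gt0.
  rewrite -!powRM ?(ltW m0) ?(ltW r0) ?(ltW k0) ?(ltW dV)//; congr (_ `^ _).
  by rewrite /r; field; rewrite !gt_eqF.
move: E; rewrite [d^-1 `^ _ * (_ * _)]mulrA.
move: (m%:R `^ al) (r `^ al) (d^-1 `^ al * k `^ al) (theta ^+ n) (theta `^ (2 * p)) => a b X y z <-.
by rewrite le_eqVlt; apply/orP; left; apply/eqP; ring.
Qed.

(** Converts a strict inequality into room for a multiplicative loss [theta^e]; for [y > 0] the
    choice [theta = (kappa / y)^(1/e)] uses up the room exactly. *)
Lemma theta_exists (y kappa e : R) : 0 <= y -> y < kappa -> 0 < e ->
  exists2 theta, 1 < theta & theta `^ e * y <= kappa.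
Proof.
move=> y0 yk e0; have [->|yn] := eqVneq y 0.
  by exists 2; [lra|rewrite mulr0 ltW// (le_lt_trans y0)].
have yp : 0 < y by rewrite lt_neqAle eq_sym yn.
have ky : 1 < kappa / y by rewrite ltr_pdivlMr// mul1r.
exists ((kappa / y) `^ e^-1).
  have one : 1 `^ e^-1 = 1 :> R by rewrite powR1.
  by rewrite -[ltLHS]one; apply: gt0_ltr_powR; rewrite ?nnegrE ?invr_gt0//; lra.
rewrite -powRrM mulVf ?gt_eqF// powRr1; last by lra.
by rewrite divfK.
Qed.

Lemma quantc_has_inf (p : R) n (H : 'M[R]_n) :
  has_inf [set (size S)%:R `^ (2 * p / n%:R) * qerr p H S | S in [set S | S != [::]]].
Proof.
split; first by eexists; exists [:: 0].
by exists 0 => _ [S _ <-]; rewrite mulr_ge0 ?powR_ge0 ?qerr_ge0.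
Qed.

Lemma quantc_le (p : R) n (H : 'M[R]_n) S : S != [::] ->
  quantc p H <= (size S)%:R `^ (2 * p / n%:R) * qerr p H S.
Proof. by move=> S0; apply: ge_inf; [have [] := quantc_has_inf p H|exists S]. Qed.

Lemma quantc_ge0 (p : R) n (H : 'M[R]_n) : 0 <= quantc p H.
Proof.
apply: lb_le_inf; first by have [] := quantc_has_inf p H.
by move=> _ [S _ <-]; rewrite mulr_ge0 ?powR_ge0 ?qerr_ge0.
Qed.

Lemma quantc_lt (p : R) n (H : 'M[R]_n) kappa : quantc p H < kappa ->
  exists2 S, S != [::] & (size S)%:R `^ (2 * p / n%:R) * qerr p H S < kappa.
Proof.
move=> hk; have e0 : 0 < kappa - quantc p H by lra.
have [_ [S S0 <-]] := inf_adherent e0 (quantc_has_inf p H).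
by rewrite -/(quantc p H) subrKC; exists S.
Qed.

Lemma scales_mulmx1 n : scales (fun x : 'rV[R]_n => x *m 1%:M) 1.
Proof.
rewrite (_ : (fun _ => _) = id); first exact: scales_id.
by apply/funext => x; rewrite mulmx1.
Qed.

(** A single nearly optimal quantizer, tiled with [A = 1], serves every large [m]; this is how the
    infimum becomes a limit. *)
Lemma quantc_upper (p : R) n (H : 'M[R]_n) kappa : 0 < p -> (0 < n)%N ->
  (forall u, 0 <= qform H u) -> quantc p H < kappa ->
  exists m0 : nat, forall m, (m0 <= m)%N -> exists S, [/\ S != [::], (size S <= m)%N &
    m%:R `^ (2 * p / n%:R) * qerr p H S <= kappa].
Proof.
move=> p0 n0 H0 /quantc_lt[S0 S00 hk].
have y0 : 0 <= (size S0)%:R `^ (2 * p / n%:R) * qerr p H S0 by rewrite mulr_ge0 ?powR_ge0 ?qerr_ge0.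
have nR : 0 < n%:R :> R by rewrite ltr0n.
have e0 : 0 < n%:R + 2 * p by lra.
have [theta th1 hth] := theta_exists y0 hk e0.
have [m0 h] := @tile_cover_asymptotic p n H 1%:M 1 theta S0 p0 n0 th1 H0 (unitmx1 _ _) (scales_mulmx1 n) S00.
exists m0 => m /h[S [S1 S2 S3]]; exists S; split; [exact: S1|exact: S2|].
by apply: le_trans hth; apply: (le_trans S3); rewrite invr1 powR1 mul1r trmx1 mulmx1 mul1mx.
Qed.

(** A quantizer for [A H A^T] is carried by [A] to a tile and repeated into a quantizer for [H],
    with [theta] as close to [1] as wished. This gives one inequality; [invmx A] gives the other. *)
Lemma quantc_scale_le (p : R) n (H A : 'M[R]_n) d : 0 < p -> (0 < n)%N ->
  (forall u, 0 <= qform H u) -> A \in unitmx -> scales (fun x => x *m A) d ->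
  d `^ (2 * p / n%:R) * quantc p H <= quantc p (A *m H *m A^T).
Proof.
move=> p0 n0 H0 uA sA; have [_ d0 _] := sA.
apply: lb_le_inf; first by have [] := quantc_has_inf p (A *m H *m A^T).
move=> _ [S0 S00 <-]; set y := _ * qerr _ _ _.
have y0 : 0 <= y by rewrite mulr_ge0 ?powR_ge0 ?qerr_ge0.
have nR : 0 < n%:R :> R by rewrite ltr0n.
have e0 : 0 < n%:R + 2 * p by lra.
set al := 2 * p / n%:R.
have al0 : 0 <= al by rewrite divr_ge0 ?mulr_ge0 ?ltW.
have dVal : 0 < d^-1 `^ al by apply: powR_gt0; rewrite invr_gt0.
suff : quantc p H <= d^-1 `^ al * y.
  move=> hq; have := ler_wpM2l (powR_ge0 d al) hq.
  by rewrite mulrA -powRM ?invr_ge0 ?(ltW d0)// mulfV ?gt_eqF// powR1 mul1r.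
apply/ler_addgt0Pr => e e1.
have yk : d^-1 `^ al * y < d^-1 `^ al * y + e by lra.
have [theta th1 hth] := theta_exists (mulr_ge0 (ltW dVal) y0) yk e0.
have [m0 h] := @tile_cover_asymptotic p n H A d theta S0 p0 n0 th1 H0 uA sA S00.
have [S [S1 S2 S3]] := h m0 (leqnn _).
apply: (le_trans (quantc_le p H S1)); apply: le_trans hth; apply: le_trans S3.
rewrite ler_wpM2r ?qerr_ge0//; apply: ge0_ler_powR => //; rewrite ?nnegrE ?ler0n//.
by rewrite ler_nat.
Qed.

Lemma quantc_scale (p : R) n (H A : 'M[R]_n) d : 0 < p -> (0 < n)%N ->
  (forall u, 0 <= qform H u) -> A \in unitmx -> scales (fun x => x *m A) d ->
  quantc p (A *m H *m A^T) = d `^ (2 * p / n%:R) * quantc p H.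
Proof.
move=> p0 n0 H0 uA sA; have [_ d0 _] := sA.
apply/eqP; rewrite eq_le (quantc_scale_le p0 n0 H0 uA sA) andbT.
have sV : scales (fun x : 'rV[R]_n => x *m invmx A) d^-1.
  apply: scales_inv sA; last exact: continuous_mulmx.
  by move=> x; rewrite mulmxK.
have uV : invmx A \in unitmx by rewrite unitmx_inv.
have := quantc_scale_le p0 n0 (qform_psdM A H0) uV sV.
have -> : invmx A *m (A *m H *m A^T) *m (invmx A)^T = H.
  by rewrite !mulmxA mulVmx// mul1mx -mulmxA -trmx_mul mulVmx// trmx1 mulmx1.
set al := 2 * p / n%:R.
move=> hq; have := ler_wpM2l (powR_ge0 d al) hq.
by rewrite mulrA -powRM ?invr_ge0 ?(ltW d0)// mulfV ?gt_eqF// powR1 mul1r.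
Qed.

Lemma qform_block k (hu a : 'M[R]_1) (hr w : 'M[R]_(1, k)) (hd : 'M[R]_k) :
  @qform R (1 + k) (block_mx hu hr hr^T hd) (row_mx a w) =
  (a *m hu *m a^T + w *m hr^T *m a^T + (a *m hr *m w^T + w *m hd *m w^T)) ord0 ord0.
Proof. by rewrite /qform mul_row_block tr_row_mx mul_row_col !mulmxDl. Qed.

Lemma block_upper_gram k (a : R) (b : 'M[R]_(1, k)) (L : 'M[R]_k) :
  (block_mx a%:M b 0 L : 'M[R]_(1 + k)) *m (block_mx a%:M b 0 L)^T =
  block_mx ((a * a)%:M + b *m b^T) (b *m L^T) (L *m b^T) (L *m L^T).
Proof.
by rewrite tr_block_mx trmx0 mulmx_block !mul0mx !mulmx0 !add0r tr_scalar_mx scalar_mxM.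
Qed.

(** Right multiplication by an upper triangular matrix has the shape treated by [scales_cons]. *)
Lemma cons_row_block k (a : R) (b : 'M[R]_(1, k)) (L : 'M[R]_k) (x : 'rV[R]_(1 + k)) :
  cons_row (a * x ord0 ord0) (x ord0 ord0 *: b + row_tail x *m L) =
  x *m (block_mx a%:M b 0 L : 'M[R]_(1 + k)).
Proof.
rewrite -[in RHS](@hsubmxK _ 1 1 k x) mul_row_block mulmx0 addr0.
have E0 : (ord0 : 'I_(1 + k)) = lshift k ord0 by exact: val_inj.
apply/rowP => i; case: (unliftP ord0 i) => [j ->|->].
  rewrite cons_row_lift.
  have -> : lift ord0 j = rshift 1 (j : 'I_k) :> 'I_(1 + k) by exact: val_inj.
  apply: etrans (esym (@row_mxEr _ _ _ _ (lsubmx x *m a%:M) (lsubmx x *m b + rsubmx x *m L) 0 (j : 'I_k))).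
  rewrite mxE [in RHS]mxE; congr (_ + _).
    by rewrite !mxE big_ord1 mxE E0.
  by rewrite !mxE; apply: eq_bigr => l _; rewrite !mxE; congr (x _ _ * _); exact: val_inj.
rewrite cons_row0 [in RHS]E0.
apply: etrans (esym (@row_mxEl _ _ _ _ (lsubmx x *m a%:M) (lsubmx x *m b + rsubmx x *m L) 0 (ord0 : 'I_1))).
by rewrite !mxE big_ord1 !mxE eqxx mulr1n mulrC E0.
Qed.

(** The induction is on the lower right block, which makes the factor upper triangular, so that its
    Jacobian can be computed along with the factorization. *)
Lemma upper_cholesky n (H : 'M[R]_n) : H^T = H -> (forall u, u != 0 -> 0 < qform H u) ->
  exists A : 'M[R]_n, [/\ H = A *m A^T, 0 < \det A & scales (fun x => x *m A) (\det A)].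
Proof.
elim: n H => [|k IH] H sH pH.
  exists 1%:M; rewrite det1; split => //; last exact: scales_mulmx1.
  by apply/matrixP => -[].
pose H2 : 'M[R]_(1 + k) := H.
pose hu := ulsubmx H2; pose hr := ursubmx H2; pose hd := drsubmx H2.
have EH : H = block_mx hu hr hr^T hd :> 'M[R]_(1 + k).
  rewrite -[LHS](@submxK _ 1 k 1 k); congr block_mx.
  by rewrite /hr trmx_ursub; congr dlsubmx; rewrite sH.
have pH' (u : 'rV[R]_(1 + k)) : u != 0 -> 0 < @qform R (1 + k) (block_mx hu hr hr^T hd) u.
  by rewrite -EH; exact: pH.
have [||L [EL dL sL]] := IH hd.
- by rewrite /hd trmx_drsub; congr drsubmx; exact: sH.
- move=> u u0; have := pH' (row_mx (0 : 'M[R]_1) u).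
  rewrite qform_block !mul0mx !add0r trmx0 mulmx0 add0r; apply.
  by apply: contra u0 => /eqP E; rewrite -(row_mxKr (0 : 'M[R]_1) u) E; apply/eqP/matrixP => i j; rewrite !mxE.
have uL : L \in unitmx by rewrite unitmxE unitfE gt_eqF.
pose b : 'M[R]_(1, k) := hr *m invmx L^T.
have bL : b *m L^T = hr by rewrite /b mulmxKV// unitmx_tr.
clearbody b.
have Lb : L *m b^T = hr^T by rewrite -bL trmx_mul trmxK.
(* This Schur complement is the value of the form at [(1, - b L^-1)], hence positive; its square
   root is the new diagonal entry. *)
have a2 : 0 < hu ord0 ord0 - (b *m b^T) ord0 ord0.
  have u0 : row_mx (1%:M : 'M[R]_1) (- (b *m invmx L)) != 0 :> 'M[R]_(1, 1 + k).
    apply/eqP => E; have : (lsubmx (row_mx (1%:M : 'M[R]_1) (- (b *m invmx L)))) ord0 ord0 = 0 by rewrite E !mxE.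
    by rewrite row_mxKl mxE => /eqP; rewrite oner_eq0.
  have := pH' _ u0; rewrite qform_block !mul1mx trmx1 !mulmx1.
  have E1 : hr *m (- (b *m invmx L))^T = - (b *m b^T).
    by rewrite linearN/= mulmxN trmx_mul mulmxA -bL trmx_inv mulmxK ?unitmx_tr.
  have E2 : - (b *m invmx L) *m hr^T = - (b *m b^T).
    by rewrite mulNmx -Lb mulmxA mulmxKV.
  have E3 : - (b *m invmx L) *m hd *m (- (b *m invmx L))^T = b *m b^T.
    rewrite EL mulNmx mulmxA mulmxKV// mulNmx linearN/= mulmxN opprK.
    by rewrite trmx_mul mulmxA trmx_inv mulmxK ?unitmx_tr.
  by rewrite E1 E2 E3 addNr addr0 !mxE.
set a := Num.sqrt (hu ord0 ord0 - (b *m b^T) ord0 ord0).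
have a0 : 0 < a by rewrite sqrtr_gt0.
exists (block_mx a%:M b 0 L : 'M[R]_(1 + k)).
have dE : \det (block_mx a%:M b 0 L : 'M[R]_(1 + k)) = a * \det L by rewrite det_ublock det_scalar1.
split.
- apply: (etrans EH); apply: (etrans _ (esym (block_upper_gram a b L))).
  rewrite bL Lb -EL; congr block_mx.
  rewrite -expr2 sqr_sqrtr ?(ltW a2)//.
  rewrite [hu]mx11_scalar [b *m b^T]mx11_scalar; apply/matrixP => i j.
  by rewrite !ord1 !mxE subrK.
- by rewrite dE mulr_gt0.
rewrite dE.
have := scales_cons 0 (@scales_shift R k) (g := fun t => t *: b) _ a0 sL.
rewrite (_ : (fun _ => cons_row _ _) = (fun x : 'rV[R]_(1 + k) => x *m block_mx a%:M b 0 L)).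
  apply; apply: continuous_row => j.
  rewrite (_ : (fun _ => _) = (fun t : R => t * b ord0 j)); last by apply/funext => t; rewrite mxE.
  by apply: continuous_mul; [move=> t; exact: cvg_id|exact: cst_continuous].
apply/funext => x; rewrite addr0; exact: cons_row_block.
Qed.

Lemma quantc_det (p : R) n (H : 'M[R]_n) : 0 < p -> (0 < n)%N ->
  H^T = H -> (forall u, u != 0 -> 0 < qform H u) ->
  0 < \det H /\ quantc p H = \det H `^ (p / n%:R) * quantc p (1%:M : 'M[R]_n).
Proof.
move=> p0 n0 sH pH; have [A [EA dA sA]] := upper_cholesky sH pH.
have uA : A \in unitmx by rewrite unitmxE unitfE gt_eqF.
have dE : \det H = \det A ^+ 2 by rewrite EA det_mulmx det_tr expr2.
split; first by rewrite dE exprn_gt0.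
have := @quantc_scale p n 1%:M A _ p0 n0 _ uA sA; rewrite mulmx1 -EA => ->; last first.
  by move=> u; rewrite qform_id dot_ge0.
by rewrite dE -powR_mulrn ?(ltW dA)// -powRrM mulrA.
Qed.

End QuantizationConstant.

(** * Convex bodies: projection onto the cube, homothety, null sets *)

Section ConvexBodies.
Context {R : realType}.
Notation borel := (borel R).

Lemma unit_cube_sub n : @unit_cube R n `<=` @unit_cubec R n.
Proof. by move=> x h i; have /andP[-> /ltW] := h i. Qed.

Lemma compact_unit_cubec n : compact (@unit_cubec R n).
Proof.
have := @rV_compact R n (fun=> `[0, 1]%classic) (fun=> @segment_compact _ _ _).
by congr compact; apply/seteqP; split => x h i; have := h i; rewrite /= in_itv.
Qed.

Lemma unit_cubec_comb n (x y : 'rV[R]_n) t : unit_cubec x -> unit_cubec y -> 0 <= t <= 1 ->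
  unit_cubec (x + t *: (y - x)).
Proof.
move=> Cx Cy /andP[t0 t1] i; rewrite !mxE.
have /andP[a0 a1] := Cx i; have /andP[b0 b1] := Cy i.
by move: (x ord0 i) (y ord0 i) a0 a1 b0 b1 => a b *; apply/andP; split; nra.
Qed.

Lemma qformD n (H : 'M[R]_n) (a b : 'rV[R]_n) (t : R) :
  qform H (a + t *: b) = qform H a + t * ((a *m H *m b^T) ord0 ord0 + (b *m H *m a^T) ord0 ord0)
    + t ^+ 2 * qform H b.
Proof.
rewrite /qform linearD linearZ/= !mulmxDl !mulmxDr -!scalemxAl -!scalemxAr !mxE; ring.
Qed.

(* Keeps the points of a quantizer in the cube, where the Taylor bounds on [v] hold. *)
Lemma cube_projection n (H : 'M[R]_n) : (forall u, 0 <= qform H u) ->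
  forall s, exists s', unit_cubec s' /\
    forall x, unit_cubec x -> qform H (x - s') <= qform H (x - s).
Proof.
move=> H0 s.
have cf : {within @unit_cubec R n, continuous (fun y => qform H (y - s))}.
  apply: continuous_subspaceT.
  exact: (continuous_qform (@continuous_sub_cst R n s)).
have ne : @unit_cubec R n !=set0 by exists 0 => i; rewrite mxE lexx ler01.
have [s' /set_mem Cs' hs'] := EVT_min_rV ne (@compact_unit_cubec n) cf.
exists s'; split => // x Cx.
(* [B] is the derivative at [t = 0] of the form along the segment from [s'] to [x], so minimality of
   [s'] forces [B >= 0]; the expansion at [t = 1] then gives the claim. *)
set B := ((s' - s) *m H *m (x - s')^T) ord0 ord0 + ((x - s') *m H *m (s' - s)^T) ord0 ord0.
have key t : 0 <= t <= 1 -> 0 <= t * B + t ^+ 2 * qform H (x - s').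
  move=> ht; have := hs' _ (mem_set (unit_cubec_comb Cs' Cx ht)).
  by rewrite addrAC qformD -/B -addrA lerDl.
have B0 : 0 <= B.
  rewrite leNgt; apply/negP => Bn.
  have q0 := H0 (x - s'); move: (qform H (x - s')) q0 key => q q0 key.
  have d0 : 0 < q - B by lra.
  (* At this [t] the quadratic polynomial equals [B^3 / (q - B)^2], which is negative if [B < 0]. *)
  have t01 : 0 <= - B / (q - B) <= 1.
    by apply/andP; split; [apply: divr_ge0; lra|rewrite ler_pdivrMr// mul1r; lra].
  have := key _ t01; rewrite (_ : _ + _ = (- B) * (- B) * B / (q - B) ^+ 2); last by field; lra.
  rewrite leNgt => /negP; apply; rewrite pmulr_llt0 ?invr_gt0 ?exprn_gt0//.
  by rewrite pmulr_rlt0// mulr_gt0; lra.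
have := qformD H (s' - s) (x - s') 1; rewrite -/B !scale1r !mul1r expr1n mul1r.
rewrite [s' - s + _]addrC addrA subrK => ->.
by rewrite lerDr addr_ge0.
Qed.

Lemma qerr_le (p : R) n (H : 'M[R]_n) S S' : 0 <= p -> (forall u, 0 <= qform H u) ->
  S != [::] -> S' != [::] -> (forall x, unit_cube x -> qmin H S' x <= qmin H S x) ->
  qerr p H S' <= qerr p H S.
Proof.
move=> p0 H0 S0 S0' h; apply: fine_le.
- by rewrite (qerrE p0 S0' H0).
- by rewrite (qerrE p0 S0 H0).
apply: ge0_le_integral; first exact: measurable_unit_cube.
- by move=> x _; rewrite lee_fin powR_ge0.
- by apply: measurable_funTS; exact: measurable_qmin.
- by apply: measurable_funTS; exact: measurable_qmin.
move=> x Cx; rewrite lee_fin; apply: ge0_ler_powR => //; last exact: h.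
- by rewrite nnegrE; exact: qmin_ge0.
- by rewrite nnegrE; exact: qmin_ge0.
Qed.

Lemma quantc_upper_cube (p : R) n (H : 'M[R]_n) kappa : 0 < p -> (0 < n)%N ->
  (forall u, 0 <= qform H u) -> quantc p H < kappa ->
  exists m0 : nat, forall m, (m0 <= m)%N -> exists S, [/\ S != [::], (size S <= m)%N,
    (forall s, s \in S -> unit_cubec s) & m%:R `^ (2 * p / n%:R) * qerr p H S <= kappa].
Proof.
move=> p0 n0 H0 hk; have [m0 h] := quantc_upper p0 n0 H0 hk.
have /choice[pr hpr] := cube_projection H0.
exists m0 => m /h[S [S0 S1 S2]]; exists (map pr S).
have S0' : map pr S != [::] by rewrite -size_eq0 size_map size_eq0.
split; [exact: S0'|by rewrite size_map| |].
  by move=> _ /mapP[s _ ->]; have [] := hpr s.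
apply: le_trans S2; apply: ler_wpM2l; first exact: powR_ge0.
apply: qerr_le => //; first exact: ltW.
move=> x Cx.
have [s sS ->] := @qmin_ex R n H S x S0.
apply: (le_trans (qmin_le _ _ (map_f pr sS))).
by have [_ ] := hpr s; apply; exact: unit_cube_sub.
Qed.

Lemma lipschitzE n (X : set 'rV[R]_n) (v : 'rV[R]_n -> R) : [lipschitz v x | x in X] ->
  exists2 k, 0 < k & forall x y, X x -> X y -> `|v x - v y| <= k * `|x - y|.
Proof.
move=> /pinfty_ex_gt0[k k0 h]; exists k => // x y Xx Xy.
by have := h (x, y); apply; split.
Qed.

Lemma compact_norm_bound n (X : set 'rV[R]_n) : compact X ->
  exists2 b, 0 < b & forall x, X x -> `|x| < b.
Proof.
move=> /compact_bounded/ex_strict_bound_gt0[b b0 h]; exists b => // x Xx; exact: h.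
Qed.

Lemma row_hausdorff n : hausdorff_space 'rV[R]_n.
Proof. exact: norm_hausdorff. Qed.

Lemma compact_borel n (X : set 'rV[R]_n) : compact X -> measurable (X : set (borel n)).
Proof. by move=> cX; apply: closed_borel; apply: compact_closed => //; exact: row_hausdorff. Qed.

Lemma leb_bounded n (X : set 'rV[R]_n) b : measurable (X : set (borel n)) ->
  (forall x, X x -> `|x| < b) -> (leb n X < +oo)%E.
Proof.
move=> mX h; apply: (le_lt_trans _ (leb_ball_fin n b)).
apply: le_measure; rewrite ?inE//; first by apply: open_borel; exact: ball_open.
by move=> x /h hx; rewrite -ball_normE /ball_/= sub0r normrN.
Qed.

Lemma leb_compact n (X : set 'rV[R]_n) : compact X -> exists2 a, leb n X = a%:E & 0 <= a.
Proof.
move=> coX; have [b b0 hb] := compact_norm_bound coX.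
have f : leb n X \is a fin_num.
  by rewrite ge0_fin_numE ?measure_ge0//; exact: leb_bounded (compact_borel coX) hb.
by exists (fine (leb n X)); rewrite ?fineK// fine_ge0 ?measure_ge0.
Qed.

(** The homothetic copy of [X] with centre [x0] and ratio [r], written as a preimage so that
    closedness and volume follow from the affine map [y |-> x0 + r^-1 (y - x0)]. *)
Definition shrink n (X : set 'rV[R]_n) (x0 : 'rV[R]_n) (r : R) : set 'rV[R]_n :=
  [set y | X (x0 + r^-1 *: (y - x0))].

Lemma shrink_comb n (x0 z y : 'rV[R]_n) (r : R) : r != 0 -> z = x0 + r^-1 *: (y - x0) ->
  y = (1 - r) *: x0 + (1 - (1 - r)) *: z.
Proof.
move=> r0 ->; apply/rowP => i; rewrite !mxE.
by move: (y ord0 i) (x0 ord0 i) => a b; field.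
Qed.

Lemma shrink_interior n (X : set 'rV[R]_n) x0 r :
  convex_set (X : set (convex_lmodType 'rV[R]_n)) -> interior X x0 -> 0 < r < 1 ->
  shrink X x0 r `<=` interior X.
Proof.
move=> cX Xx0 /andP[r0 r1] y Xy.
have r0' : r != 0 by rewrite gt_eqF.
have E := shrink_comb r0' (erefl (x0 + r^-1 *: (y - x0))).
rewrite {1}E; clear E.
by apply: interior_convex_comb => //; apply/andP; split; lra.
Qed.

Lemma shrink_scales n (x0 : 'rV[R]_n) r : 0 < r ->
  scales (fun y => x0 + r^-1 *: (y - x0)) (r^-1 ^+ n).
Proof.
move=> r0; have rV : 0 < r^-1 by rewrite invr_gt0.
have := scales_comp (scales_affine x0 rV) (scales_shift (- x0)).
by rewrite mulr1.
Qed.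

Lemma closed_shrink n (X : set 'rV[R]_n) x0 r : 0 < r -> closed X -> closed (shrink X x0 r).
Proof.
move=> r0 cX; have [c _ _] := shrink_scales x0 r0.
by apply: (@preimage_closed _ _ _ X) => // x _; exact: c.
Qed.

Lemma leb_shrink n (X : set 'rV[R]_n) x0 r : measurable (X : set (borel n)) -> 0 < r ->
  leb n (shrink X x0 r) = ((r ^+ n)%:E * leb n X)%E.
Proof.
move=> mX r0; rewrite (scales_measure (shrink_scales x0 r0) mX) muleA -EFinM.
by rewrite -exprMn divff ?gt_eqF// expr1n mul1e.
Qed.

Lemma shrink_mono n (X : set 'rV[R]_n) x0 r s :
  convex_set (X : set (convex_lmodType 'rV[R]_n)) -> X x0 -> 0 < r -> r <= s ->
  shrink X x0 r `<=` shrink X x0 s.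
Proof.
move=> cX Xx0 r0 rs y Xy; have s0 : 0 < s by lra.
rewrite /shrink/=.
have -> : x0 + s^-1 *: (y - x0) = (r / s) *: (x0 + r^-1 *: (y - x0)) + (1 - r / s) *: x0.
  apply/rowP => i; rewrite !mxE; move: (y ord0 i) (x0 ord0 i) => a b.
  by field; rewrite !gt_eqF.
apply: convex_setE => //; apply/andP; split; first by rewrite divr_ge0 ?ltW.
by rewrite ler_pdivrMr// mul1r.
Qed.

Lemma shrink_exhaust n (X : set 'rV[R]_n) x0 x : interior X x ->
  exists2 r, 0 < r < 1 & shrink X x0 r x.
Proof.
move=> /interior_ball[e e0 h].
pose q := 1 + e / (2 * (`|x - x0| + e)).
have d0 : 0 < `|x - x0| + e by rewrite ltr_wpDl.
have q1 : 1 < q by rewrite ltrDl divr_gt0// mulr_gt0.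
have q0 : 0 < q by lra.
exists q^-1; first by rewrite invr_gt0 q0 invf_lt1.
rewrite /shrink/= invrK; apply: h.
have -> : x0 + q *: (x - x0) - x = (q - 1) *: (x - x0).
  by apply/rowP => i; rewrite !mxE; ring.
rewrite normrZ ger0_norm; last by lra.
rewrite /q addrC addKr mulrAC ltr_pdivrMr ?mulr_gt0// ltr_pM2l//.
by have := normr_ge0 (x - x0); lra.
Qed.

(** The weight missing from [1] sits at [x0]. One weight is split off at a time and the others are
    divided by [1 - l i], so a weight equal to [1] is treated apart. *)
Lemma convex_sum n (X : set 'rV[R]_n) (I : eqType) (r : seq I) (u : I -> 'rV[R]_n) x0 :
  convex_set (X : set (convex_lmodType 'rV[R]_n)) -> X x0 -> (forall i, X (x0 + u i)) ->
  forall l : I -> R, (forall i, 0 <= l i) -> \sum_(i <- r) l i <= 1 ->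
  X (x0 + \sum_(i <- r) l i *: u i).
Proof.
move=> cX Xx0 Xu; elim: r => [|i r IH] l l0; first by rewrite !big_nil addr0.
rewrite !big_cons => hl.
have s0 : 0 <= \sum_(j <- r) l j by exact: sumr_ge0.
have [l1|l1] := eqVneq (l i) 1.
  have z : \sum_(j <- r) l j = 0 by lra.
  have -> : \sum_(j <- r) l j *: u j = 0.
    move/eqP: z; rewrite psumr_eq0// => /allP z.
    by apply: big1_seq => j /andP[_ /z]/= /eqP ->; rewrite scale0r.
  by rewrite l1 scale1r addr0.
have li1 : 0 < 1 - l i by rewrite subr_gt0 lt_neqAle l1/=; lra.
have -> : x0 + (l i *: u i + \sum_(j <- r) l j *: u j) =
    l i *: (x0 + u i) + (1 - l i) *: (x0 + \sum_(j <- r) (l j / (1 - l i)) *: u j).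
  have -> : \sum_(j <- r) (l j / (1 - l i)) *: u j = (1 - l i)^-1 *: \sum_(j <- r) l j *: u j.
    by rewrite scaler_sumr; apply: eq_bigr => j _; rewrite scalerA mulrC.
  rewrite !scalerDr scalerA divff ?gt_eqF// scale1r.
  by rewrite addrACA -scalerDl subrKC scale1r addrA.
apply: convex_setE => //; last by rewrite l0/=; lra.
apply: IH => [j|]; first by rewrite divr_ge0// ltW.
by rewrite -mulr_suml ler_pdivrMr// mul1r; lra.
Qed.

(** [X] contains the simplex with vertices [x0] and [x0 + row i B]; the point is its barycentre. *)
Lemma unitmx_interior n (X : set 'rV[R]_n) x0 (B : 'M[R]_n) :
  convex_set (X : set (convex_lmodType 'rV[R]_n)) -> X x0 -> B \in unitmx ->
  (forall i, X (x0 + row i B)) -> interior X (x0 + (const_mx n.+1%:R^-1) *m B).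
Proof.
move=> cX Xx0 uB XB; apply/interior_ball.
set c := \sum_i \sum_j `|invmx B i j|.
have c0 : 0 <= c by apply: sumr_ge0 => j _; exact: sumr_ge0.
have N0 : 0 < n.+1%:R :> R by rewrite ltr0n.
(* Within [e] each barycentric coordinate moves by at most [(n + 1)^-2]: it stays nonnegative, and
   the coordinates add up to at most [n (1 / (n + 1) + 1 / (n + 1)^2) = 1 - (n + 1)^-2]. *)
pose e := (n.+1%:R ^+ 2 * (c + 1))^-1.
have e0 : 0 < e by rewrite invr_gt0 mulr_gt0 ?exprn_gt0//; lra.
exists e => // y hy.
pose l : 'rV[R]_n := (y - x0) *m invmx B.
have El : y = x0 + \sum_i l ord0 i *: row i B.
  by rewrite -mulmx_sum_row /l mulmxKV// addrC subrK.
have hl i : `|l ord0 i - n.+1%:R^-1| <= (n.+1%:R ^+ 2)^-1.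
  have -> : l ord0 i - n.+1%:R^-1 = ((y - (x0 + const_mx n.+1%:R^-1 *m B)) *m invmx B) ord0 i.
    by rewrite opprD addrA mulmxBl mulmxK// [in RHS]mxE /l; congr (_ + _); rewrite !mxE.
  apply: (le_trans (coord_le_norm _ _)); apply: (le_trans (mulmx_norm_le _ _)).
  apply: (@le_trans _ _ (c * e)); first by rewrite ler_wpM2l// ltW.
  rewrite /e invfM mulrCA -[leRHS]mulr1 ler_wpM2l ?invr_ge0 ?sqr_ge0//.
  by rewrite ler_pdivrMr ?mul1r; lra.
have Ne : (n.+1%:R ^+ 2)^-1 <= n.+1%:R^-1 :> R.
  by rewrite lef_pV2 ?posrE ?exprn_gt0// expr2 ler_pMr// ler1n.
rewrite El; apply: convex_sum => // [i|].
  have := hl i; rewrite ler_norml => /andP[h1 _].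
  by move: (l ord0 i) (n.+1%:R^-1 : R) ((n.+1%:R ^+ 2)^-1 : R) Ne h1 => t a b; lra.
apply: (@le_trans _ _ (\sum_(i < n) (n.+1%:R^-1 + (n.+1%:R ^+ 2)^-1))).
  apply: ler_sum => i _; have := hl i; rewrite ler_norml => /andP[_ h2].
  by move: (l ord0 i) (n.+1%:R^-1 : R) ((n.+1%:R ^+ 2)^-1 : R) Ne h2 => t a b; lra.
rewrite sumr_const card_ord -[leLHS]mulr_natl.
have -> : n%:R = n.+1%:R - 1 :> R by rewrite -natr1 addrK.
move: (n.+1%:R : R) N0 => N N0.
have -> : (N - 1) * (N^-1 + (N ^+ 2)^-1) = 1 - (N ^+ 2)^-1 by field; rewrite gt_eqF.
by rewrite gerBl invr_ge0 sqr_ge0.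
Qed.

(* A convex set with empty interior spans a proper affine subspace, hence has
   arbitrarily many disjoint translates inside one ball. *)
Lemma convex_null n (X : set 'rV[R]_n) :
  convex_set (X : set (convex_lmodType 'rV[R]_n)) -> compact X -> interior X = set0 ->
  leb n X = 0%E.
Proof.
move=> cX coX iX; have mX := compact_borel coX.
have [[x0 Xx0]|/set0P/negP] := pselect (X !=set0); last first.
  by rewrite negbK => /eqP ->; rewrite measure0.
(* [P r] says that [X] offers [r] independent directions from [x0]. It holds for [0] and fails for
   [n], so it fails for the first time after some [r < n]. *)
pose P r := exists B : 'M[R]_(r, n), row_free B /\ forall i, X (x0 + row i B).
have nPn : ~ P n.
  move=> [B [fB XB]]; have := unitmx_interior cX Xx0 (_ : B \in unitmx) XB.
  by rewrite -row_free_unit iX; apply.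
have P0 : P 0%N by exists 0; split; [rewrite /row_free mxrank0|case].
have [r [rn [B [fB XB]] nPr]] : exists r, [/\ (r < n)%N, P r & ~ P (r + 1)%N].
  apply: contrapT => hno.
  have : forall k, (k <= n)%N -> P k.
    elim=> // k IH kn; apply: contrapT => nk; apply: hno; exists k; split => //; first exact: IH (ltnW kn).
    by rewrite addn1.
  by move=> /(_ n (leqnn _)).
(* The columns of [K] are linear forms vanishing on the rows of [B]; as no further independent
   direction exists, they vanish on [X - x0] too. *)
pose K := cokermx B.
have XK x : X x -> (x - x0) *m K = 0.
  move=> Xx; apply/eqP; rewrite -submxE; apply: contrapT => nB; apply: nPr.
  exists (col_mx B (x - x0)); split; last first.
    move=> i; case: (split_ordP i) => j ->.
      by rewrite rowKu; exact: XB.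
    by rewrite rowKd row_id addrC subrK.
  have sB : (B <= col_mx B (x - x0))%MS by rewrite -addsmxE addsmxSl.
  rewrite /row_free eqn_leq rank_leq_row/= [leqLHS]addn1.
  have := mxrank_leqif_sup sB; move/eqP: fB => ->; case=> h1 h2.
  rewrite ltn_neqAle h1 andbT h2; apply/negP => h3; apply: nB.
  by apply: submx_trans h3; rewrite -addsmxE addsmxSr.
have K0 : K != 0.
  by rewrite -mxrank_eq0 mxrank_coker (eqP fB) -lt0n subn_gt0.
have [i iK] : exists i, row i K != 0.
  apply: contrapT => h; move/negP: K0; apply; apply/eqP/row_matrixP => i; rewrite row0.
  by apply/eqP; apply: contrapT => /negP hi; apply: h; exists i.
pose w := ebasis R i.
have wK : w *m K != 0 by rewrite /w /ebasis -rowE.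
have [b b0 hb] := compact_norm_bound coX.
pose D := ball (0 : 'rV[R]_n) (b + 1).
have mD : measurable (D : set (borel n)) by apply: open_borel; exact: ball_open.
(* Translates of [X] along [w]. They are disjoint because [K] is constant on [X] but tells multiples
   of [w] apart, and the shifts are at most [1] long, so [N + 1] of them fit in [D]. *)
pose Bk (N : nat) (k : nat) : set 'rV[R]_n := [set x | X (x + (- (k%:R / N.+1%:R) *: w))].
have [a Ea a0] := leb_compact coX.
have key N : ((a *+ N.+1)%:E <= leb n D)%E.
  have mB k : measurable (Bk N k : set (borel n)).
    have [c _ _] := scales_shift (- (k%:R / N.+1%:R) *: w).
    have := measurable_borel_continuous c measurableT mX.
    by rewrite setTI.
  have EB k : leb n (Bk N k) = leb n X.
    by rewrite [RHS](scales_measure (scales_shift (- (k%:R / N.+1%:R) *: w)) mX) mul1e.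
  have := @sum_integral_disjoint R n _ (iota 0 N.+1) (Bk N) D (fun=> 1%E) (iota_uniq _ _) mB mD _ _ (measurable_cst _) (fun=> @lee01 R).
  under eq_bigr => k _ do rewrite integral_cst// mul1e EB Ea.
  rewrite integral_cst// mul1e sumEFin big_const_seq count_predT size_iota iter_addr_0; apply.
  - move=> k k' x _ _ h1 h2; have := XK _ h1; rewrite -(XK _ h2) => /eqP.
    rewrite -subr_eq0 -mulmxBl opprB addrA subrK opprD addrACA subrr add0r -scalerBl.
    rewrite -scalemxAl scaler_eq0 (negbTE wK) orbF subr_eq0 eqr_opp => /eqP h.
    apply/eqP; rewrite -(eqr_nat R); apply/eqP.
    by apply: (@mulIf _ (N.+1%:R^-1)) => //; rewrite invr_eq0 pnatr_eq0.
  - move=> k; rewrite mem_iota add0n leq0n/= => kN x hx.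
    rewrite /D -ball_normE /ball_/= sub0r normrN.
    have -> : x = (x + (- (k%:R / N.+1%:R) *: w)) + (k%:R / N.+1%:R) *: w by rewrite scaleNr subrK.
    apply: (le_lt_trans (ler_normD _ _)); apply: ltr_leD; first exact: hb hx.
    rewrite normrZ -[leRHS]mulr1 ler_pM//; last exact: norm_ebasis_le.
    rewrite ger0_norm ?divr_ge0// ler_pdivrMr ?ltr0n// mul1r ler_nat; exact: ltnW.
have fD : (leb n D < +oo)%E by exact: leb_ball_fin.
move: fD key; case: (leb n D) => [e| |] // _ key; last by have := key 0%N; rewrite leeNy_eq.
rewrite Ea; apply/eqP; rewrite eqe eq_le a0 andbT leNgt; apply/negP => ap.
have := key (Num.truncn (e / a)); rewrite lee_fin leNgt => /negP; apply.
by rewrite -[ltRHS]mulr_natl -ltr_pdivrMr//; exact: truncnS_gt.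
Qed.

End ConvexBodies.

(** * Tangents with a uniform error up to the boundary *)

Section Approximation.
Context {R : realType}.

Lemma dotDl n (x y z : 'rV[R]_n) : dot (x + y) z = dot x z + dot y z.
Proof. by rewrite /dot mulmxDl mxE. Qed.

Lemma dotNl n (x z : 'rV[R]_n) : dot (- x) z = - dot x z.
Proof. by rewrite /dot mulNmx mxE. Qed.

Lemma dotZl n (t : R) (x z : 'rV[R]_n) : dot (t *: x) z = t * dot x z.
Proof. by rewrite /dot -scalemxAl mxE. Qed.

Lemma grad_bound n (X : set 'rV[R]_n) (v : 'rV[R]_n -> R) k :
  0 <= k -> (forall x y, X x -> X y -> `|v x - v y| <= k * `|x - y|) ->
  C2plus_on (interior X) v -> forall x i, interior X x -> `|grad v x ord0 i| <= k.
Proof.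
move=> k0 lv C2 x i Ix; have [_ [dv _] _ _ _] := C2.
have /interior_ball[r r0 hr] := Ix.
have lip t : 0 < t < r -> `|v (x + t *: ebasis R i) - v x| <= k * t.
  move=> /andP[t0 tr].
  have nt : `|t *: ebasis R i| <= t.
    by rewrite normrZ gtr0_norm// ler_piMr ?norm_ebasis_le// ltW.
  apply: (le_trans (lv _ _ _ (interior_subset Ix))).
    by apply: hr; rewrite addrC addKr; exact: le_lt_trans tr.
  by rewrite addrC addKr ler_wpM2l.
rewrite mxE ler_norml; apply/andP; split.
  apply: (derive_ge_quot r0 (dv i x Ix)) => t /lip; rewrite ler_norml mulNr => /andP[? _].
  by [].
by apply: (derive_le_quot r0 (dv i x Ix)) => t /lip; rewrite ler_norml => /andP[_ ?].
Qed.

Lemma same_trunc (a b : R) : 0 <= a -> 0 <= b -> Num.truncn a = Num.truncn b -> `|a - b| <= 1.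
Proof.
move=> a0 b0 E; have /andP[h1 h2] := truncn_itv a0; have /andP[h3 h4] := truncn_itv b0.
move: h1 h2 h3 h4; rewrite E -natr1; move: ((Num.truncn b)%:R : R) => t *.
by rewrite ler_norml; apply/andP; split; lra.
Qed.

(* The tangent at [x] bounds the error by [(x - s) . (grad v x - grad v s)]; then use
   [a b <= (a + b)^2 / 4] in each coordinate. *)
Lemma tangent_error n (X : set 'rV[R]_n) (v : 'rV[R]_n -> R) :
  convex_function (X : set (convex_lmodType 'rV[R]_n)) v -> C2plus_on (interior X) v ->
  forall x s, interior X x -> interior X s ->
  v x - v s - dot (x - s) (grad v s) <=
  (\sum_i ((x ord0 i + grad v x ord0 i) - (s ord0 i + grad v s ord0 i)) ^+ 2) / 4.
Proof.
move=> cv C2 x s Ix Is.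
have h := convex_tangent cv C2 Ix (interior_subset Is).
apply: (@le_trans _ _ (dot (x - s) (grad v x) - dot (x - s) (grad v s))).
  by move: h; rewrite -[s - x]opprB dotNl; lra.
rewrite !dotE -sumrB mulr_suml; apply: ler_sum => i _; rewrite !mxE.
move: (x ord0 i) (s ord0 i) (partial i v x) (partial i v s) => a b c d.
have := sqr_ge0 (a - b - (c - d)); rewrite !expr2; nra.
Qed.

(** Dudley's construction: [Psi x = x + grad v x] stays in a cube of half-side [b] by the Lipschitz
    bound, and points whose images share a cell of a subdivision have a small tangent error by
    [tangent_error]. One point per nonempty cell suffices, however the Hessian behaves near the
    boundary. *)
Lemma tangent_net n (X : set 'rV[R]_n) (v : 'rV[R]_n -> R) : (0 < n)%N -> compact X ->
  [lipschitz v x | x in X] ->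
  convex_function (X : set (convex_lmodType 'rV[R]_n)) v -> C2plus_on (interior X) v ->
  exists2 C, 0 <= C & forall m, (0 < m)%N -> exists L : seq 'rV[R]_n,
    [/\ (size L <= m)%N, (forall s, s \in L -> interior X s) &
     forall x, interior X x -> exists2 s, s \in L &
       v x - v s - dot (x - s) (grad v s) <= C * m%:R `^ (- (2 / n%:R))].
Proof.
move=> n0 coX /lipschitzE[k k0 lv] cv C2.
have [bX bX0 hbX] := compact_norm_bound coX.
pose b := bX + k.
have b0 : 0 < b by rewrite /b; lra.
pose Psi (x : 'rV[R]_n) (i : 'I_n) := x ord0 i + grad v x ord0 i.
have hPsi x i : interior X x -> `|Psi x i| < b.
  move=> Ix; apply: (le_lt_trans (ler_normD _ _)); apply: ltr_leD.
    exact: le_lt_trans (coord_le_norm x i) (hbX _ (interior_subset Ix)).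
  exact: (grad_bound (ltW k0) lv C2).
(* With [M] cells per axis the error is at most [n (2 b / M)^2 / 4 = n b^2 / M^2], and
   [m^(1/n) <= 2 M] turns this into [4 n b^2 m^(- 2 / n)]. *)
exists (4 * n%:R * b ^+ 2).
  by apply: mulr_ge0; [exact: mulr_ge0|exact: sqr_ge0].
move=> m m0.
have mR : 0 < m%:R :> R by rewrite ltr0n.
pose y : R := m%:R `^ n%:R^-1.
have yn : y ^+ n = m%:R by rewrite powR_root.
have y1 : 1 <= y.
  rewrite -(@ler_pXn2r _ n)// ?nnegrE ?powR_ge0// expr1n yn ler1n//.
pose M := Num.truncn y.
have /andP[My yM] : M%:R <= y < M.+1%:R by apply: truncn_itv; lra.
have M0 : (0 < M)%N by rewrite -ltnS -(ltr_nat R); lra.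
have MR : 0 < M%:R :> R by rewrite ltr0n.
have Mnm : (M ^ n <= m)%N.
  by rewrite -(ler_nat R) natrX -yn lerXn2r// nnegrE ?ler0n// powR_ge0.
pose A (x : 'rV[R]_n) (i : 'I_n) := (Psi x i + b) / (2 * b) * M%:R.
have A0 x i : interior X x -> 0 <= A x i.
  move=> Ix; have := hPsi x i Ix; rewrite ltr_norml => /andP[h1 h2].
  by rewrite mulr_ge0// divr_ge0//; lra.
have AM x i : interior X x -> (Num.truncn (A x i) < M.-1.+1)%N.
  move=> Ix; rewrite prednK// truncn_lt_nat ?A0// /A -ltr_pdivlMr// divff ?gt_eqF//.
  have := hPsi x i Ix; rewrite ltr_norml => /andP[h1 h2].
  by rewrite ltr_pdivrMr ?mul1r; lra.
pose cell (x : 'rV[R]_n) : {ffun 'I_n -> 'I_M.-1.+1} := [ffun i => inord (Num.truncn (A x i))].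
pose P f := exists x : 'rV[R]_n, interior X x /\ cell x = f.
pose rep f := xget (0 : 'rV[R]_n) [set x | interior X x /\ cell x = f].
have repP f : P f -> interior X (rep f) /\ cell (rep f) = f.
  by move=> [x hx]; rewrite /rep; case: xgetP => // h; have := h x.
exists [seq rep f | f <- enum {: {ffun 'I_n -> 'I_M.-1.+1}} & `[< P f >]]; split.
- rewrite size_map; apply: (leq_trans (size_subseq (filter_subseq _ _))).
  by rewrite -cardE card_ffun !card_ord prednK.
- by move=> s /mapP[f]; rewrite mem_filter => /andP[/asboolP/repP[hs _] _] ->.
move=> x Ix; have Pc : P (cell x) by exists x.
have [Is Es] := repP _ Pc.
exists (rep (cell x)).
  by apply: map_f; rewrite mem_filter mem_enum andbT; apply/asboolP.
set s := rep (cell x) in Is Es *.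
apply: (le_trans (tangent_error cv C2 Ix Is)).
have close i : (Psi x i - Psi s i) ^+ 2 <= (2 * b / M%:R) ^+ 2.
  have E : Num.truncn (A x i) = Num.truncn (A s i).
    have /ffunP/(_ i) := Es; rewrite !ffunE => /(congr1 val)/=.
    by rewrite !inordK// AM.
  have h := same_trunc (A0 x i Ix) (A0 s i Is) E.
  rewrite -[leLHS]real_normK ?num_real// lerXn2r// ?nnegrE ?normr_ge0//.
    by rewrite divr_ge0// mulr_ge0// ltW.
  have b20 : 0 < 2 * b by rewrite mulr_gt0.
  rewrite ler_pdivlMr//; move: h.
  rewrite /A -mulrBl -mulrBl opprD addrACA subrr addr0 !normrM [`|M%:R|]ger0_norm//.
  by rewrite normfV [`|2 * b|]gtr0_norm// mulrAC ler_pdivrMr// mul1r.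
apply: (@le_trans _ _ ((\sum_(i < n) (2 * b / M%:R) ^+ 2) / 4)).
  by rewrite ler_wpM2r ?invr_ge0//; apply: ler_sum => i _; exact: close.
rewrite sumr_const card_ord powRN.
have -> : m%:R `^ (2 / n%:R) = y ^+ 2.
  by rewrite /y -powR_mulrn ?powR_ge0// -powRrM mulrC.
have y2 : y <= 2 * M%:R.
  have : 1 <= M%:R :> R by rewrite ler1n.
  by move: yM; rewrite -natr1; lra.
rewrite -[X in X / 4]mulr_natl; have nR : 0 <= n%:R :> R by rewrite ler0n.
have ->: n%:R * (2 * b / M%:R) ^+ 2 / 4 = 4 * n%:R * b ^+ 2 * ((2 * M%:R) ^+ 2)^-1.
  by field; rewrite gt_eqF.
apply: ler_wpM2l; first by apply: mulr_ge0; [exact: mulr_ge0|exact: sqr_ge0].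
rewrite lef_pV2 ?posrE ?exprn_gt0 ?mulr_gt0//; last by lra.
by rewrite lerXn2r// nnegrE ?mulr_ge0//; lra.
Qed.

End Approximation.

(** * Grids on which Hessian, weight and density are nearly constant *)

Section GoodGrid.
Context {R : realType}.

Lemma continuous_at_sum (T : topologicalType) (I : Type) (r : seq I) (F : I -> T -> R) x :
  (forall i, {for x, continuous (F i)}) -> {for x, continuous (fun y => \sum_(i <- r) F i y)}.
Proof.
move=> cF; elim: r => [|i r IH].
  rewrite (_ : (fun _ => _) = (fun=> 0)); first exact: cst_continuous.
  by apply/funext => y; rewrite big_nil.
rewrite (_ : (fun _ => _) = (fun y => F i y + \sum_(j <- r) F j y)); last first.
  by apply/funext => y; rewrite big_cons.
by apply: cvgD; [exact: cF|exact: IH].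
Qed.

Lemma continuous_at_prod (T : topologicalType) (I : Type) (r : seq I) (F : I -> T -> R) x :
  (forall i, {for x, continuous (F i)}) -> {for x, continuous (fun y => \prod_(i <- r) F i y)}.
Proof.
move=> cF; elim: r => [|i r IH].
  rewrite (_ : (fun _ => _) = (fun=> 1)); first exact: cst_continuous.
  by apply/funext => y; rewrite big_nil.
rewrite (_ : (fun _ => _) = (fun y => F i y * \prod_(j <- r) F j y)); last first.
  by apply/funext => y; rewrite big_cons.
by apply: cvgM; [exact: cF|exact: IH].
Qed.

Lemma continuous_at_det (T : topologicalType) n (M : T -> 'M[R]_n) x :
  (forall i j, {for x, continuous (fun y => M y i j)}) -> {for x, continuous (fun y => \det (M y))}.
Proof.
move=> cM; apply: continuous_at_sum => s; apply: cvgM; first exact: cvg_cst.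
by apply: continuous_at_prod => i; exact: cM.
Qed.

Lemma near_ratio n (f : 'rV[R]_n -> R) x e : {for x, continuous f} -> 0 < f x -> 0 < e ->
  exists2 r, 0 < r & forall y, `|y - x| < r -> (1 - e) * f x <= f y <= (1 + e) * f x.
Proof.
move=> cf f0 e0; have [r r0 h] := cvg_ball cf (mulr_gt0 e0 f0).
exists r => // y /h; rewrite ltr_norml => /andP[h1 h2].
rewrite mulrBl mulrDl mul1r; move: (e * f x) (f x) (f y) h1 h2 => t a b h1 h2.
by apply/andP; split; lra.
Qed.

(** Coercivity is read off the Cholesky factor: the form is the squared Euclidean length of
    [u *m A], and [invmx A] recovers [u]. *)
Lemma qform_lower n (H : 'M[R]_n) : H^T = H -> (forall u, u != 0 -> 0 < qform H u) ->
  exists2 lam, 0 < lam & forall u, lam * `|u| ^+ 2 <= qform H u.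
Proof.
move=> sH pH; have [A [EA dA _]] := upper_cholesky sH pH.
have uA : A \in unitmx by rewrite unitmxE unitfE gt_eqF.
pose c := \sum_i \sum_j `|invmx A i j| + 1.
have c0 : 0 < c by rewrite ltr_wpDl//; apply: sumr_ge0 => j _; exact: sumr_ge0.
exists (c ^+ 2)^-1; first by rewrite invr_gt0 exprn_gt0.
move=> u; rewrite mulrC ler_pdivrMr ?exprn_gt0//.
have -> : qform H u = dot (u *m A) (u *m A).
  by rewrite /qform /dot EA trmx_mul !mulmxA.
have h1 : `|u| <= c * `|u *m A|.
  have := mulmx_norm_le (invmx A) (u *m A); rewrite mulmxK// => h.
  by apply: (le_trans h); rewrite ler_wpM2r// lerDl.
have h2 : `|u *m A| ^+ 2 <= dot (u *m A) (u *m A).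
  set w := u *m A; have [->|w0] := eqVneq w 0.
    by rewrite normr0 expr0n/= dot_ge0.
  have [[i j] Ei] : exists i, `|w| = `|w i.1 i.2| by apply: mx_norm_neq0; rewrite -normr_eq0 in w0.
  rewrite Ei/= (ord1 i) real_normK ?num_real// dotE (bigD1 j)//= -expr2 lerDl.
  by apply: sumr_ge0 => l _; rewrite -expr2 sqr_ge0.
apply: (@le_trans _ _ ((c * `|u *m A|) ^+ 2)).
  by rewrite lerXn2r// nnegrE ?mulr_ge0// ltW.
by rewrite exprMn mulrC ler_wpM2r// sqr_ge0.
Qed.

(** Entrywise continuity gives an additive bound; coercivity of the form at [x] makes it
    relative. *)
Lemma near_hessian n (U : set 'rV[R]_n) (v : 'rV[R]_n -> R) x e : open U -> C2plus_on U v ->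
  U x -> 0 < e -> exists2 r, 0 < r & forall y, `|y - x| < r -> forall u,
    (1 - e) * qform (hessian v x) u <= qform (hessian v y) u <= (1 + e) * qform (hessian v x) u.
Proof.
move=> oU C2 Ux e0; have [_ _ _ cv pv] := C2.
have [lam lam0 hlam] := qform_lower (hessian_sym oU C2 Ux) (pv x Ux).
(* A matrix with entries below [d] has a form at most [n^2 d |u|^2 <= e lam |u|^2]. *)
pose d := e * lam / (n%:R * n%:R + 1).
have N0 : 0 < n%:R * n%:R + 1 :> R by rewrite ltr_wpDl// mulr_ge0.
have d0 : 0 < d by rewrite divr_gt0// mulr_gt0.
have /choice[r hr] : forall ij : 'I_n * 'I_n, exists r, 0 < r /\ forall y, `|y - x| < r ->
    `|hessian v x ij.1 ij.2 - hessian v y ij.1 ij.2| < d.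
  move=> [i j]; have [r r0 h] := cvg_ball (cv i j x (mem_set Ux)) d0.
  have E z : hessian v z i j = partial i (partial j v) z by rewrite mxE.
  by exists r; split=> [|y /h hy]; [exact: r0|rewrite !E; exact: hy].
exists (\big[Num.min/1]_ij r ij).
  by apply/bigmin_gtP; split => // ij _; have [] := hr ij.
move=> y hy u.
have hd i j : `|hessian v x i j - hessian v y i j| < d.
  have [_ h] := hr (i, j); apply: h; apply: lt_le_trans hy _; exact: bigmin_le.
move: (hessian v x) (hessian v y) hlam hd => Hx Hy hlam hd.
have bnd (M : 'M[R]_n) : (forall i j, `|M i j| < d) -> qform M u <= e * qform Hx u.
  move=> hM; apply: (le_trans (qform_le _ _)).
  apply: (@le_trans _ _ (e * lam * `|u| ^+ 2)); last by rewrite -mulrA ler_pM2l.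
  rewrite ler_wpM2r ?sqr_ge0//.
  apply: (@le_trans _ _ (\sum_(j < n) \sum_(i < n) d)).
    by apply: ler_sum => j _; apply: ler_sum => i _; rewrite ltW.
  rewrite !sumr_const card_ord -mulrnA -[leLHS]mulr_natl natrM /d mulrA ler_pdivrMr//.
  by rewrite mulrC ler_wpM2l ?mulr_ge0 ?(ltW e0) ?(ltW lam0)// lerDl.
have qB (M N : 'M[R]_n) : qform (M - N) u = qform M u - qform N u.
  by rewrite /qform mulmxBr mulmxBl !mxE.
have mB (M N : 'M[R]_n) i j : (M - N) i j = M i j - N i j by rewrite !mxE.
have h1 : qform (Hx - Hy) u <= e * qform Hx u.
  by apply: bnd => i j; rewrite mB; exact: hd.
have h2 : qform (Hy - Hx) u <= e * qform Hx u.
  by apply: bnd => i j; rewrite mB distrC; exact: hd.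
move: h1 h2; rewrite !qB; move: (qform Hx u) (qform Hy u) => a b h1 h2.
by rewrite mulrBl mulrDl mul1r; move: (e * a) h1 h2 => t *; apply/andP; split; lra.
Qed.

(** Because [a + b <= 1], the joint relative error is again at most [e]: [(1 - e)^(a + b) >= 1 - e]
    and [(1 + e)^(a + b) <= 1 + e]. *)
Lemma powR_ratio (a b A B A' B' e : R) : 0 <= a -> 0 <= b -> a + b <= 1 -> 0 < e < 1 ->
  0 < A -> 0 < B -> (1 - e) * A <= A' <= (1 + e) * A -> (1 - e) * B <= B' <= (1 + e) * B ->
  (1 - e) * (A `^ a * B `^ b) <= A' `^ a * B' `^ b <= (1 + e) * (A `^ a * B `^ b).
Proof.
move=> a0 b0 ab /andP[e0 e1] A0 B0 /andP[A1 A2] /andP[B1 B2].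
have em : 0 < 1 - e by lra.
have ep : 0 < 1 + e by lra.
have A'0 : 0 < A' by apply: lt_le_trans A1; exact: mulr_gt0.
have B'0 : 0 < B' by apply: lt_le_trans B1; exact: mulr_gt0.
have AB0 : 0 <= A `^ a * B `^ b by rewrite mulr_ge0 ?powR_ge0.
have E (t : R) : 0 < t -> ((t * A) `^ a) * ((t * B) `^ b) = t `^ (a + b) * (A `^ a * B `^ b).
  move=> t0; rewrite !powRM ?(ltW t0) ?(ltW A0) ?(ltW B0)// powRD ?(gt_eqF t0) ?implybT//.
  by rewrite mulrACA.
have mono (s t c : R) : 0 <= c -> 0 <= s -> s <= t -> s `^ c <= t `^ c.
  by move=> c0 s0 st; apply: ge0_ler_powR => //; rewrite nnegrE// (le_trans s0).
apply/andP; split.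
  apply: (@le_trans _ _ ((1 - e) `^ (a + b) * (A `^ a * B `^ b))).
    rewrite ler_wpM2r// -[leLHS](powRr1 (ltW em)).
    by apply: ger_powR => //; apply/andP; split => //; lra.
  rewrite -E//; apply: ler_pM; [exact: powR_ge0|exact: powR_ge0| |].
    by apply: mono => //; exact: mulr_ge0 (ltW em) (ltW A0).
  by apply: mono => //; exact: mulr_ge0 (ltW em) (ltW B0).
apply: (@le_trans _ _ ((1 + e) `^ (a + b) * (A `^ a * B `^ b))).
  rewrite -E//; apply: ler_pM; [exact: powR_ge0|exact: powR_ge0| |].
    by apply: mono => //; exact: ltW.
  by apply: mono => //; exact: ltW.
rewrite ler_wpM2r// -[leRHS](powRr1 (ltW ep)).
by apply: ler_powR => //; lra.
Qed.

(** The exponents are tuned so that [h^n] times the density, raised to the power [1 + 2 p / n], is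
    [h^(n + 2 p) det^(p / n) omega], the leading factor of the error in a cube of side [h]. *)
Definition density (p : R) n (v : 'rV[R]_n -> R) (omega : 'rV[R]_n * R -> R) (x : 'rV[R]_n) : R :=
  \det (hessian v x) `^ (p / (n%:R + 2 * p)) * omega (x, v x) `^ (n%:R / (n%:R + 2 * p)).

Definition comparable_at (p e : R) n (v : 'rV[R]_n -> R) (omega : 'rV[R]_n * R -> R)
    (c y : 'rV[R]_n) : Prop :=
  [/\ forall u, (1 - e) * qform (hessian v c) u <= qform (hessian v y) u <= (1 + e) * qform (hessian v c) u,
      (1 - e) * omega (c, v c) <= omega (y, v y) <= (1 + e) * omega (c, v c) &
      (1 - e) * density p v omega c <= density p v omega y <= (1 + e) * density p v omega c].

Lemma continuous_at_graph (T : topologicalType) (f : T -> R) (g : T * R -> R) x :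
  {for x, continuous f} -> continuous g -> {for x, continuous (fun y => g (y, f y))}.
Proof.
move=> cf cg; apply: (@continuous_comp _ _ _ (fun y => (y, f y)) g); last exact: cg.
move=> A [[P Q] [/= nP nQ] PQ]; have hQ := cf _ nQ.
by apply: filterS2 nP hQ => y Py Qy; exact: PQ.
Qed.

Lemma continuous_at_omega n (U : set 'rV[R]_n) (v : 'rV[R]_n -> R) (omega : 'rV[R]_n * R -> R) x :
  C2plus_on U v -> continuous omega -> U x -> {for x, continuous (fun y => omega (y, v y))}.
Proof.
move=> [cv _ _ _ _] cw Ux.
by apply: continuous_at_graph => //; exact/cv/mem_set.
Qed.

Lemma local_comparable (p e : R) n (U : set 'rV[R]_n) (v : 'rV[R]_n -> R) (omega : 'rV[R]_n * R -> R) x :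
  0 < p -> (0 < n)%N -> open U -> C2plus_on U v -> continuous omega -> (forall z, 0 < omega z) ->
  0 < e < 1 -> U x ->
  exists2 r, 0 < r & forall y, `|y - x| < r -> U y /\ comparable_at p e v omega x y.
Proof.
move=> p0 n0 oU C2 cw w0 /andP[e0 e1] Ux.
have [_ _ _ cv pv] := C2.
have nR : 0 < n%:R :> R by rewrite ltr0n.
have D0 : 0 < n%:R + 2 * p by lra.
have [r1 r10 h1] := open_ball_sub oU Ux.
have [r2 r20 h2] := near_hessian oU C2 Ux e0.
have [r3 r30 h3] := near_ratio (continuous_at_omega C2 cw Ux) (w0 _) e0.
have [det0 _] := quantc_det p0 n0 (hessian_sym oU C2 Ux) (pv x Ux).
have cdet : {for x, continuous (fun y => \det (hessian v y))}.
  apply: continuous_at_det => i j.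
  rewrite (_ : (fun _ => _) = partial i (partial j v)); first exact: cv _ _ _ (mem_set Ux).
  by apply/funext => y; rewrite mxE.
have [r4 r40 h4] := near_ratio cdet det0 e0.
exists (Num.min (Num.min r1 r2) (Num.min r3 r4)); first by rewrite !lt_min r10 r20 r30 r40.
move=> y; rewrite !lt_min => /andP[/andP[y1 y2] /andP[y3 y4]].
split; first exact: h1.
split; [exact: h2|exact: h3|].
apply: powR_ratio => //; [| | |by rewrite e0|exact: h4|exact: h3].
- by rewrite divr_ge0 ?ltW.
- by rewrite divr_ge0 ?ltW.
- by rewrite -mulrDl ler_pdivrMr// mul1r; lra.
Qed.

Lemma seq_pos_lower (T : eqType) (s : seq T) (f : T -> R) : (forall x, x \in s -> 0 < f x) ->
  exists2 h, 0 < h & forall x, x \in s -> h <= f x.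
Proof.
elim: s => [|a s IH] hf; first by exists 1.
have [|h h0 hh] := IH; first by move=> x xs; apply: hf; rewrite inE xs orbT.
exists (Num.min h (f a)); first by rewrite lt_min h0 hf// inE eqxx.
by move=> x; rewrite inE ge_min => /predU1P[->|/hh ->//]; rewrite lexx orbT.
Qed.

(** The finite subcover uses balls of half the radius; the least half radius is then a margin valid
    at every point. *)
Lemma lebesgue_number n (K : set 'rV[R]_n) (r : 'rV[R]_n -> R) : compact K ->
  (forall x, K x -> 0 < r x) ->
  exists2 h, 0 < h & forall k, K k -> exists2 x, K x & forall y, `|y - k| <= h -> `|y - x| < r x.
Proof.
move=> coK r0; have : cover_compact K by rewrite -compact_cover.
move=> /(_ _ K (fun x => ball x (r x / 2)))[||D DK cov].
- by move=> x Kx; exact: ball_open.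
- move=> x Kx; exists x => //; apply: ballxx; rewrite divr_gt0// r0//.
have [x xD|h h0 hh] := @seq_pos_lower _ (finmap.enum_fset D) (fun x => r x / 2).
  by rewrite divr_gt0//; apply: r0; apply: set_mem; exact: DK.
exists h => // k /cov[x xD]; rewrite -ball_normE /ball_/= => xk.
exists x; first exact/set_mem/DK.
move=> y yk; have := hh x xD => hx.
rewrite -(subrKA k); apply: (le_lt_trans (ler_normD _ _)); rewrite [`|k - x|]distrC.
by move: (`|y - k|) (`|x - k|) (r x) yk xk hx => a b c; lra.
Qed.

(** The mesh is a Lebesgue number for the cover of [K] by the balls of [local_comparable]. A closed
    cube of side [h] meeting [K] therefore lies in one such ball, whose centre serves as [c z];
    cubes that miss [K] are dropped. *)
Lemma good_grid (p e : R) n (X K : set 'rV[R]_n) (v : 'rV[R]_n -> R) (omega : 'rV[R]_n * R -> R) :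
  0 < p -> (0 < n)%N -> compact K -> K `<=` interior X -> C2plus_on (interior X) v ->
  continuous omega -> (forall z, 0 < omega z) -> 0 < e < 1 ->
  exists (h : R) (Z : seq 'rV[R]_n) (c : 'rV[R]_n -> 'rV[R]_n), [/\ 0 < h, uniq Z,
    (forall z z' x, z \in Z -> z' \in Z -> unit_cube (x - z) -> unit_cube (x - z') -> z = z'),
    (forall x, K x -> exists2 z, z \in Z & unit_cube (h^-1 *: x - z)) &
    (forall z, z \in Z -> interior X (c z) /\ forall u, unit_cubec u ->
       interior X (h *: (z + u)) /\ comparable_at p e v omega (c z) (h *: (z + u)))].
Proof.
move=> p0 n0 coK KX C2 cw w0 e01.
have oX := @open_interior _ X.
have /choice[r hr] : forall x, exists r, K x -> 0 < r /\
    forall y, `|y - x| < r -> interior X y /\ comparable_at p e v omega x y.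
  move=> x; have [Kx|nK] := pselect (K x); last by exists 0 => /nK.
  have [r r0 h] := local_comparable p0 n0 oX C2 cw w0 e01 (KX _ Kx).
  by exists r.
have [h h0 hh] := lebesgue_number coK (fun x Kx => (hr x Kx).1).
have [b b0 hb] := compact_norm_bound coK.
have [Z [uZ dZ cZ]] := @grid R n (h^-1 * b).
pose P z := exists k, K k /\ unit_cube (h^-1 *: k - z).
pose good z c := K c /\ forall u, unit_cubec u -> `|h *: (z + u) - c| < r c.
have /choice[c hc] : forall z, exists c, P z -> good z c.
  move=> z; have [[k [Kk Ck]]|nP] := pselect (P z); last by exists 0 => /nP.
  have [x Kx hx] := hh k Kk; exists x => _; split => // u Cu; apply: hx.
  have -> : h *: (z + u) - k = h *: (u - (h^-1 *: k - z)).
    rewrite opprB addrA [u + z]addrC scalerBr scalerA divff ?gt_eqF// scale1r.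
    by [].
  rewrite normrZ gtr0_norm// ler_piMr ?(ltW h0)//.
  apply/row_norm_le => // i; rewrite !mxE ler_norml.
  have /andP[? ?] := Cu i; have := Ck i; rewrite !mxE => /andP[? ?].
  by apply/andP; split; lra.
exists h, [seq z <- Z | `[< P z >]], c; split => //.
- by rewrite filter_uniq.
- move=> z z' x; rewrite !mem_filter => /andP[_ zZ] /andP[_ zZ']; exact: dZ.
- move=> x Kx; have [|z zZ Cz] := cZ (h^-1 *: x).
    by rewrite normrZ gtr0_norm ?invr_gt0// ler_pM2l ?invr_gt0// ltW// hb.
  by exists z => //; rewrite mem_filter zZ andbT; apply/asboolP; exists x.
move=> z; rewrite mem_filter => /andP[/asboolP/hc[Kc hz] _].
split; first exact: KX.
by move=> u Cu; have [_ h2] := hr _ Kc; apply: h2; exact: hz.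
Qed.

End GoodGrid.

(** * Maxima of affine functions, measurability, rounding and Hoelder's inequality *)

Section Minorants.
Context {R : realType}.
Notation borel := (borel R).

Lemma affine_funE n (ab : 'rV[R]_n * R) x : affine_fun ab x = dot x ab.1 + ab.2.
Proof. by []. Qed.

Lemma continuous_affine n (ab : 'rV[R]_n * R) : continuous (affine_fun ab).
Proof.
rewrite (_ : affine_fun ab = fun x => \sum_i x ord0 i * ab.1 ord0 i + ab.2).
  apply: continuous_add; last exact: cst_continuous.
  apply: continuous_sum => i; apply: continuous_mul; last exact: cst_continuous.
  exact: coord_continuous.
by apply/funext => x; rewrite affine_funE dotE.
Qed.

Lemma continuous_maxr (T : topologicalType) (f g : T -> R) :
  continuous f -> continuous g -> continuous (fun x => Num.max (f x) (g x)).
Proof. by move=> cf cg x; apply: continuous_max; [exact: cf|exact: cg]. Qed.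

Lemma continuous_max_affine n k (F : 'I_k.+1 -> 'rV[R]_n * R) : continuous (max_affine F).
Proof.
rewrite /max_affine; elim: (index_enum _) => [|j r IH].
  rewrite (_ : (fun _ => _) = affine_fun (F ord0)); first exact: continuous_affine.
  by apply/funext => x; rewrite big_nil.
rewrite (_ : (fun _ => _) = (fun x => Num.max (affine_fun (F j) x)
    (\big[Num.max/affine_fun (F ord0) x]_(j <- r) affine_fun (F j) x))); last first.
  by apply/funext => x; rewrite big_cons.
by apply: continuous_maxr; [exact: continuous_affine|exact: IH].
Qed.

Lemma max_affine_ge n k (F : 'I_k.+1 -> 'rV[R]_n * R) j x : affine_fun (F j) x <= max_affine F x.
Proof. exact: le_bigmax. Qed.

Lemma max_affine_ex n k (F : 'I_k.+1 -> 'rV[R]_n * R) x :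
  exists j, max_affine F x = affine_fun (F j) x.
Proof.
rewrite /max_affine; elim/big_ind: _ => [|a b [i ->] [j ->]|i _]; [by exists ord0| |by exists i].
by rewrite /Num.max; case: ifP => _; [exists j|exists i].
Qed.

Lemma Pc_continuous n m (X : set 'rV[R]_n) (v l : 'rV[R]_n -> R) : Pc m X v l -> continuous l.
Proof. by case=> k [F [_ -> _]]; exact: continuous_max_affine. Qed.

Lemma Pc_of_seq n (L : seq ('rV[R]_n * R)) m (X : set 'rV[R]_n) (v : 'rV[R]_n -> R) :
  L != [::] -> (size L <= m)%N -> (forall ab, ab \in L -> forall x, X x -> affine_fun ab x <= v x) ->
  exists2 l, Pc m X v l & forall ab x, ab \in L -> affine_fun ab x <= l x.
Proof.
case: L => // a L _ sL hL.
pose F (j : 'I_(size L).+1) := nth a (a :: L) j.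
have FL j : F j \in a :: L by rewrite mem_nth/=.
exists (max_affine F).
  exists (size L), F; split => // x Xx.
  by have [j ->] := max_affine_ex F x; exact: hL.
move=> ab x abL.
have ij : (index ab (a :: L) < (size L).+1)%N by rewrite -(index_mem ab) in abL.
have := max_affine_ge F (Ordinal ij) x; rewrite /F/=.
by rewrite nth_index.
Qed.

Lemma borel_open_continuous n (U : set 'rV[R]_n) (f : 'rV[R]_n -> R) : open U ->
  (forall x, U x -> {for x, continuous f}) -> measurable_fun (U : set (borel n)) (f : borel n -> R).
Proof.
move=> oU cf; apply: (measurability _ (RGenOInfty.measurableE R)) => // _ [_ [a ->] <-].
apply: open_borel; rewrite openE => x [Ux /=]; rewrite in_itv/= andbT => ax.
have [r1 r10 h1] := open_ball_sub oU Ux.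
have e0 : 0 < f x - a by lra.
have [r2 r20 h2] := cvg_ball (cf x Ux) e0.
apply/interior_ball; exists (Num.min r1 r2); first by rewrite lt_min r10.
move=> y; rewrite lt_min => /andP[/h1 Uy /h2]; rewrite ltr_norml => /andP[h3 h4].
by split => //=; rewrite in_itv/= andbT; lra.
Qed.

Lemma measurable_density (p : R) n (U : set 'rV[R]_n) (v : 'rV[R]_n -> R) (omega : 'rV[R]_n * R -> R) :
  open U -> C2plus_on U v -> continuous omega ->
  measurable_fun (U : set (borel n)) ((fun x => (density p v omega x)%:E) : borel n -> \bar R).
Proof.
move=> oU C2 cw; have [_ _ _ cv _] := C2.
apply/measurable_EFinP; apply: measurable_funM.
  apply: (measurableT_comp (measurable_powR _)); apply: borel_open_continuous => // x Ux.
  apply: continuous_at_det => i j.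
  rewrite (_ : (fun _ => _) = partial i (partial j v)); first exact: cv _ _ _ (mem_set Ux).
  by apply/funext => y; rewrite mxE.
apply: (measurableT_comp (measurable_powR _)); apply: borel_open_continuous => // x Ux.
exact: continuous_at_omega C2 cw Ux.
Qed.

Lemma density_ge0 (p : R) n (v : 'rV[R]_n -> R) (omega : 'rV[R]_n * R -> R) x :
  0 <= density p v omega x.
Proof. by rewrite mulr_ge0 ?powR_ge0. Qed.

Lemma lipschitz_sublevel_closed n (X : set 'rV[R]_n) (v : 'rV[R]_n -> R) k a : closed X -> 0 < k ->
  (forall x y, X x -> X y -> `|v x - v y| <= k * `|x - y|) -> closed (X `&` [set x | v x <= a]).
Proof.
move=> cX k0 lv; rewrite -(setCK (_ `&` _)); apply: open_closedC; rewrite openE => x hx.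
have [Xx|nX] := pselect (X x); last first.
  have /interior_ball[r r0 h] : interior (~` X) x.
    by have := closed_openC cX; rewrite openE; exact.
  by apply/interior_ball; exists r => // y /h nXy [].
have av : a < v x.
  by rewrite ltNge; apply/negP => h; apply: hx.
apply/interior_ball; exists ((v x - a) / k); first by rewrite divr_gt0 ?subr_gt0.
move=> y hy [Xy /= vy]; have := lv x y Xx Xy; rewrite distrC ler_norml => /andP[h1 _].
move: hy; rewrite ltr_pdivlMr// distrC mulrC => hy.
by move: (k * `|x - y|) (v x) (v y) h1 hy vy => t b c; lra.
Qed.

Definition penalty (p : R) n (X : set 'rV[R]_n) (v : 'rV[R]_n -> R) (omega : 'rV[R]_n * R -> R)
    (l : 'rV[R]_n -> R) (x : 'rV[R]_n) : \bar R :=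
  if x \in X then ((v x - l x) `^ p * omega (x, v x))%:E else 0%E.

Lemma penalty_ge0 (p : R) n (X : set 'rV[R]_n) v omega l x : (forall z, 0 < omega z) ->
  (0 <= @penalty p n X v omega l x)%E.
Proof.
by move=> w0; rewrite /penalty; case: ifP => // _; rewrite lee_fin mulr_ge0 ?powR_ge0 ?ltW.
Qed.

Lemma measurable_penalty (p : R) n (X : set 'rV[R]_n) (v : 'rV[R]_n -> R)
   (omega : 'rV[R]_n * R -> R) (l : 'rV[R]_n -> R) : compact X -> [lipschitz v x | x in X] ->
  continuous omega -> continuous l ->
  measurable_fun setT (penalty p X v omega l : borel n -> \bar R).
Proof.
move=> coX /lipschitzE[k k0 lv] cw cl; have mX := compact_borel coX.
have cX : closed X by apply: compact_closed => //; exact: row_hausdorff.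
(* Off [X] the values of [v] are unconstrained. Replacing them by [0] lets every superlevel set be
   described by closed subsets of [X]. *)
pose vX (x : borel n) : R := if x \in X then v x else 0.
have mvX : measurable_fun setT vX.
  apply: borel_measurable_gt => a.
  have mS : measurable (X `&` [set x | v x <= a] : set (borel n)).
    by apply: closed_borel; exact: lipschitz_sublevel_closed lv.
  (* As [vX] is [0] off [X], the superlevel set contains the complement of [X] exactly when
     [a < 0]. *)
  have [a0|a0] := ltP a 0.
    rewrite (_ : [set x | _] = ~` (X `&` [set x | v x <= a])); first exact: measurableC.
    apply/seteqP; split => x; rewrite /vX/=; case: ifPn => [/set_mem Xx|/negP nX].
    - by move=> ax [_]; rewrite leNgt ax.
    - by move=> _ [/mem_set].
    - by move=> h; rewrite ltNge; apply/negP => h'; apply: h.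
    - by [].
  rewrite (_ : [set x | _] = X `\` (X `&` [set x | v x <= a])); first exact: measurableD.
  apply/seteqP; split => x; rewrite /vX/=; case: ifPn => [/set_mem Xx|/negP nX].
  - by move=> ax; split => // -[_]; rewrite leNgt ax.
  - by rewrite ltNge a0.
  - by move=> [_ h]; rewrite ltNge; apply/negP => h'; apply: h.
  - by move=> [/mem_set].
have mom : measurable_fun setT (fun x : borel n => omega (x, vX x)).
  have mo : measurable_fun setT (fun z : measurableTypeR R * borel n => omega (z.2, z.1)).
    apply: (measurability _ (RGenOInfty.measurableE R)) => // _ [_ [a ->] <-].
    rewrite setTI; apply: open_rectangle_measurable.
    apply: (@open_comp _ _ (fun z : R * 'rV[R]_n => omega (z.2, z.1)) `]a, +oo[%classic); last first.
      by apply: interval_open.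
    move=> z _; apply: (@continuous_comp _ _ _ (fun z : R * 'rV[R]_n => (z.2, z.1)) omega); last exact: cw.
    exact: swap_continuous.
  apply: (measurableT_comp mo (g := fun x : borel n => (vX x, x))).
  by apply/measurable_fun_pair => //; exact: measurable_id.
rewrite (_ : penalty p X v omega l = (fun x => ((vX x - l x) `^ p * omega (x, vX x))%:E) \_ X); last first.
  apply/funext => x; rewrite patchE /penalty /vX; case: ifP => // xX.
apply/(measurable_restrictT _ mX); apply: measurable_funTS.
apply/measurable_EFinP; apply: measurable_funM => //.
apply: (measurableT_comp (measurable_powR p)); apply: measurable_funB => //.
exact: borel_continuous.
Qed.

(** Rounding down loses at most [1], and [th / (th - 1)] is the threshold beyond which
    [x - 1 >= x / th]. *)
Lemma trunc_lower (x th : R) : 1 < th -> th / (th - 1) <= x -> x / th <= (Num.truncn x)%:R.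
Proof.
move=> th1 hx; have th0 : 0 < th by lra.
have d0 : 0 < th - 1 by lra.
have x0 : 0 <= x by apply: le_trans hx; rewrite divr_ge0// ltW.
have /andP[_] := truncn_itv x0; rewrite -natr1 => h.
have : x / th <= x - 1.
  rewrite ler_pdivrMr//; move: hx; rewrite ler_pdivrMr// => hx; nra.
by move: ((Num.truncn x)%:R : R) h => t; lra.
Qed.

Lemma eventually_all (T : eqType) (Z : seq T) (P : T -> nat -> Prop) :
  (forall z, z \in Z -> exists m0 : nat, forall m, (m0 <= m)%N -> P z m) ->
  exists m0 : nat, forall m, (m0 <= m)%N -> forall z, z \in Z -> P z m.
Proof.
elim: Z => [|a Z IH] h; first by exists 0%N.
have [|m1 h1] := IH; first by move=> z zZ; apply: h; rewrite inE zZ orbT.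
have [|m2 h2] := h a; first by rewrite inE eqxx.
exists (maxn m1 m2) => m; rewrite geq_max => /andP[hm1 hm2] z; rewrite inE => /predU1P[->|zZ].
  exact: h2.
exact: h1.
Qed.

Lemma eventually_ge (c a : R) : 0 < a -> exists m0 : nat, forall m, (m0 <= m)%N -> c <= m%:R * a.
Proof.
move=> a0; exists (Num.truncn (c / a)).+1 => m hm.
rewrite -ler_pdivrMr//; apply: (le_trans (ltW (truncnS_gt _))).
by rewrite ler_nat.
Qed.

Lemma powR_invl (x b : R) : 0 <= x -> x^-1 `^ b = x `^ (- b).
Proof. by move=> x0; rewrite -powR_inv1// -powRrM mulN1r. Qed.

(* Bernoulli's [t^(1+al) >= (1+al) t - al] at [t = a z / (k z * lam)], where [lam]
   is the ratio of the two sums. *)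
Lemma holder_sum (I : eqType) (Z : seq I) (a k : I -> R) (al : R) : 0 < al ->
  (forall z, z \in Z -> 0 < a z /\ 0 < k z) -> Z != [::] ->
  (\sum_(z <- Z) a z) `^ (1 + al) * (\sum_(z <- Z) k z) `^ (- al) <=
  \sum_(z <- Z) a z `^ (1 + al) * k z `^ (- al).
Proof.
move=> al0 h Z0.
have sumpos (f : I -> R) : (forall z, z \in Z -> 0 < f z) -> 0 < \sum_(z <- Z) f z.
  move=> hf; case: (Z) Z0 hf => // z r _ hf; rewrite big_cons ltr_wpDr//.
    by rewrite big_seq; apply: sumr_ge0 => y yr; rewrite ltW// hf// inE yr orbT.
  by rewrite hf// inE eqxx.
set A := \sum_(z <- Z) a z; set K := \sum_(z <- Z) k z.
have A0 : 0 < A by apply: sumpos => z /h[].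
have K0 : 0 < K by apply: sumpos => z /h[].
have [lam Elam] : exists l, l = A / K by exists (A / K).
have lam0 : 0 < lam by rewrite Elam divr_gt0.
have al1 : 0 < 1 + al by lra.
(* Bernoulli's inequality, obtained as Young's inequality for the product of [t] and [1]. *)
have bern (t : R) : 0 <= t -> (1 + al) * t - al <= t `^ (1 + al).
  move=> t0; have q0 : 0 < (1 + al) / al by rewrite divr_gt0.
  have hq : (1 + al)^-1 + ((1 + al) / al)^-1 = 1 by field; lra.
  have := conjugate_powR t0 ler01 al1 q0 hq.
  rewrite mulr1 powR1 div1r invf_div => ht.
  have : (1 + al) * t <= (1 + al) * (t `^ (1 + al) / (1 + al) + al / (1 + al)) by rewrite ler_pM2l.
  rewrite mulrDr !mulrA ![(1 + al) * _]mulrC !mulfK ?gt_eqF//; lra.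
(* This bound is linear in [a z] and [k z], so it can be summed, and [lam = A / K] makes the sum
   equal to the left-hand side. *)
have term z : z \in Z -> (1 + al) * (lam `^ al * a z) - al * (lam `^ (1 + al) * k z) <= a z `^ (1 + al) * k z `^ (- al).
  move=> /h[az kz].
  have t0 : 0 <= a z / (k z * lam) by apply: ltW; rewrite divr_gt0// mulr_gt0.
  have hb := bern _ t0.
  have c0 : 0 <= lam `^ (1 + al) * k z by rewrite mulr_ge0 ?powR_ge0 ?ltW.
  have := ler_wpM2l c0 hb.
  have -> : lam `^ (1 + al) * k z * ((1 + al) * (a z / (k z * lam)) - al) =
      (1 + al) * (lam `^ (1 + al) / lam * a z) - al * (lam `^ (1 + al) * k z).
    by field; rewrite !gt_eqF.
  have El : lam `^ (1 + al) / lam = lam `^ al.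
    by rewrite powRD ?(gt_eqF lam0) ?implybT// powRr1 ?(ltW lam0)// mulrAC mulfV ?gt_eqF// mul1r.
  rewrite El; move/le_trans; apply.
  rewrite powRM ?invr_ge0 ?mulr_ge0 ?(ltW az) ?(ltW kz) ?(ltW lam0)//.
  rewrite powR_invl ?mulr_ge0 ?(ltW kz) ?(ltW lam0)// powRM ?(ltW kz) ?(ltW lam0)//.
  rewrite !powRN [k z `^ (1 + al)]powRD ?(gt_eqF kz) ?implybT// powRr1 ?(ltW kz)//.
  rewrite le_eqVlt; apply/orP; left; apply/eqP.
  have k1 : 0 < k z `^ al by exact: powR_gt0.
  have l1 : 0 < lam `^ (1 + al) by exact: powR_gt0.
  by field; rewrite !gt_eqF.
apply: (@le_trans _ _ (\sum_(z <- Z) ((1 + al) * (lam `^ al * a z) - al * (lam `^ (1 + al) * k z)))); last first.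
  by rewrite big_seq [leRHS]big_seq; apply: ler_sum => z; exact: term.
rewrite sumrB -!mulr_sumr -/A -/K.
have Ea : lam `^ al = A `^ al / K `^ al.
  by rewrite Elam powRM ?invr_ge0 ?(ltW A0) ?(ltW K0)// powR_invl ?(ltW K0)// powRN.
rewrite !powRD ?(gt_eqF lam0) ?(gt_eqF A0) ?implybT// !powRr1 ?(ltW lam0) ?(ltW A0)// Ea powRN Elam.
rewrite le_eqVlt; apply/orP; left; apply/eqP.
have k1 : 0 < K `^ al by exact: powR_gt0.
by field; rewrite !gt_eqF.
Qed.

End Minorants.

(** * Cubes of the grid, the boundary layer and the error of one cube *)

Section Cells.
Context {R : realType}.
Notation borel := (borel R).

Definition cell n (a : 'rV[R]_n) (r : R) : set 'rV[R]_n := [set x | unit_cube (r^-1 *: (x - a))].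

Lemma measurable_cell n (a : 'rV[R]_n) r : 0 < r -> measurable (cell a r : set (borel n)).
Proof. by move=> r0; have [] := leb_affine_cube a r0. Qed.

Lemma cellK n (a u : 'rV[R]_n) r : 0 < r -> r^-1 *: (a + r *: u - a) = u.
Proof. by move=> r0; rewrite [a + _]addrC addrK scalerA mulVf ?gt_eqF// scale1r. Qed.

Lemma integral_cell n (a : 'rV[R]_n) r (f : borel n -> \bar R) : 0 < r ->
  measurable_fun setT f -> (forall x, 0 <= f x)%E ->
  (\int[leb n]_(x in cell a r) f x = (r ^+ n)%:E * \int[leb n]_(u in @unit_cube R n) f (a + r *: u)%R)%E.
Proof.
move=> r0 mf f0; rewrite (scales_integral (scales_affine a r0) (measurable_cell a r0) mf f0).
congr (_ * _)%E; rewrite (_ : _ @^-1` _ = @unit_cube R n)//.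
by apply/seteqP; split => x; rewrite /preimage/= /cell/= cellK.
Qed.

Lemma measurable_cell_qmin (p C w : R) n (H : 'M[R]_n) S (a : 'rV[R]_n) r : 0 < r ->
  measurable_fun setT ((fun x => ((C * qmin H S (r^-1 *: (x - a))) `^ p * w)%:E) : borel n -> \bar R).
Proof.
move=> r0; apply/measurable_EFinP; apply: measurable_funM; last exact: measurable_cst.
apply: (measurableT_comp (measurable_powR p)); apply: borel_continuous.
apply: continuous_mul; first exact: cst_continuous.
have rV : 0 < r^-1 by rewrite invr_gt0.
have [c _ _] := scales_comp (scales_mul n rV) (scales_shift (- a)).
have cq : continuous (qmin H S \o (fun x => r^-1 *: (x - a))).
  by move=> x; exact: continuous_comp (c x) (@continuous_qmin R n H S _).
exact: cq.
Qed.

Lemma integral_cell_qmin (p C w : R) n (H : 'M[R]_n) S (a : 'rV[R]_n) r : 0 < r -> 0 < p ->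
  0 <= C -> 0 <= w -> S != [::] -> (forall u, 0 <= qform H u) ->
  (\int[leb n]_(x in cell a r) ((C * qmin H S (r^-1 *: (x - a))) `^ p * w)%:E =
    (r ^+ n * (C `^ p * w) * qerr p H S)%:E)%E.
Proof.
move=> r0 p0 C0 w0 S0 H0; rewrite integral_cell//; first last.
- by move=> x; rewrite lee_fin mulr_ge0 ?powR_ge0.
- exact: measurable_cell_qmin.
under eq_integral => u _.
  rewrite cellK// powRM ?qmin_ge0// mulrAC EFinM.
  over.
rewrite ge0_integralZl//.
- by rewrite (qerrE (ltW p0) S0 H0) -!EFinM !mulrA.
- exact: measurable_unit_cube.
- by apply: measurable_funTS; exact: measurable_qmin.
- by move=> x _; rewrite lee_fin powR_ge0.
- by rewrite lee_fin mulr_ge0 ?powR_ge0.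
Qed.

Definition tangent n (v : 'rV[R]_n -> R) (s : 'rV[R]_n) : 'rV[R]_n * R :=
  (grad v s, v s - dot s (grad v s)).

Lemma tangentE n (v : 'rV[R]_n -> R) s x : affine_fun (tangent v s) x = v s + dot (x - s) (grad v s).
Proof. by rewrite affine_funE/= dotDl dotNl addrCA. Qed.

Definition good_cube (p e : R) n (X : set 'rV[R]_n) (v : 'rV[R]_n -> R) (omega : 'rV[R]_n * R -> R)
   (c : 'rV[R]_n) (h : R) (z : 'rV[R]_n) : Prop :=
  forall u, unit_cubec u -> interior X (h *: (z + u)) /\ comparable_at p e v omega c (h *: (z + u)).

(** Segments between points of the closed cube stay in it, so the Hessian at every intermediate
    point is comparable with the one at [c]. *)
Lemma good_cube_taylor (p e : R) n (X : set 'rV[R]_n) (v : 'rV[R]_n -> R) (omega : 'rV[R]_n * R -> R)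
   (c : 'rV[R]_n) (h : R) (z : 'rV[R]_n) : C2plus_on (interior X) v ->
  good_cube p e X v omega c h z -> forall u s, unit_cubec u -> unit_cubec s ->
  (1 - e) * (h ^+ 2 * qform (hessian v c) (u - s)) / 2 <=
  v (h *: (z + u)) - v (h *: (z + s)) - dot (h *: (z + u) - h *: (z + s)) (grad v (h *: (z + s))) <=
  (1 + e) * (h ^+ 2 * qform (hessian v c) (u - s)) / 2.
Proof.
move=> C2 good u s Cu Cs.
have Ed : h *: (z + u) - h *: (z + s) = h *: (u - s).
  by rewrite -scalerBr opprD addrACA subrr add0r.
have Ex : h *: (z + u) = h *: (z + s) + h *: (u - s) by rewrite -Ed [RHS]addrC subrK.
have seg t : 0 <= t <= 1 -> interior X (h *: (z + s) + t *: (h *: (u - s))) /\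
    comparable_at p e v omega c (h *: (z + s) + t *: (h *: (u - s))).
  move=> ht; have := good _ (unit_cubec_comb Cs Cu ht).
  by rewrite [t *: (h *: _)]scalerA [t * h]mulrC -scalerA -scalerDr addrA.
rewrite Ed {1 2}Ex -(qformZ (hessian v c) h (u - s)); apply/andP; split.
  apply: (C2_taylor_ge (@open_interior _ X) C2) => t /seg[It [hq _ _]].
  by split => //; have /andP[] := hq (h *: (u - s)).
apply: (C2_taylor_le (@open_interior _ X) C2) => t /seg[It [hq _ _]].
by split => //; have /andP[] := hq (h *: (u - s)).
Qed.

Lemma cellE n (h : R) (z x : 'rV[R]_n) : 0 < h -> h^-1 *: (x - h *: z) = h^-1 *: x - z.
Proof. by move=> h0; rewrite scalerBr scalerA mulVf ?gt_eqF// scale1r. Qed.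

Lemma cell_point n (h : R) (z x : 'rV[R]_n) : 0 < h -> h *: (z + h^-1 *: (x - h *: z)) = x.
Proof. by move=> h0; rewrite cellE// addrC subrK scalerA divff ?gt_eqF// scale1r. Qed.

(** [K] is a homothetic copy of [X]: convexity puts it in the interior, and its volume is a known
    fraction of that of [X], so nothing about the shape of the boundary has to be known. *)
Lemma boundary_layer n (X : set 'rV[R]_n) x0 tau : (0 < n)%N -> compact X ->
  convex_set (X : set (convex_lmodType 'rV[R]_n)) -> interior X x0 -> 0 < tau ->
  exists K, [/\ compact K, K `<=` interior X, K x0 & (leb n (X `\` K) <= tau%:E)%E].
Proof.
move=> n0 coX cX Ix0 t0; have mX := compact_borel coX.
have IX : interior X `<=` X by exact: interior_subset.
have [a Ea a0] := leb_compact coX.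
have fX : (leb n X < +oo)%E by rewrite Ea ltry.
have q0 : 0 < a + 1 + tau by lra.
(* With volume ratio [q] the layer has volume [(1 - q) a = a tau / (a + 1 + tau) <= tau]; adding [1]
   keeps [q] positive even if [a = 0]. *)
pose q : R := (a + 1) / (a + 1 + tau).
have [q2 q3] : 0 < q /\ q < 1.
  have a1 : 0 < a + 1 by lra.
  by split; [rewrite divr_gt0|rewrite ltr_pdivrMr// mul1r; lra].
have rr : 0 < q `^ n%:R^-1 < 1.
  have one : 1 `^ n%:R^-1 = 1 :> R by rewrite powR1.
  rewrite powR_gt0//= -[ltRHS]one; apply: gt0_ltr_powR; rewrite ?nnegrE ?invr_gt0 ?ltr0n ?(ltW q2)//.
have /andP[r0 r1] := rr.
have KI := shrink_interior cX Ix0 rr.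
have cK : closed (shrink X x0 (q `^ n%:R^-1)).
  by apply: closed_shrink => //; apply: compact_closed => //; exact: row_hausdorff.
exists (shrink X x0 (q `^ n%:R^-1)); split => //.
- by apply: (subclosed_compact cK coX) => x /KI/IX.
- by rewrite /shrink/= subrr scaler0 addr0; exact: IX.
have KX : shrink X x0 (q `^ n%:R^-1) `<=` X by move=> x /KI/IX.
have mS := closed_borel cK.
have E : leb n (X `\` shrink X x0 (q `^ n%:R^-1)) = (leb n X - leb n (shrink X x0 (q `^ n%:R^-1)))%E.
  by rewrite measureD ?setIidr.
rewrite E leb_shrink// Ea -EFinM -EFinB lee_fin powR_root ?(ltW q2)//.
have -> : a - q * a = a * tau / (a + 1 + tau) by rewrite /q; field; rewrite gt_eqF.
rewrite ler_pdivrMr//; nra.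
Qed.

(** The error is integrated over [X], the density over [interior X]; this reconciles the two
    domains. *)
Lemma boundary_null n (X : set 'rV[R]_n) x0 : (0 < n)%N -> compact X ->
  convex_set (X : set (convex_lmodType 'rV[R]_n)) -> interior X x0 ->
  leb n (X `\` interior X) = 0%E.
Proof.
move=> n0 coX cX Ix0; have mX := compact_borel coX.
have mI : measurable (interior X : set (borel n)) by apply: open_borel; exact: open_interior.
apply/eqP; rewrite eq_le measure_ge0 andbT; apply/lee_addgt0Pr => t t0; rewrite add0e.
have [K [coK KI _]] := boundary_layer n0 coX cX Ix0 t0; apply: le_trans.
have mK := compact_borel coK.
apply: le_measure; rewrite ?inE; try exact: measurableD.
by move=> x [Xx nI]; split => // /KI.
Qed.

Lemma penalty_interior (p : R) n (X : set 'rV[R]_n) (v : 'rV[R]_n -> R) (omega : 'rV[R]_n * R -> R) l x0 :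
  (0 < n)%N -> compact X -> convex_set (X : set (convex_lmodType 'rV[R]_n)) -> interior X x0 ->
  (forall z, 0 < omega z) -> measurable_fun setT (penalty p X v omega l : borel n -> \bar R) ->
  (\int[leb n]_x penalty p X v omega l x = \int[leb n]_(x in interior X) penalty p X v omega l x)%E.
Proof.
move=> n0 coX cX Ix0 w0 mp; have mX := compact_borel coX.
have mI : measurable (interior X : set (borel n)) by apply: open_borel; exact: open_interior.
have -> : (\int[leb n]_x penalty p X v omega l x = \int[leb n]_(x in X) penalty p X v omega l x)%E.
  rewrite [RHS]integral_mkcond; apply: eq_integral => x _.
  by rewrite patchE /penalty; case: ifP.
rewrite (ge0_negligible_integral (measurableD mX mI) _ _ _ (boundary_null n0 coX cX Ix0))//.
- by rewrite setDD setIidr//; exact: interior_subset.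
- exact: measurable_funTS.
- by move=> x _; exact: penalty_ge0.
Qed.

(** The half-open cubes are disjoint and lie in the interior, so a Riemann sum of the density cannot
    much exceed the integral; this serves the upper bound. The covering counterpart on a compact [K]
    serves the lower one. *)
Lemma grid_integral_ge (p e : R) n (X : set 'rV[R]_n) (v : 'rV[R]_n -> R) (omega : 'rV[R]_n * R -> R)
   h (Z : seq 'rV[R]_n) (c : 'rV[R]_n -> 'rV[R]_n) : C2plus_on (interior X) v -> continuous omega ->
  e <= 1 -> 0 < h -> uniq Z ->
  (forall z z' x, z \in Z -> z' \in Z -> unit_cube (x - z) -> unit_cube (x - z') -> z = z') ->
  (forall z, z \in Z -> good_cube p e X v omega (c z) h z) ->
  (((1 - e) * \sum_(z <- Z) (h ^+ n * density p v omega (c z)))%:E <=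
    \int[leb n]_(x in interior X) (density p v omega x)%:E)%E.
Proof.
move=> C2 cw e1 h0 uZ dZ gZ.
have mI : measurable (interior X : set (borel n)) by apply: open_borel; exact: open_interior.
have md := measurable_density p (@open_interior _ X) C2 cw.
pose f := (fun x => (density p v omega x)%:E : \bar R) \_ (interior X).
have f0 x : (0 <= f x)%E by rewrite /f patchE; case: ifP => // _; rewrite lee_fin density_ge0.
have mf : measurable_fun setT (f : borel n -> \bar R) by apply/(measurable_restrictT _ mI).
rewrite integral_mkcond -/f.
apply: le_trans (sum_integral_disjoint (B := fun z => cell (h *: z) h) (D := setT) uZ _ _ _ _ mf f0) => //.
- rewrite mulr_sumr -sumEFin big_seq [leRHS]big_seq; apply: lee_sum => z /gZ gz.
  have [mc Ec] := leb_affine_cube (h *: z) h0.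
  apply: (@le_trans _ _ (\int[leb n]_(x in cell (h *: z) h) (cst ((1 - e) * density p v omega (c z))%:E) x)%E).
    rewrite integral_cst// Ec -EFinM lee_fin.
    by move: (density _ _ _ _) (h ^+ n) => *; lra.
  apply: ge0_le_integral => //.
  - by move=> x _; rewrite lee_fin mulr_ge0 ?density_ge0// subr_ge0.
  - exact: measurable_funTS.
  move=> x cx; have := gz _ (unit_cube_sub cx); rewrite cell_point// => -[Ix [_ _ /andP[hd _]]].
  by rewrite /f patchE mem_set// lee_fin.
- by move=> z; exact: measurable_cell.
- move=> z z' x zZ zZ' c1 c2; apply: (dZ z z' (h^-1 *: x)) => //.
    by rewrite -cellE.
  by rewrite -cellE.
Qed.

Lemma grid_integral_le (p e : R) n (X K : set 'rV[R]_n) (v : 'rV[R]_n -> R) (omega : 'rV[R]_n * R -> R)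
   h (Z : seq 'rV[R]_n) (c : 'rV[R]_n -> 'rV[R]_n) : C2plus_on (interior X) v -> continuous omega ->
  0 <= e -> 0 < h -> compact K -> K `<=` interior X ->
  (forall x, K x -> exists2 z, z \in Z & unit_cube (h^-1 *: x - z)) ->
  (forall z, z \in Z -> good_cube p e X v omega (c z) h z) ->
  (\int[leb n]_(x in K) (density p v omega x)%:E <=
   ((1 + e) * \sum_(z <- Z) (h ^+ n * density p v omega (c z)))%:E)%E.
Proof.
move=> C2 cw e0 h0 coK KI cov gZ.
have mI : measurable (interior X : set (borel n)) by apply: open_borel; exact: open_interior.
have md := measurable_density p (@open_interior _ X) C2 cw.
have mK := compact_borel coK.
apply: (le_trans (integral_le_cover (Z := Z) (B := fun z => cell (h *: z) h)
   (g := fun z => cst ((1 + e) * density p v omega (c z))%:E) _ mK _ _ _ _ _)).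
- by move=> z; exact: measurable_cell.
- exact: measurable_funS md.
- by move=> x; rewrite lee_fin density_ge0.
- by move=> z; exact: measurable_cst.
- by move=> z x; rewrite lee_fin mulr_ge0 ?density_ge0//; lra.
- move=> x Kx; have [z zZ uz] := cov x Kx; exists z; rewrite -cellE// in uz; split => //.
  have := gZ z zZ _ (unit_cube_sub uz); rewrite cell_point// => -[Ix [_ _ /andP[_ hd]]].
  by rewrite lee_fin.
rewrite mulr_sumr -sumEFin; apply: lee_sum => z _.
have [mc Ec] := leb_affine_cube (h *: z) h0.
rewrite integral_cst// Ec -EFinM lee_fin.
by move: (density _ _ _ _) (h ^+ n) => *; lra.
Qed.

Lemma lipschitz_bounded n (X : set 'rV[R]_n) (v : 'rV[R]_n -> R) :
  compact X -> [lipschitz v x | x in X] -> exists T, forall x, X x -> `|v x| <= T.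
Proof.
move=> coX /lipschitzE[k k0 lv].
have [[x0 Xx0]|nX] := pselect (X !=set0); last by exists 1 => // x Xx; exfalso; apply: nX; exists x.
have [b b0 hb] := compact_norm_bound coX.
exists (`|v x0| + k * (b + b)) => x Xx.
have := lv x x0 Xx Xx0 => h.
have h2 : `|x - x0| <= b + b.
  by apply: (le_trans (ler_normB _ _)); apply: lerD; apply: ltW; exact: hb.
have h3 : `|v x| <= `|v x - v x0| + `|v x0|.
  by rewrite -{1}[v x](subrK (v x0)) ler_normD.
have h4 : k * `|x - x0| <= k * (b + b) by rewrite ler_pM2l.
move: (`|v x|) (`|v x - v x0|) (`|v x0|) (k * `|x - x0|) (k * (b + b)) h h3 h4 => *; lra.
Qed.

Lemma weight_bound n (X : set 'rV[R]_n) (v : 'rV[R]_n -> R) (omega : 'rV[R]_n * R -> R) :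
  compact X -> [lipschitz v x | x in X] -> continuous omega ->
  exists2 W, 0 < W & forall x, X x -> omega (x, v x) <= W.
Proof.
move=> coX lX cw; have [T hT] := lipschitz_bounded coX lX.
have co : compact (X `*` `[- T, T]%classic) by apply: compact_setX => //; exact: segment_compact.
have /compact_bounded/ex_strict_bound_gt0[W W0 hW] : compact (omega @` (X `*` `[- T, T]%classic)).
  by apply: continuous_compact => //; apply: continuous_subspaceT.
exists W => // x Xx; apply: ltW; apply: (le_lt_trans (ler_norm _)); apply: hW.
by exists (x, v x) => //; split => //=; rewrite in_itv/= -ler_norml; exact: hT.
Qed.

Lemma cell_weight (p h det w : R) n : 0 < p -> (0 < n)%N -> 0 < h -> 0 < det -> 0 < w ->
  (h ^+ n * (det `^ (p / (n%:R + 2 * p)) * w `^ (n%:R / (n%:R + 2 * p)))) `^ (1 + 2 * p / n%:R) =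
  h ^+ n * h `^ (2 * p) * (det `^ (p / n%:R) * w).
Proof.
move=> p0 n0 h0 d0 w0; have nR : 0 < n%:R :> R by rewrite ltr0n.
have D0 : 0 < n%:R + 2 * p by lra.
have E1 : 1 + 2 * p / n%:R = (n%:R + 2 * p) / n%:R by field; rewrite gt_eqF.
rewrite !powRM ?mulr_ge0 ?powR_ge0 ?exprn_ge0 ?(ltW h0)// -!powRrM E1.
rewrite -{1}powR_mulrn ?(ltW h0)// -powRrM.
have -> : n%:R * ((n%:R + 2 * p) / n%:R) = n%:R + 2 * p by field; rewrite gt_eqF.
have -> : p / (n%:R + 2 * p) * ((n%:R + 2 * p) / n%:R) = p / n%:R by field; rewrite !gt_eqF.
have -> : n%:R / (n%:R + 2 * p) * ((n%:R + 2 * p) / n%:R) = 1 by field; rewrite !gt_eqF.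
by rewrite powRr1 ?(ltW w0)// powRD ?(gt_eqF h0) ?implybT// powR_mulrn ?(ltW h0).
Qed.

Lemma weight_pow (p c h w : R) : 0 < c -> 0 < h ->
  (c / 2 * h ^+ 2) `^ p * (c * w) = c `^ (1 + p) * 2 `^ (- p) * (h `^ (2 * p) * w).
Proof.
move=> e1 h0.
rewrite powRM ?divr_ge0 ?sqr_ge0 ?(ltW e1)// powRM ?(ltW e1) ?invr_ge0//.
rewrite -powR_mulrn ?(ltW h0)// -powRrM powR_invl//.
rewrite powRD ?(gt_eqF e1) ?implybT// powRr1 ?(ltW e1)//.
by move: (c `^ p) (2 `^ (- p)) (h `^ _) => *; ring.
Qed.

(** The allotment makes [k^(- al)] at most [(th^2 a / az)^al m^(- al)], where [al = 2 p / n]. As the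
    weight of the cube is [az^(1 + al)], a factor [az^al] cancels and [a^al az] remains, which sums
    to [a^(1 + al)]. In the exponent of [th], [1 + p] comes from Hessian and weight, [2 al] from
    [th^2]. *)
Lemma cell_error_upper (p h det w e th a az m k qe DK : R) n : 0 < p -> (0 < n)%N -> 0 < h ->
  0 < det -> 0 < w -> 0 <= e -> 1 + e <= th -> 0 < a -> 0 < m -> 0 < k -> 0 <= qe ->
  az = h ^+ n * (det `^ (p / (n%:R + 2 * p)) * w `^ (n%:R / (n%:R + 2 * p))) ->
  k `^ (2 * p / n%:R) * qe <= DK * det `^ (p / n%:R) ->
  m * az / (th ^+ 2 * a) <= k ->
  m `^ (2 * p / n%:R) * (h ^+ n * (((1 + e) / 2 * h ^+ 2) `^ p * ((1 + e) * w)) * qe) <=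
  th `^ (1 + p + 2 * (2 * p / n%:R)) * 2 `^ (- p) * DK * a `^ (2 * p / n%:R) * az.
Proof.
move=> p0 n0 h0 d0 w0 e0 eth a0 m0 k0 qe0 Eaz hq hk.
have nR : 0 < n%:R :> R by rewrite ltr0n.
have al0 : 0 < 2 * p / n%:R by rewrite divr_gt0// mulr_gt0.
have th0 : 0 < th by lra.
have az0 : 0 < az by rewrite Eaz mulr_gt0 ?exprn_gt0// mulr_gt0 ?powR_gt0.
have Ew := cell_weight p0 n0 h0 d0 w0; rewrite -Eaz in Ew.
set al := 2 * p / n%:R in al0 hq hk Ew *.
have mk : m <= th ^+ 2 * a / az * k.
  have : m * az <= k * (th ^+ 2 * a) by rewrite -ler_pdivrMr ?mulr_gt0 ?exprn_gt0.
  by rewrite -ler_pdivlMr// => /le_trans; apply; rewrite le_eqVlt; apply/orP; left; apply/eqP; field; rewrite gt_eqF.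
have B0 : 0 < th ^+ 2 * a / az by rewrite divr_gt0// mulr_gt0// exprn_gt0.
have h1 : m `^ al * qe <= (th ^+ 2 * a / az) `^ al * (DK * det `^ (p / n%:R)).
  apply: (@le_trans _ _ ((th ^+ 2 * a / az * k) `^ al * qe)).
    rewrite ler_wpM2r//; apply: ge0_ler_powR; rewrite ?nnegrE ?(ltW al0) ?(ltW m0)//.
    by apply: mulr_ge0; [exact: ltW B0|exact: ltW k0].
  rewrite powRM; [|exact: ltW B0|exact: ltW k0].
  by rewrite -mulrA ler_wpM2l// powR_ge0.
have e1 : 0 < 1 + e by lra.
rewrite (weight_pow p w e1 h0).
have h2 : (1 + e) `^ (1 + p) <= th `^ (1 + p).
  by apply: ge0_ler_powR; rewrite ?nnegrE ?(ltW th0) ?(ltW e1)//; lra.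
have E3 : (th ^+ 2 * a / az) `^ al = th `^ (2 * al) * a `^ al / az `^ al.
  have t2 : 0 <= th ^+ 2 * a by rewrite mulr_ge0 ?sqr_ge0 ?(ltW a0).
  have azV : 0 <= az^-1 by rewrite invr_ge0 ltW.
  rewrite (powRM _ t2 azV) (powRM _ (sqr_ge0 th) (ltW a0)).
  by rewrite -powR_mulrn ?(ltW th0)// -powRrM powR_invl ?(ltW az0)// powRN.
rewrite E3 in h1.
have azal : 0 < az `^ al by exact: powR_gt0.
have E4 : az `^ (1 + al) = az * az `^ al by rewrite powRD ?(gt_eqF az0) ?implybT// powRr1 ?(ltW az0).
rewrite E4 in Ew.
have E5 : th `^ (1 + p + 2 * al) = th `^ (1 + p) * th `^ (2 * al) by rewrite powRD ?(gt_eqF th0) ?implybT.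
rewrite E5.
apply: (@le_trans _ _ (th `^ (1 + p) * 2 `^ (- p) * (h ^+ n * h `^ (2 * p) * w) * (m `^ al * qe))).
  have -> : m `^ al * (h ^+ n * ((1 + e) `^ (1 + p) * 2 `^ (- p) * (h `^ (2 * p) * w)) * qe) =
     (1 + e) `^ (1 + p) * (2 `^ (- p) * (h ^+ n * h `^ (2 * p) * w) * (m `^ al * qe)) by ring.
  rewrite -!mulrA ler_wpM2r// !mulr_ge0 ?powR_ge0 ?exprn_ge0 ?(ltW h0) ?(ltW w0)//.
apply: (@le_trans _ _ (th `^ (1 + p) * 2 `^ (- p) * (h ^+ n * h `^ (2 * p) * w) *
   (th `^ (2 * al) * a `^ al / az `^ al * (DK * det `^ (p / n%:R))))).
  by rewrite ler_wpM2l// !mulr_ge0 ?powR_ge0 ?exprn_ge0 ?(ltW h0) ?(ltW w0).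
have -> : th `^ (1 + p) * 2 `^ (- p) * (h ^+ n * h `^ (2 * p) * w) *
   (th `^ (2 * al) * a `^ al / az `^ al * (DK * det `^ (p / n%:R))) =
   th `^ (1 + p) * 2 `^ (- p) * (th `^ (2 * al) * a `^ al / az `^ al * DK) *
   (h ^+ n * h `^ (2 * p) * (det `^ (p / n%:R) * w)) by ring.
rewrite -Ew.
move: (th `^ (1 + p)) (2 `^ (- p)) (th `^ (2 * al)) (a `^ al) (az `^ al) azal => A B C D E E0.
rewrite le_eqVlt; apply/orP; left; apply/eqP.
by field; rewrite gt_eqF.
Qed.

End Cells.

(** * Upper bound: tangents at quantizer points and along the boundary *)

Section UpperBound.
Context {R : realType}.
Notation borel := (borel R).

Lemma seq_choice (T : eqType) (U : Type) (u0 : U) (Z : seq T) (P : T -> U -> Prop) :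
  (forall z, z \in Z -> exists u, P z u) -> exists f, forall z, z \in Z -> P z (f z).
Proof.
move=> h; have [f hf] : {f : T -> U & forall z, z \in Z -> P z (f z)}.
  apply: (@choice T U (fun z u => z \in Z -> P z u)) => z.
  by have [/h[u ?]|_] := boolP (z \in Z); [exists u|exists u0].
by exists f.
Qed.

Lemma hessian_posdef n (X : set 'rV[R]_n) (v : 'rV[R]_n -> R) x : C2plus_on (interior X) v -> interior X x ->
  forall u, u != 0 -> 0 < qform (hessian v x) u.
Proof. by case=> _ _ _ _ h Ix u u0; exact: h. Qed.

Lemma hessian_psd n (X : set 'rV[R]_n) (v : 'rV[R]_n -> R) x : C2plus_on (interior X) v -> interior X x ->
  forall u, 0 <= qform (hessian v x) u.
Proof.
move=> C2 Ix u; have [->|u0] := eqVneq u 0.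
  by rewrite /qform !mul0mx mxE.
by apply: ltW; exact: hessian_posdef C2 Ix _ u0.
Qed.

Lemma hessian_quantc (p : R) n (X : set 'rV[R]_n) (v : 'rV[R]_n -> R) x : 0 < p -> (0 < n)%N ->
  C2plus_on (interior X) v -> interior X x ->
  0 < \det (hessian v x) /\
  quantc p (hessian v x) = \det (hessian v x) `^ (p / n%:R) * quantc p (1%:M : 'M[R]_n).
Proof.
move=> p0 n0 C2 Ix; apply: quantc_det => //.
  exact: hessian_sym (@open_interior _ X) C2 _ Ix.
exact: hessian_posdef C2 Ix.
Qed.

Lemma density_gt0 (p : R) n (X : set 'rV[R]_n) (v : 'rV[R]_n -> R) omega x : 0 < p -> (0 < n)%N ->
  C2plus_on (interior X) v -> (forall z, 0 < omega z) -> interior X x -> 0 < density p v omega x.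
Proof.
move=> p0 n0 C2 w0 Ix; have [d0 _] := hessian_quantc p0 n0 C2 Ix.
by rewrite mulr_gt0 ?powR_gt0.
Qed.

(** [k] is the integer part of the target [m x1]: for large [m] it is in the range where the
    quantization limit is nearly attained, and rounding costs at most a factor [th]. *)
Lemma cell_points (p : R) n (X : set 'rV[R]_n) (v : 'rV[R]_n -> R) x (th x1 ka : R) : 0 < p -> (0 < n)%N ->
  C2plus_on (interior X) v -> interior X x -> 1 < th -> 0 < x1 -> 0 < ka ->
  exists m0 : nat, forall m, (m0 <= m)%N -> exists S k, [/\ S != [::], (size S <= k)%N,
    (forall s, s \in S -> unit_cubec s),
    k%:R `^ (2 * p / n%:R) * qerr p (hessian v x) S <=
      (quantc p (1%:M : 'M[R]_n) + ka) * \det (hessian v x) `^ (p / n%:R) &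
    [/\ (0 < k)%N, k%:R <= m%:R * x1 & m%:R * x1 / th <= k%:R]].
Proof.
move=> p0 n0 C2 Ix th1 x10 ka0.
have aux (q D q1 : R) : q = D * q1 -> 0 < D -> q < (q1 + ka) * D by move=> -> ?; nra.
have [m1 h1] : exists m0 : nat, forall m, (m0 <= m)%N -> exists S, [/\ S != [::], (size S <= m)%N,
    (forall s, s \in S -> unit_cubec s) & m%:R `^ (2 * p / n%:R) * qerr p (hessian v x) S <=
      (quantc p (1%:M : 'M[R]_n) + ka) * \det (hessian v x) `^ (p / n%:R)].
  have [d0 Eq] := hessian_quantc p0 n0 C2 Ix.
  exact: (quantc_upper_cube p0 n0 (hessian_psd C2 Ix) (aux _ _ _ Eq (powR_gt0 (p / n%:R) d0))).
(* The first summand forces [k >= m1 + 1], in particular [k > 0]; the second is the threshold of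
   [trunc_lower]. *)
have [m2 h2] := eventually_ge (th * m1.+1%:R + th / (th - 1)) x10.
exists m2 => m /h2 hm.
have th0 : 0 < th by lra.
have t0 : 0 < th / (th - 1) by rewrite divr_gt0// subr_gt0.
have t1 : 0 <= th * m1.+1%:R by rewrite mulr_ge0// ltW.
have tr := @trunc_lower R (m%:R * x1) th th1.
have hk : m%:R * x1 / th <= (Num.truncn (m%:R * x1))%:R by apply: tr; lra.
have hk1 : (m1.+1 <= Num.truncn (m%:R * x1))%N.
  rewrite -(@ler_nat R); apply: le_trans hk; rewrite ler_pdivlMr//; lra.
have [S [S0 sS cS eS]] := h1 _ (ltnW hk1).
exists S, (Num.truncn (m%:R * x1)); split => //; split => //.
  exact: leq_trans hk1.
have y0 : 0 <= m%:R * x1 by rewrite mulr_ge0// ltW.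
by have /andP[] := truncn_itv y0.
Qed.

(** With [e = 1 - 1 / th], losses in [1 - e] and in [1 + e] are both expressed by powers of [th]. *)
Lemma theta_gap (th : R) : 1 < th ->
  [/\ 0 < 1 - th^-1 < 1, 1 - (1 - th^-1) = th^-1 & 1 + (1 - th^-1) <= th].
Proof.
move=> th1; have th0 : 0 < th by lra.
have thV : th * th^-1 = 1 by rewrite mulfV ?gt_eqF.
have thV0 : 0 < th^-1 by rewrite invr_gt0.
have thV1 : th^-1 < 1 by rewrite invf_lt1.
by move: (th^-1) thV thV0 thV1 => t *; split; [apply/andP; split; lra|lra|nra].
Qed.

(** The cubes share a fraction [1 / th] of the [m] tangents in proportion to their masses; the
    boundary layer receives the fraction [e = 1 - 1 / th]. The Riemann sum [a] is fixed before [ka],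
    because the excess caused by [ka] is multiplied by a power of [a]. *)
Lemma upper_core (p th eta : R) n (X : set 'rV[R]_n) (v : 'rV[R]_n -> R) (omega : 'rV[R]_n * R -> R) x0 :
  0 < p -> (0 < n)%N -> compact X -> [lipschitz v x | x in X] ->
  convex_set (X : set (convex_lmodType 'rV[R]_n)) ->
  convex_function (X : set (convex_lmodType 'rV[R]_n)) v -> C2plus_on (interior X) v ->
  continuous omega -> (forall z, 0 < omega z) -> interior X x0 -> 1 < th -> 0 < eta ->
  exists a, [/\ 0 < a, (a%:E <= th%:E * \int[leb n]_(x in interior X) (density p v omega x)%:E)%E &
   forall ka, 0 < ka -> exists m0 : nat, forall m, (m0 <= m)%N -> exists2 l, Pc m X v l &
    ((m%:R `^ (2 * p / n%:R))%:E * \int[leb n]_x penalty p X v omega l x <=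
     (th `^ (1 + p + 2 * (2 * p / n%:R)) * 2 `^ (- p) * (quantc p (1%:M : 'M[R]_n) + ka) *
       a `^ (1 + 2 * p / n%:R) + eta)%:E)%E].
Proof.
move=> p0 n0 coX lX cX cv C2 cw w0 Ix0 th1 eta0.
have auxc (x y t cp w : R) : 0 <= w -> 0 <= cp -> x * y <= t -> x * (cp * y * w) <= w * (cp * t).
  move=> ? ? ?; have -> : x * (cp * y * w) = w * cp * (x * y) by ring.
  by rewrite [leRHS]mulrA; apply: ler_wpM2l => //; rewrite mulr_ge0.
have auxb (B : R) : 0 <= B -> B / (B + 1) <= 1 by move=> ?; rewrite ler_pdivrMr; lra.
have th0 : 0 < th by lra.
have nR : 0 < n%:R :> R by rewrite ltr0n.
have [e Ee] : exists e, e = 1 - th^-1 by exists (1 - th^-1).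
have thV : th * th^-1 = 1 by rewrite mulfV ?gt_eqF.
have [e01 _ eth] := theta_gap th1; rewrite -Ee in e01 eth.
have /andP[e0 e1] := e01.
have e10 : 0 <= 1 + e by lra.
set al := 2 * p / n%:R.
have al0 : 0 < al by rewrite divr_gt0// mulr_gt0.
have [C C0 hC] := tangent_net n0 coX lX cv C2.
have [W W0 hW] := weight_bound coX lX cw.
(* [B] bounds [m^al] times the integrand on the layer, where the net of at least [m e / th] tangents
   has uniform error [C mD^(- 2 / n)]. A layer of volume [eta / (B + 1)] thus costs at most
   [eta]. *)
pose B := W * (C `^ p * (th / e) `^ al).
have B0 : 0 <= B by rewrite !mulr_ge0 ?powR_ge0// ltW.
have tau0 : 0 < eta / (B + 1) by rewrite divr_gt0//; lra.
have [K [coK KI Kx0 lK]] := boundary_layer n0 coX cX Ix0 tau0.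
have [h [Z [c [h0 uZ dZ cov gZ]]]] := good_grid p0 n0 coK KI C2 cw w0 e01.
have gc z : z \in Z -> good_cube p e X v omega (c z) h z by move=> /gZ[].
have Ic z : z \in Z -> interior X (c z) by move=> /gZ[].
pose az z := h ^+ n * density p v omega (c z).
have az0 z : z \in Z -> 0 < az z.
  by move=> /Ic Iz; rewrite mulr_gt0 ?exprn_gt0// (density_gt0 p0 n0 C2 w0 Iz).
pose a := \sum_(z <- Z) az z.
have [z0 z0Z _] := cov _ Kx0.
have a0 : 0 < a.
  rewrite /a (big_rem z0)//= ltr_wpDr ?az0// big_seq.
  by apply: sumr_ge0 => z /mem_rem /az0/ltW.
exists a; split => //.
  have hle := grid_integral_ge C2 cw (ltW e1) h0 uZ dZ gc.
  have -> : a%:E = (th%:E * ((1 - e) * a)%:E)%E.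
    by rewrite -EFinM Ee opprB addrCA subrr addr0 mulrA thV mul1r.
  by apply: lee_wpmul2l; rewrite ?lee_fin ?(ltW th0).
move=> ka ka0.
have mI : measurable (interior X : set (borel n)) by apply: open_borel; exact: open_interior.
have IX : interior X `<=` X by exact: interior_subset.
have mX := compact_borel coX.
have mK := compact_borel coK.
(* These shares add up to [1 / th], which leaves [m e] tangents for the layer. *)
have x10 z : z \in Z -> 0 < az z / (th * a) by move=> /az0 ?; rewrite divr_gt0// mulr_gt0.
have [m1 hm1] := eventually_all (fun z zZ => cell_points p0 n0 C2 (Ic z zZ) th1 (x10 z zZ) ka0).
have [m2 hm2] := eventually_ge (th / (th - 1)) e0.
exists (m1 + m2).+1 => m hm.
have mp : 0 < m%:R :> R by rewrite ltr0n (leq_ltn_trans _ hm).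
have hz := hm1 m (leq_trans (leq_addr _ _) (ltnW hm)).
have /trunc_lower htr := hm2 m (leq_trans (leq_addl _ _) (ltnW hm)).
have {htr}hmD := htr th1.
have me0 : 0 < m%:R * e by rewrite mulr_gt0.
have mDu : (Num.truncn (m%:R * e))%:R <= m%:R * e by have /andP[] := truncn_itv (ltW me0).
move: (Num.truncn _) hmD mDu => mD hmD mDu.
have mDR : 0 < mD%:R :> R by apply: lt_le_trans hmD; rewrite divr_gt0.
have mD0 : (0 < mD)%N by rewrite ltr0n in mDR.
have [L [sL IL eL]] := hC _ mD0.
have [S hS'] := seq_choice [::] hz.
have [kk hS] := seq_choice 0%N hS'.
pose PL := flatten [seq [seq tangent v (h *: (z + s)) | s <- S z] | z <- Z] ++ [seq tangent v s | s <- L].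
have PL0 : PL != [::].
  have [s sL0 _] := eL _ Ix0.
  have : tangent v s \in PL by rewrite mem_cat map_f ?orbT.
  by case: PL.
have sPL : (size PL <= m)%N.
  rewrite size_cat size_map size_flatten /shape -map_comp sumnE big_map -(@ler_nat R) natrD natr_sum.
  have h1 : \sum_(z <- Z) (size (map (fun s => tangent v (h *: (z + s))) (S z)))%:R <= m%:R * th^-1 :> R.
    have -> : m%:R * th^-1 = \sum_(z <- Z) m%:R * (az z / (th * a)).
      rewrite -mulr_sumr -mulr_suml -/a; congr (_ * _); rewrite invfM mulrCA mulfV ?mulr1//.
      by rewrite gt_eqF.
    rewrite big_seq [leRHS]big_seq; apply: ler_sum => z /hS[_ sk _ _ [_ ku _]].
    by apply: le_trans ku; rewrite ler_nat size_map.
  have h2 : (size L)%:R <= m%:R * (1 - th^-1).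
    by rewrite -Ee; apply: le_trans mDu; rewrite ler_nat.
  apply: le_trans (lerD h1 h2) _; rewrite -mulrDr addrC subrK mulr1//.
have PLv ab : ab \in PL -> forall x, X x -> affine_fun ab x <= v x.
  rewrite mem_cat => /orP[/flatten_mapP[z zZ /mapP[s sS ->]]|/mapP[s sL' ->]] x Xx; rewrite tangentE.
    apply: (convex_tangent cv C2) => //; have [_ _ cS _ _] := hS _ zZ.
    by have [] := gc _ zZ _ (cS _ sS).
  by apply: (convex_tangent cv C2) => //; exact: IL.
have [l Pl lge] := Pc_of_seq PL0 sPL PLv.
exists l => //.
have mpen := measurable_penalty p coX lX cw (Pc_continuous Pl).
have lv x : X x -> l x <= v x by case: Pl => ? [? [_ _ hl]]; exact: hl.
rewrite (penalty_interior n0 coX cX Ix0 w0 mpen).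
pose wz z := omega (c z, v (c z)).
pose Ce := (1 + e) / 2 * h ^+ 2.
have Ce0 : 0 <= Ce by rewrite mulr_ge0 ?sqr_ge0// divr_ge0.
(* [Some z] stands for a cube of the grid and [None] for the layer, so that one covering estimate
   treats both. *)
pose BB (o : option 'rV[R]_n) : set 'rV[R]_n := if o is Some z then cell (h *: z) h else interior X `\` K.
pose cD := (C * mD%:R `^ (- (2 / n%:R))) `^ p * W.
have cD0 : 0 <= cD by rewrite mulr_ge0 ?powR_ge0// ltW.
pose gg (o : option 'rV[R]_n) : borel n -> \bar R :=
  if o is Some z then (fun x => ((Ce * qmin (hessian v (c z)) (S z) (h^-1 *: (x - h *: z))) `^ p * ((1 + e) * wz z))%:E)
  else cst cD%:E.
have gg0 o x : (0 <= gg o x)%E.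
  case: o => [z|]; rewrite lee_fin// mulr_ge0 ?powR_ge0//.
  by rewrite mulr_ge0 ?(ltW (w0 _)).
have pen_le x b q : interior X x -> v x - l x <= b -> omega (x, v x) <= q ->
    (penalty p X v omega l x <= (b `^ p * q)%:E)%E.
  move=> Ix hb hq; have Xx := IX _ Ix.
  have vl : 0 <= v x - l x by rewrite subr_ge0 lv.
  rewrite /penalty mem_set// lee_fin ler_pM ?powR_ge0 ?(ltW (w0 _))//.
  by apply: ge0_ler_powR; rewrite ?nnegrE ?(ltW p0)//; exact: le_trans hb.
have step : (\int[leb n]_(x in interior X) penalty p X v omega l x <=
   \sum_(o <- None :: map Some Z) \int[leb n]_(x in BB o) gg o x)%E.
  apply: integral_le_cover => //.
  - by case=> [z|]; [exact: measurable_cell|exact: measurableD].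
  - exact: measurable_funTS.
  - by move=> x; exact: penalty_ge0.
  - by case=> [z|]; [exact: measurable_cell_qmin|exact: measurable_cst].
  move=> x Ix; have [Kx|nKx] := pselect (K x); last first.
    exists None; split => //; rewrite ?inE//.
    apply: pen_le => //; last exact: hW (IX _ Ix).
    have [s sL' hs] := eL _ Ix; apply: le_trans hs.
    have : tangent v s \in PL by rewrite mem_cat map_f ?orbT.
    move=> /(lge _ x); rewrite tangentE.
    by move: (dot _ _) => d; lra.
  have [z zZ uz] := cov x Kx; rewrite -cellE// in uz.
  exists (Some z); split => //; first by rewrite inE map_f// orbT.
  have [S0 _ cS _ _] := hS z zZ.
  have [_ ] := gc z zZ _ (unit_cube_sub uz); rewrite cell_point// => -[_ /andP[_ hw] _].
  apply: pen_le => //.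
  have [s sS ->] := qmin_ex (hessian v (c z)) (h^-1 *: (x - h *: z)) S0.
  have /andP[_] := good_cube_taylor C2 (gc z zZ) (unit_cube_sub uz) (cS s sS).
  rewrite cell_point//; move=> ht.
  have : tangent v (h *: (z + s)) \in PL.
    rewrite mem_cat; apply/orP; left; apply/flatten_mapP; exists z => //.
    by apply/mapP; exists s.
  move=> /(lge _ x); rewrite tangentE /Ce.
  by move: ht; move: (dot _ _) (qform _ _) => d q; lra.
apply: le_trans (lee_wpmul2l _ step) _; first by rewrite lee_fin powR_ge0.
rewrite big_cons big_map ge0_muleDr; first last.
- by apply: sume_ge0 => z _; apply: integral_ge0 => x _; exact: gg0 (Some z) x.
- by apply: integral_ge0 => x _; rewrite lee_fin.
rewrite [X in (_ <= X)%E]EFinD [X in (_ <= X)%E]addeC; apply: leeD.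
  rewrite /BB /gg integral_cst//; last exact: measurableD.
  have hl : (leb n (interior X `\` K) <= (eta / (B + 1))%:E)%E.
    apply: le_trans lK; apply: le_measure; rewrite ?inE; try exact: measurableD.
    by move=> x [/IX].
  have hc : m%:R `^ al * cD <= B.
    rewrite /cD powRM ?powR_ge0// -powRrM /B.
    have -> : - (2 / n%:R) * p = - al by rewrite /al; field; rewrite gt_eqF.
    have hpow : m%:R `^ al * mD%:R `^ (- al) <= (th / e) `^ al.
      have te0 : 0 < th / e by rewrite divr_gt0.
      have te1 : m%:R <= th / e * mD%:R.
        apply: (@le_trans _ _ (th / e * (m%:R * e / th))).
          by rewrite le_eqVlt; apply/orP; left; apply/eqP; field; rewrite !gt_eqF.
        by rewrite ler_pM2l.
      have pD : 0 < mD%:R `^ al by exact: powR_gt0.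
      rewrite powRN ler_pdivrMr//; move: (th / e) te0 te1 => te te0 te1.
      rewrite -powRM ?(ltW te0)//.
      by apply: ge0_ler_powR => //; rewrite ?nnegrE ?(ltW al0)// mulr_ge0// ltW.
    by apply: auxc; rewrite ?powR_ge0 ?(ltW W0).
  apply: (@le_trans _ _ (B%:E * (eta / (B + 1))%:E)%E).
    rewrite muleA -EFinM; apply: lee_pmul => //.
      by rewrite lee_fin mulr_ge0 ?powR_ge0.
  by rewrite -EFinM lee_fin mulrCA ger_pMr// auxb.
rewrite ge0_sume_distrr; last first.
  by move=> z _; apply: integral_ge0 => x _; exact: gg0 (Some z) x.
have -> : a `^ (1 + al) = a `^ al * \sum_(z <- Z) az z.
  by rewrite -/a powRD ?(gt_eqF a0) ?implybT// powRr1 ?(ltW a0)// mulrC.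
rewrite mulrA mulr_sumr -sumEFin big_seq [leRHS]big_seq; apply: lee_sum => z zZ.
have [S0 _ _ hq [k0 _ hk]] := hS z zZ.
have Iz := Ic _ zZ.
have w10 : 0 <= (1 + e) * wz z by rewrite mulr_ge0 ?(ltW (w0 _)).
rewrite /BB /gg integral_cell_qmin//; last exact: hessian_psd C2 Iz.
rewrite -EFinM lee_fin /Ce.
have [d0 _] := hessian_quantc p0 n0 C2 Iz.
apply: (@cell_error_upper R p h (\det (hessian v (c z))) (wz z) e th a (az z) m%:R (kk z)%:R) => //.
- exact: w0.
- exact: ltW.
- by rewrite ltr0n.
- exact: qerr_ge0.
- apply: le_trans hk; rewrite le_eqVlt; apply/orP; left; apply/eqP.
  by move: (az z) => y; field; rewrite !gt_eqF.
Qed.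

End UpperBound.

(** * Lower bound: sharing the affine pieces among disjoint closed cubes *)

Section LowerBound.
Context {R : realType}.
Notation borel := (borel R).

Definition box n (h : R) (z : 'rV[R]_n) : set 'rV[R]_n := (fun u => h *: (z + u)) @` @unit_cubec R n.

Lemma compact_box n h (z : 'rV[R]_n) : 0 < h -> compact (box h z).
Proof.
move=> h0; apply: continuous_compact; last exact: compact_unit_cubec.
apply: continuous_subspaceT; have [c _ _] := scales_affine (h *: z) h0.
rewrite (_ : (fun u => h *: (z + u)) = (fun u => h *: z + h *: u)) //.
by apply/funext => u; rewrite scalerDr.
Qed.

Lemma continuous_at_sub (T : topologicalType) (f g : T -> R) x :
  {for x, continuous f} -> {for x, continuous g} -> {for x, continuous (fun y => f y - g y)}.
Proof. by move=> cf cg; exact: (cvgB cf cg). Qed.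

(* An affine minorant within [c0] of [v] at both [x] and [y] would exceed [v] at
   the midpoint. *)
Lemma midpoint_gap n (X A B : set 'rV[R]_n) (v : 'rV[R]_n -> R) :
  convex_set (X : set (convex_lmodType 'rV[R]_n)) -> C2plus_on (interior X) v ->
  compact A -> compact B -> A `<=` interior X -> B `<=` interior X -> (forall x, A x -> ~ B x) ->
  exists2 c0, 0 < c0 & forall x y, A x -> B y -> v (2^-1 *: x + 2^-1 *: y) + c0 <= (v x + v y) / 2.
Proof.
move=> cX C2 coA coB AI BI AB.
have [[[x0 y0] [/= Ax0 By0]]|nAB] := pselect ((A `*` B) !=set0); last first.
  by exists 1 => // x y Ax By; exfalso; apply: nAB; exists (x, y).
have cv x : interior X x -> {for x, continuous v} by case: C2 => c _ _ _ _ Ix; apply: c; exact: mem_set.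
pose F (z : 'rV[R]_n * 'rV[R]_n) := (v z.1 + v z.2) * 2^-1 - v (2^-1 *: z.1 + 2^-1 *: z.2).
have cmid : continuous (fun z : 'rV[R]_n * 'rV[R]_n => 2^-1 *: z.1 + 2^-1 *: z.2).
  apply: continuous_row => i.
  have E : (fun z : 'rV[R]_n * 'rV[R]_n => (2^-1 *: z.1 + 2^-1 *: z.2) ord0 i) =
           (fun z => 2^-1 * z.1 ord0 i + 2^-1 * z.2 ord0 i).
    by apply/funext => z; rewrite !mxE.
  rewrite E; apply: continuous_add; apply: continuous_mul; try exact: cst_continuous.
    by apply: continuous_coord => z; exact: cvg_fst.
  by apply: continuous_coord => z; exact: cvg_snd.
have Imid x y : interior X x -> interior X y -> interior X (2^-1 *: x + 2^-1 *: y).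
  move=> Ix Iy; have Xy := interior_subset Iy.
  have h2 : 0 < (2^-1 : R) <= 1 by apply/andP; split; lra.
  have := interior_convex_comb cX Ix Xy h2.
  by rewrite (_ : 1 - 2^-1 = 2^-1 :> R)//; lra.
have cF : {within A `*` B, continuous F}.
  apply: continuous_in_subspaceT => -[x y] /set_mem[/= Ax By].
  apply: cvgB; first apply: cvgM; last first.
  - apply: (@continuous_comp _ _ _ (fun z : 'rV[R]_n * 'rV[R]_n => 2^-1 *: z.1 + 2^-1 *: z.2) v); first exact: cmid.
    by apply: cv; apply: Imid; [exact: AI|exact: BI].
  - exact: cvg_cst.
  apply: cvgD.
    apply: (@continuous_comp _ _ _ (fun z : 'rV[R]_n * 'rV[R]_n => z.1) v); first exact: cvg_fst.
    by apply: cv; exact: AI.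
  apply: (@continuous_comp _ _ _ (fun z : 'rV[R]_n * 'rV[R]_n => z.2) v); first exact: cvg_snd.
  by apply: cv; exact: BI.
have ne : (A `*` B) !=set0 by exists (x0, y0).
have [[x1 y1] /set_mem[/= Ax1 By1] hmin] := compact_EVT_min ne (compact_setX coA coB) cF.
exists (F (x1, y1)).
  rewrite /F/= subr_gt0; apply: (strict_midpoint cX C2); [exact: AI|exact: BI|].
  by apply/eqP => E; apply: (AB x1) => //; rewrite E.
move=> x y Ax By; have /hmin : (x, y) \in A `*` B by rewrite inE.
rewrite [in X in _ <= X]/F /=; move: (F _) => q; lra.
Qed.

Lemma midpoint_gap_seq (T : eqType) (Z : seq T) n (X : set 'rV[R]_n) (Q : T -> set 'rV[R]_n) (v : 'rV[R]_n -> R) :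
  convex_set (X : set (convex_lmodType 'rV[R]_n)) -> C2plus_on (interior X) v ->
  (forall z, z \in Z -> compact (Q z) /\ Q z `<=` interior X) ->
  (forall z z' x, z \in Z -> z' \in Z -> Q z x -> Q z' x -> z = z') ->
  exists2 c0, 0 < c0 & forall z z' x y, z \in Z -> z' \in Z -> z != z' -> Q z x -> Q z' y ->
    v (2^-1 *: x + 2^-1 *: y) + c0 <= (v x + v y) / 2.
Proof.
move=> cX C2 hQ dQ.
pose ZZ := [seq (z, z') | z <- Z, z' <- Z].
have hz (t : T * T) : t \in ZZ -> exists c0, 0 < c0 /\ (t.1 != t.2 -> forall x y, Q t.1 x -> Q t.2 y ->
    v (2^-1 *: x + 2^-1 *: y) + c0 <= (v x + v y) / 2).
  move=> /allpairsP[[z z'] /= [zZ zZ' ->]] /=.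
  have [->|zz] := eqVneq z z'; first by exists 1.
  have [c1 I1] := hQ _ zZ; have [c2 I2] := hQ _ zZ'.
  have dd x : Q z x -> ~ Q z' x by move=> q1 q2; move/eqP: zz; apply; exact: dQ q1 q2.
  by have [c0 c00 hc] := midpoint_gap cX C2 c1 c2 I1 I2 dd; exists c0.
have [f hf] := seq_choice 0 hz.
have [c0 c00 hc] : exists2 h, 0 < h & forall x, x \in ZZ -> h <= f x.
  by apply: seq_pos_lower => t /hf[].
exists c0 => // z z' x y zZ zZ' zz qx qy.
have tZ : (z, z') \in ZZ by apply/allpairsP; exists (z, z').
have [_ /(_ zz _ _ qx qy)] := hf _ tZ; apply: le_trans.
by rewrite lerD2l; exact: hc.
Qed.

(** [s] minimises the gap between [v] and the affine function on the closed cube. It may lie on the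
    boundary of the cube, so optimality is only an inequality between derivatives in directions
    pointing into the cube; together with Taylor's formula at [s] and the nonnegative gap there, it
    suffices. *)
Lemma affine_support (p e : R) n (X : set 'rV[R]_n) (v : 'rV[R]_n -> R) (omega : 'rV[R]_n * R -> R)
   (c : 'rV[R]_n) (h : R) (z : 'rV[R]_n) (ab : 'rV[R]_n * R) : 0 < h -> C2plus_on (interior X) v ->
  good_cube p e X v omega c h z -> (forall x, X x -> affine_fun ab x <= v x) ->
  exists2 s, unit_cubec s & forall u, unit_cubec u ->
    (1 - e) / 2 * h ^+ 2 * qform (hessian v c) (u - s) <= v (h *: (z + u)) - affine_fun ab (h *: (z + u)).
Proof.
move=> h0 C2 good lev.
have cv x : interior X x -> {for x, continuous v} by case: C2 => c' _ _ _ _ Ix; apply: c'; exact: mem_set.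
have ne : box h z !=set0.
  by exists (h *: (z + 0)); exists 0 => // i; rewrite mxE; apply/andP; split; lra.
have cF : {within box h z, continuous (fun x => affine_fun ab x - v x)}.
  apply: continuous_in_subspaceT => x /set_mem[u Cu <-].
  by apply: continuous_at_sub; [exact: continuous_affine|apply: cv; have [] := good _ Cu].
have [x /set_mem[s Cs <-] hmax] := compact_EVT_max ne (compact_box (z := z) h0) cF.
exists s => // u Cu; have [Is _] := good _ Cs.
have /andP[ht _] := good_cube_taylor C2 good Cu Cs.
have Xs := interior_subset Is.
pose d := h *: (z + u) - h *: (z + s).
have Ed : d = h *: (u - s) by rewrite /d -scalerBr opprD addrACA subrr add0r.
have aff t : affine_fun ab (h *: (z + s) + t *: d) = affine_fun ab (h *: (z + s)) + t * dot d ab.1.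
  by rewrite !affine_funE dotDl [dot (t *: d) _]dotZl addrAC.
have [dv Dv] := C2_derive (@open_interior _ X) C2 d Is.
have opt : dot d ab.1 <= dot d (grad v (h *: (z + s))).
  rewrite -Dv; apply: (derive_ge_quot ltr01 dv) => t /andP[t0 t1].
  have t01 : 0 <= t <= 1 by rewrite !ltW.
  have Et : h *: (z + s) + t *: d = h *: (z + (s + t *: (u - s))).
    by rewrite Ed [t *: (h *: _)]scalerA [t * h]mulrC -scalerA -scalerDr addrA.
  have /hmax : h *: (z + s) + t *: d \in box h z.
    by rewrite inE Et; exists (s + t *: (u - s)) => //; exact: unit_cubec_comb.
  rewrite aff; move: (affine_fun _ _) (v _) (v (h *: (z + s))) (dot _ _) => A V1 V2 D; lra.
have Eu : h *: (z + u) = h *: (z + s) + 1 *: d by rewrite scale1r /d [RHS]addrC subrK.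
have Au : affine_fun ab (h *: (z + u)) = affine_fun ab (h *: (z + s)) + dot d ab.1.
  by rewrite {1}Eu aff mul1r.
have := lev _ Xs; rewrite Au; move: ht opt; rewrite -/d.
move: (dot d ab.1) (dot d _) (affine_fun _ _) (v _) (v (h *: (z + s))) (qform _ _) => *; lra.
Qed.

(** A fixed finite set of points that will stand in for all affine pieces staying away from [v] on a
    cube. *)
Lemma quad_net n (H : 'M[R]_n) (d : R) : 0 < d -> exists2 N : seq 'rV[R]_n, N != [::] &
  forall u, unit_cubec u -> exists2 s, s \in N & qform H (u - s) <= d.
Proof.
move=> d0; pose M := \sum_j \sum_i `|H i j|.
have M0 : 0 <= M by apply: sumr_ge0 => j _; apply: sumr_ge0 => i _.
(* [t <= 1] gives [t^2 <= t], hence [M t^2 <= t (M + 1) <= d]. *)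
pose t := Num.min 1 (d / (M + 1)).
have M1 : 0 < M + 1 by lra.
have t0 : 0 < t by rewrite lt_min ltr01 divr_gt0.
have Mt : M * t ^+ 2 <= d.
  have t1 : t <= 1 by rewrite ge_min lexx.
  have : t * (M + 1) <= d by rewrite -ler_pdivlMr// ge_min lexx orbT.
  by move: t t0 t1 => t t0 t1; nra.
have [G [_ _ cov]] := @grid R n t^-1.
have key u : unit_cubec u -> exists2 s, s \in [seq t *: g | g <- G] & qform H (u - s) <= d.
  move=> Cu; have : `|t^-1 *: u| <= t^-1.
    rewrite normrZ gtr0_norm ?invr_gt0// ler_piMr ?invr_ge0 ?(ltW t0)//.
    apply/row_norm_le => // i; have /andP[u0 u1] := Cu i; by rewrite ger0_norm.
  move=> /cov[g gG ug]; exists (t *: g); first exact: map_f.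
  have -> : u - t *: g = t *: (t^-1 *: u - g) by rewrite scalerBr scalerA mulfV ?gt_eqF// scale1r.
  rewrite qformZ; apply: le_trans Mt; rewrite mulrC ler_wpM2r ?sqr_ge0//.
  apply: (le_trans (qform_le _ _)); rewrite -/M ler_piMr//.
  apply: exprn_ile1 => //; apply/row_norm_le => // i.
  by have /andP[u0 u1] := ug i; rewrite ger0_norm// ltW.
exists [seq t *: g | g <- G] => //.
have [|s sG _] := key 0; first by move=> i; rewrite mxE; apply/andP; split; lra.
by case: (map _ _) sG.
Qed.

(** Double counting: every index passes the filter of at most one [z]. *)
Lemma sum_filter_disjoint (T : eqType) (J : Type) (Z : seq T) (I : seq J) (A : T -> pred J) : uniq Z ->
  (forall j z z', z \in Z -> z' \in Z -> A z j -> A z' j -> z = z') ->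
  (\sum_(z <- Z) size [seq j <- I | A z j] <= size I)%N.
Proof.
move=> uZ dA.
have -> : (\sum_(z <- Z) size [seq j <- I | A z j] = \sum_(j <- I) count (fun z => A z j) Z)%N.
  under eq_bigr => z _ do rewrite size_filter -sum1_count big_mkcond.
  by rewrite exchange_big /=; apply: eq_bigr => j _; rewrite -sum1_count [RHS]big_mkcond.
have -> : size I = (\sum_(j <- I) 1)%N by rewrite sum1_size.
apply: leq_sum => j _; rewrite -size_filter.
have := filter_uniq (fun z => A z j) uZ.
have : forall z z', z \in [seq z <- Z | A z j] -> z' \in [seq z <- Z | A z j] -> z = z'.
  by move=> z z'; rewrite !mem_filter => /andP[a1 zZ] /andP[a2 zZ']; exact: dA a1 a2.
case: [seq _ <- _ | _] => [|z [|z' r]]//= /(_ z z'); rewrite !inE !eqxx orbT => /(_ erefl erefl) ->.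
by rewrite eqxx.
Qed.

(** Here [k] is whatever the minorant spends on the cube; the bound keeps the shape
    [az^(1 + al) k^(- al)] summed by [holder_sum]. *)
Lemma cell_error_lower (p h det w e az k qe D : R) n : 0 < p -> (0 < n)%N -> 0 < h ->
  0 < det -> 0 < w -> e < 1 -> 0 < k ->
  az = h ^+ n * (det `^ (p / (n%:R + 2 * p)) * w `^ (n%:R / (n%:R + 2 * p))) ->
  det `^ (p / n%:R) * D <= k `^ (2 * p / n%:R) * qe ->
  (1 - e) `^ (1 + p) * 2 `^ (- p) * D * (az `^ (1 + 2 * p / n%:R) * k `^ (- (2 * p / n%:R))) <=
  h ^+ n * (((1 - e) / 2 * h ^+ 2) `^ p * ((1 - e) * w)) * qe.
Proof.
move=> p0 n0 h0 d0 w0 e1 k0 Eaz hq.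
have e10 : 0 < 1 - e by lra.
rewrite Eaz (cell_weight p0 n0 h0 d0 w0) (weight_pow p w e10 h0) [k `^ (- _)]powRN.
have k1 : 0 < k `^ (2 * p / n%:R) by exact: powR_gt0.
have T0 : 0 <= (1 - e) `^ (1 + p) * 2 `^ (- p) * (h ^+ n * h `^ (2 * p) * w).
  by rewrite !mulr_ge0 ?powR_ge0 ?exprn_ge0 ?(ltW h0) ?(ltW w0).
have hq' : det `^ (p / n%:R) * D / k `^ (2 * p / n%:R) <= qe by rewrite ler_pdivrMr// [leRHS]mulrC.
have := ler_wpM2l T0 hq'.
move: ((1 - e) `^ _) (2 `^ _) (h ^+ n) (h `^ _) (det `^ _) (k `^ _)^-1 => *; lra.
Qed.

(** A minorant is turned into one quantizer per cube, made of the support points of its active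
    pieces and a fixed net. The sizes add up to at most [m + N0], and the infimum defining [quantc]
    bounds the error of each quantizer from below. *)
Lemma lower_cells (p e h : R) n (X : set 'rV[R]_n) (v : 'rV[R]_n -> R) (omega : 'rV[R]_n * R -> R)
    (Z : seq 'rV[R]_n) (c : 'rV[R]_n -> 'rV[R]_n) :
  0 < p -> (0 < n)%N -> compact X -> [lipschitz v x | x in X] ->
  convex_set (X : set (convex_lmodType 'rV[R]_n)) -> C2plus_on (interior X) v ->
  continuous omega -> (forall z, 0 < omega z) -> 0 < e < 1 -> 0 < h -> uniq Z ->
  (forall z, z \in Z -> interior X (c z)) -> (forall z, z \in Z -> good_cube p e X v omega (c z) h z) ->
  (forall z z' x, z \in Z -> z' \in Z -> box h z x -> box h z' x -> z = z') ->
  exists N0 : nat, forall m l, Pc m X v l ->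
   (((1 - e) `^ (1 + p) * 2 `^ (- p) * quantc p (1%:M : 'M[R]_n) *
     ((\sum_(z <- Z) h ^+ n * density p v omega (c z)) `^ (1 + 2 * p / n%:R) * (m + N0)%:R `^ (- (2 * p / n%:R))))%:E
    <= \int[leb n]_x penalty p X v omega l x)%E.
Proof.
move=> p0 n0 coX lX cX C2 cw w0 /andP[e0 e1] h0 uZ Ic gc dB.
have nR : 0 < n%:R :> R by rewrite ltr0n.
have al0 : 0 < 2 * p / n%:R by rewrite divr_gt0// mulr_gt0.
have e10 : 0 < 1 - e by lra.
have [c0 c00 hc0] : exists2 c0, 0 < c0 & forall z z' x y, z \in Z -> z' \in Z -> z != z' -> box h z x -> box h z' y ->
    v (2^-1 *: x + 2^-1 *: y) + c0 <= (v x + v y) / 2.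
  apply: (midpoint_gap_seq cX C2) => // z zZ; split; first exact: compact_box.
  by move=> _ [u Cu <-]; have [] := gc _ zZ _ Cu.
pose C := (1 - e) / 2 * h ^+ 2.
have C0 : 0 < C by rewrite mulr_gt0 ?exprn_gt0// divr_gt0.
have d0 : 0 < c0 / C by rewrite divr_gt0.
have hN' z : z \in Z -> exists N : seq 'rV[R]_n, N != [::] /\
   forall u, unit_cubec u -> exists2 s, s \in N & qform (hessian v (c z)) (u - s) <= c0 / C.
  by move=> _; have [N N0 hN] := quad_net (hessian v (c z)) d0; exists N.
have [N hN] := seq_choice [::] hN'.
(* [N0] counts the net points; it depends neither on [m] nor on [l], so it disappears in the
   limit. *)
exists (\sum_(z <- Z) size (N z))%N => m l Pl.
have w0' x : (0 <= penalty p X v omega l x)%E by exact: penalty_ge0.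
have [Z0|Z0] := eqVneq Z [::].
  rewrite Z0 big_nil powR0; last by rewrite gt_eqF//; lra.
  by rewrite mul0r mulr0; exact: integral_ge0.
have [k [F [km El lv]]] := Pl.
have mpen := measurable_penalty p coX lX cw (Pc_continuous Pl).
have Fv j x : X x -> affine_fun (F j) x <= v x.
  by move=> Xx; apply: le_trans (lv _ Xx); rewrite El; exact: max_affine_ge.
(* A piece is active on a cube if it comes within [c0] of [v] somewhere on the closed cube; by the
   midpoint gap it is active on at most one. *)
pose act z j := `[< exists2 u, unit_cubec u & v (h *: (z + u)) - affine_fun (F j) (h *: (z + u)) < c0 >].
have actd j z z' : z \in Z -> z' \in Z -> act z j -> act z' j -> z = z'.
  move=> zZ zZ' /asboolP[u Cu hu] /asboolP[u' Cu' hu']; apply: contrapT => /eqP zz.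
  have := hc0 z z' (h *: (z + u)) (h *: (z' + u')) zZ zZ' zz.
  have b1 : box h z (h *: (z + u)) by exists u.
  have b2 : box h z' (h *: (z' + u')) by exists u'.
  move=> /(_ b1 b2).
  have [I1 _] := gc _ zZ _ Cu; have [I2 _] := gc _ zZ' _ Cu'.
  have h2 : 0 <= (2^-1 : R) <= 1 by apply/andP; split; lra.
  have := convex_setE cX (interior_subset I1) (interior_subset I2) h2.
  rewrite (_ : 1 - 2^-1 = 2^-1 :> R); last by lra.
  move=> /(Fv j); move: hu hu'.
  rewrite !affine_funE dotDl ![dot (2^-1 *: _) _]dotZl.
  move: (dot _ _) (dot (h *: (z' + u')) _) (v _) (v (h *: (z' + u'))) (v (_ + _)) (F j).2 => *; lra.
have hs' z : z \in Z -> exists s : 'I_k.+1 -> 'rV[R]_n, forall j,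
   unit_cubec (s j) /\ forall u, unit_cubec u ->
    C * qform (hessian v (c z)) (u - s j) <= v (h *: (z + u)) - affine_fun (F j) (h *: (z + u)).
  move=> zZ; have [f hf] := @choice _ _ (fun j y => unit_cubec y /\ forall u, unit_cubec u ->
     C * qform (hessian v (c z)) (u - y) <= v (h *: (z + u)) - affine_fun (F j) (h *: (z + u)))
     (fun j => let: ex_intro2 y a b := affine_support h0 C2 (gc z zZ) (Fv j) in ex_intro _ y (conj a b)).
  by exists f.
have [s hs] := seq_choice (fun=> 0) hs'.
(* On this cube an inactive piece leaves an error of at least [c0], while the net keeps [C * qmin]
   below [c0]; so the net replaces all inactive pieces. *)
pose S z := [seq s z j | j <- [seq j <- enum 'I_k.+1 | act z j]] ++ N z.
have S0 z : z \in Z -> S z != [::].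
  by move=> /hN[Nz _]; rewrite /S; case: (map _ _) => //.
have low z u : z \in Z -> unit_cubec u ->
    C * qmin (hessian v (c z)) (S z) u <= v (h *: (z + u)) - l (h *: (z + u)).
  move=> zZ Cu; rewrite El; have [j ->] := max_affine_ex F (h *: (z + u)).
  have [aj|naj] := boolP (act z j).
    have [_ /(_ u Cu)] := hs z zZ j; apply: le_trans.
    rewrite ler_pM2l//; apply: qmin_le; rewrite mem_cat; apply/orP; left.
    by apply: map_f; rewrite mem_filter aj mem_enum.
  have [_ /(_ u Cu)[y yN hy]] := hN z zZ.
  have h1 : c0 <= v (h *: (z + u)) - affine_fun (F j) (h *: (z + u)).
    by rewrite leNgt; apply/negP => hlt; move/asboolP: naj; apply; exists u.
  apply: le_trans h1; rewrite mulrC -ler_pdivlMr//; apply: le_trans hy.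
  by apply: qmin_le; rewrite mem_cat yN orbT.
have sS : (\sum_(z <- Z) size (S z) <= m + \sum_(z <- Z) size (N z))%N.
  under eq_bigr => z _ do rewrite size_cat size_map.
  rewrite big_split leq_add2r; apply: leq_trans km.
  have := sum_filter_disjoint (enum 'I_k.+1) uZ actd.
  by rewrite size_enum_ord.
pose wz z := omega (c z, v (c z)).
pose az z := h ^+ n * density p v omega (c z).
have az0 z : z \in Z -> 0 < az z.
  by move=> /Ic Iz; rewrite mulr_gt0 ?exprn_gt0// (density_gt0 p0 n0 C2 w0 Iz).
have k0 z : z \in Z -> 0 < (size (S z))%:R :> R.
  by move=> /S0; rewrite ltr0n; case: (S z).
pose T := (1 - e) `^ (1 + p) * 2 `^ (- p) * quantc p (1%:M : 'M[R]_n).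
have T0 : 0 <= T by rewrite !mulr_ge0 ?powR_ge0 ?quantc_ge0.
have hsum := holder_sum al0 (fun z zZ => conj (az0 z zZ) (k0 z zZ)) Z0.
have kpos : 0 < \sum_(z <- Z) (size (S z))%:R :> R.
  case: (Z) Z0 k0 => // z r _ kz; rewrite big_cons ltr_wpDr//; first exact: sumr_ge0.
  by apply: kz; rewrite inE eqxx.
have kle : (m + \sum_(z <- Z) size (N z))%:R `^ (- (2 * p / n%:R)) <=
    (\sum_(z <- Z) (size (S z))%:R) `^ (- (2 * p / n%:R)) :> R.
  rewrite !powRN lef_pV2 ?posrE ?powR_gt0//; last first.
    by apply: lt_le_trans kpos _; rewrite -natr_sum ler_nat.
  apply: ge0_ler_powR; rewrite ?nnegrE ?(ltW al0) ?(ltW kpos)//.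
  by rewrite -natr_sum ler_nat.
apply: (@le_trans _ _ (T * \sum_(z <- Z) (az z `^ (1 + 2 * p / n%:R) * (size (S z))%:R `^ (- (2 * p / n%:R))))%:E).
  rewrite lee_fin -/T; apply: ler_wpM2l => //; apply: le_trans hsum.
  by apply: ler_wpM2l => //; exact: powR_ge0.
apply: le_trans (sum_integral_disjoint (B := fun z => cell (h *: z) h) (D := setT) uZ _ _ _ _ mpen w0') => //; first last.
- move=> z z' x zZ zZ' c1 c2; apply: (dB z z' x) => //.
    by exists (h^-1 *: (x - h *: z)); [exact: unit_cube_sub|rewrite cell_point].
  by exists (h^-1 *: (x - h *: z')); [exact: unit_cube_sub|rewrite cell_point].
- by move=> z; exact: measurable_cell.
rewrite mulr_sumr -sumEFin big_seq [leRHS]big_seq; apply: lee_sum => z zZ.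
have Iz := Ic _ zZ.
have [dt0 Eq] := hessian_quantc p0 n0 C2 Iz.
have w10 : 0 <= (1 - e) * wz z by rewrite mulr_ge0 ?(ltW (w0 _)) ?(ltW e10).
apply: (@le_trans _ _ (\int[leb n]_(x in cell (h *: z) h)
   ((C * qmin (hessian v (c z)) (S z) (h^-1 *: (x - h *: z))) `^ p * ((1 - e) * wz z))%:E)%E).
  rewrite integral_cell_qmin//; [|exact: ltW C0|exact: S0|exact: hessian_psd C2 Iz].
  rewrite lee_fin; apply: (@cell_error_lower p h (\det (hessian v (c z))) (wz z) e (az z)) => //; [exact: w0|exact: k0|].
  by have := quantc_le p (hessian v (c z)) (S0 z zZ); apply: le_trans; rewrite le_eqVlt; apply/orP; left; apply/eqP; exact: esym Eq.
apply: ge0_le_integral => //.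
- exact: measurable_cell.
- by move=> x _; rewrite lee_fin mulr_ge0 ?powR_ge0.
- by apply: measurable_funTS; exact: measurable_cell_qmin.
- exact: measurable_funTS.
move=> x cx; have Cu := unit_cube_sub cx.
have := low z _ zZ Cu; rewrite cell_point// => hl.
have [Ix] := gc z zZ _ Cu; rewrite cell_point// in Ix * => -[_ /andP[hw _] _].
rewrite /penalty mem_set; last exact: interior_subset.
have q0 : 0 <= C * qmin (hessian v (c z)) (S z) (h^-1 *: (x - h *: z)).
  by apply: mulr_ge0; [exact: ltW|apply: qmin_ge0; exact: hessian_psd C2 Iz].
rewrite lee_fin; apply: ler_pM => //; first exact: powR_ge0.
by apply: ge0_ler_powR; rewrite ?nnegrE ?(ltW p0)//; exact: le_trans hl.
Qed.

(** The cubes of the grid are disjoint only as half-open cubes. Closed cubes with the same corner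
    and side [(1 - e) h] are contained in them, hence disjoint, at the cost of a factor [(1 - e)^n]
    in the masses. *)
Lemma lower_core (p e : R) n (X K : set 'rV[R]_n) (v : 'rV[R]_n -> R) (omega : 'rV[R]_n * R -> R) :
  0 < p -> (0 < n)%N -> compact X -> [lipschitz v x | x in X] ->
  convex_set (X : set (convex_lmodType 'rV[R]_n)) -> C2plus_on (interior X) v ->
  continuous omega -> (forall z, 0 < omega z) -> compact K -> K `<=` interior X -> 0 < e < 1 ->
  exists a, [/\ 0 <= a, (\int[leb n]_(x in K) (density p v omega x)%:E <= ((1 + e) * a)%:E)%E &
  exists N0 : nat, forall m l, Pc m X v l ->
   (((1 - e) `^ (1 + p) * 2 `^ (- p) * quantc p (1%:M : 'M[R]_n) *
     (((1 - e) ^+ n * a) `^ (1 + 2 * p / n%:R) * (m + N0)%:R `^ (- (2 * p / n%:R))))%:E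
    <= \int[leb n]_x penalty p X v omega l x)%E].
Proof.
move=> p0 n0 coX lX cX C2 cw w0 coK KI e01; have /andP[e0 e1] := e01.
have [h [Z [c [h0 uZ dZ cov gZ]]]] := good_grid p0 n0 coK KI C2 cw w0 e01.
have gc z : z \in Z -> good_cube p e X v omega (c z) h z by move=> /gZ[].
have e10 : 0 < 1 - e by lra.
have En : 1 - e != 0 by rewrite gt_eqF.
exists (\sum_(z <- Z) h ^+ n * density p v omega (c z)); split.
- by apply: sumr_ge0 => z _; rewrite mulr_ge0 ?exprn_ge0 ?(ltW h0) ?density_ge0.
- exact: grid_integral_le C2 cw (ltW e0) h0 coK KI cov gc.
have sub u : unit_cubec u -> unit_cubec ((1 - e) *: u).
  move=> Cu i; have /andP[u0 u1] := Cu i; rewrite mxE mulr_ge0 ?(ltW e10)//=.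
  by move: (u ord0 i) u0 u1 => q q0 q1; nra.
have sub' u : unit_cubec u -> unit_cube ((1 - e) *: u).
  move=> Cu i; have /andP[u0 u1] := Cu i; rewrite mxE mulr_ge0 ?(ltW e10)//=.
  by move: (u ord0 i) u0 u1 => q q0 q1; nra.
(* The shrunken cubes are those of mesh [(1 - e) h] indexed by [(1 - e)^-1 *: z]. *)
have pt z u : ((1 - e) * h) *: ((1 - e)^-1 *: z + u) = h *: (z + (1 - e) *: u).
  by rewrite -[(1 - e) * h]mulrC -scalerA scalerDr scalerA mulfV// scale1r.
have inj : injective (fun z : 'rV[R]_n => (1 - e)^-1 *: z).
  by move=> x y /= /(congr1 (fun t => (1 - e) *: t)); rewrite !scalerA mulfV// !scale1r.
have h'0 : 0 < (1 - e) * h by rewrite mulr_gt0.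
have [] := @lower_cells p e ((1 - e) * h) n X v omega [seq (1 - e)^-1 *: z | z <- Z]
    (fun z => c ((1 - e) *: z)) p0 n0 coX lX cX C2 cw w0 e01 h'0.
- by rewrite map_inj_uniq.
- by move=> _ /mapP[z zZ ->]; rewrite scalerA mulfV// scale1r; have [] := gZ z zZ.
- move=> _ /mapP[z zZ ->] u Cu; rewrite scalerA mulfV// scale1r pt.
  by apply: (gc z zZ); exact: sub.
- move=> _ _ x /mapP[z zZ ->] /mapP[z' zZ' ->] [u Cu <-] [u' Cu']; rewrite !pt => E.
  have {}E : z' + (1 - e) *: u' = z + (1 - e) *: u.
    by move/(congr1 (fun t => h^-1 *: t)): E; rewrite !scalerA mulVf ?gt_eqF// !scale1r.
  congr (_ *: _); apply: (dZ z z' (z + (1 - e) *: u)) => //.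
    by rewrite addrAC subrr add0r; exact: sub'.
  by rewrite -E addrAC subrr add0r; exact: sub'.
move=> N0 hN; exists N0 => m l /hN.
have -> : \sum_(z <- [seq (1 - e)^-1 *: z | z <- Z]) ((1 - e) * h) ^+ n * density p v omega (c ((1 - e) *: z)) =
   (1 - e) ^+ n * \sum_(z <- Z) h ^+ n * density p v omega (c z).
  rewrite big_map mulr_sumr; apply: eq_bigr => z _.
  rewrite (_ : (1 - e) *: ((1 - e)^-1 *: z) = z); last by rewrite scalerA mulfV// scale1r.
  by rewrite exprMn -mulrA.
by [].
Qed.

End LowerBound.

(** * Passage to the limit *)

Section Asymptotics.
Context {R : realType}.
Notation borel := (borel R).

(** The limit may be infinite; then the upper condition is vacuous and the lower one alone gives
    divergence. *)
Lemma cvge_squeeze (u : nat -> \bar R) (L : \bar R) : (0 <= L)%E ->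
  (forall c : R, (L < c%:E)%E -> exists m0 : nat, forall m, (m0 <= m)%N -> (u m <= c%:E)%E) ->
  (forall c : R, (c%:E < L)%E -> exists m0 : nat, forall m, (m0 <= m)%N -> (c%:E <= u m)%E) ->
  u @ \oo --> L.
Proof.
case: L => [r||] // _ up lo; last first.
  apply/cvgeyPge => A; have [m0 hm] := lo A (ltry A).
  by exists m0 => // m; exact: hm.
have near_r e : 0 < e -> \forall m \near \oo, ((r - e)%:E <= u m <= (r + e)%:E)%E.
  move=> e0; have [m1 h1] : exists m0 : nat, forall m, (m0 <= m)%N -> (u m <= (r + e)%:E)%E.
    by apply: up; rewrite lte_fin; lra.
  have [m2 h2] : exists m0 : nat, forall m, (m0 <= m)%N -> ((r - e)%:E <= u m)%E.
    by apply: lo; rewrite lte_fin; lra.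
  exists (m1 + m2)%N => // m /= hm.
  by apply/andP; split; [apply: h2; exact: leq_trans (leq_addl _ _) hm|apply: h1; exact: leq_trans (leq_addr _ _) hm].
have fin m e : ((r - e)%:E <= u m <= (r + e)%:E)%E -> u m \is a fin_num.
  by move=> /andP[a b]; apply: fin_real; rewrite (lt_le_trans (ltNyr _) a) (le_lt_trans b (ltry _)).
apply/fine_cvgP; split.
  by apply: filterS (near_r 1 ltr01) => m; exact: fin.
apply/cvgrPdist_le => e e0; apply: filterS (near_r e e0) => m hm /=.
have := hm; rewrite -(fineK (fin _ _ hm)) !lee_fin => /andP[a b].
by rewrite ler_norml; apply/andP; split; lra.
Qed.

(** Monotone convergence along homothetic copies of ratio [1 - 1 / (k + 2)], which lies strictly
    between [0] and [1] from [k = 0] on. The integral over the interior may be infinite, so it is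
    approached through a strict lower bound. *)
Lemma interior_exhaust n (X : set 'rV[R]_n) (f : borel n -> \bar R) x0 (i : R) : compact X ->
  convex_set (X : set (convex_lmodType 'rV[R]_n)) -> interior X x0 ->
  measurable_fun (interior X : set (borel n)) f -> (forall x, 0 <= f x)%E ->
  (i%:E < \int[leb n]_(x in interior X) f x)%E ->
  exists K, [/\ compact K, K `<=` interior X & (i%:E < \int[leb n]_(x in K) f x)%E].
Proof.
move=> coX cX Ix0 mf f0 hi.
have Xx0 : X x0 by exact: interior_subset.
pose r (k : nat) : R := 1 - k.+2%:R^-1.
have r01 k : 0 < r k < 1.
  have h1 : (k.+2%:R : R)^-1 <= 2^-1 by rewrite lef_pV2 ?posrE// ler_nat.
  have h2 : 0 < (k.+2%:R : R)^-1 by rewrite invr_gt0.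
  by rewrite /r; move: (_^-1) h1 h2 => q *; apply/andP; split; lra.
have rmono k k' : (k <= k')%N -> r k <= r k'.
  by move=> kk; rewrite lerD2l lerN2 lef_pV2 ?posrE// ler_nat !ltnS.
have KI k : shrink X x0 (r k) `<=` interior X by exact: shrink_interior.
have cK k : closed (shrink X x0 (r k)).
  have /andP[r0 _] := r01 k.
  by apply: closed_shrink => //; apply: compact_closed => //; exact: row_hausdorff.
have coK k : compact (shrink X x0 (r k)).
  by apply: (subclosed_compact (cK k) coX) => x /KI/interior_subset.
have UK : \bigcup_k shrink X x0 (r k) = interior X.
  apply/seteqP; split => [x [k _ /KI]//|x /(shrink_exhaust x0)[s /andP[s0 s1] sx]].
  have s1' : 0 < 1 - s by lra.
  have [k hk] := eventually_ge 1 s1'.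
  exists k => //; apply: (shrink_mono cX Xx0 s0) sx.
  have h1 : 1 <= k%:R * (1 - s) by exact: hk.
  have h2 : (k%:R : R) <= k.+2%:R by rewrite ler_nat ltnW.
  rewrite /r lerBrDr -lerBrDl -[leLHS]div1r ler_pdivrMr// mulrC.
  by apply: (le_trans h1); rewrite ler_pM2r.
apply: contrapT => nK.
have lek k : (\int[leb n]_(x in shrink X x0 (r k)) f x <= i%:E)%E.
  by rewrite leNgt; apply/negP => hlt; apply: nK; exists (shrink X x0 (r k)).
have cv := @ge0_nondecreasing_set_cvg_integral _ (borel n) R (fun k => shrink X x0 (r k)) f (leb n).
have {}cv : (\int[leb n]_(x in shrink X x0 (r k)) f x)%E @[k --> \oo] --> (\int[leb n]_(x in interior X) f x)%E.
  rewrite -UK; apply: cv.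
  - move=> k k' /rmono kk; apply/subsetPset; have /andP[r0 _] := r01 k.
    exact: (shrink_mono cX Xx0 r0 kk).
  - by move=> k; exact: closed_borel.
  - by move=> k; apply: measurable_funS mf => //; apply: open_borel; exact: open_interior.
  - by [].
have : (\int[leb n]_(x in interior X) f x <= i%:E)%E.
  rewrite -(cvg_lim _ cv)//; apply: lime_le; first by apply/cvg_ex; exists (\int[leb n]_(x in interior X) f x)%E.
  by apply: nearW => k; exact: lek.
by rewrite leNgt hi.
Qed.

Lemma triangle_le (p : R) n m (X : set 'rV[R]_n) (v : 'rV[R]_n -> R) (omega : 'rV[R]_n * R -> R) l :
  compact X -> [lipschitz v x | x in X] -> continuous omega -> (forall z, 0 < omega z) ->
  Pc m X v l -> (triangle_p p X v omega m <= \int[leb n]_x penalty p X v omega l x)%E.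
Proof.
move=> coX lX cw w0 Pl.
have mpen := measurable_penalty p coX lX cw (Pc_continuous Pl).
rewrite -(lebintE mpen) => [|x]; last exact: penalty_ge0.
by apply: ereal_inf_lbound; exists l.
Qed.

Lemma triangle_ge (p : R) n m (X : set 'rV[R]_n) (v : 'rV[R]_n -> R) (omega : 'rV[R]_n * R -> R) (c : \bar R) :
  compact X -> [lipschitz v x | x in X] -> continuous omega -> (forall z, 0 < omega z) ->
  (forall l, Pc m X v l -> (c <= \int[leb n]_x penalty p X v omega l x)%E) ->
  (c <= triangle_p p X v omega m)%E.
Proof.
move=> coX lX cw w0 hl; apply/ereal_infP => _ [l [Pl ->]].
have mpen := measurable_penalty p coX lX cw (Pc_continuous Pl).
have := hl l Pl; rewrite -(lebintE mpen)// => x; exact: penalty_ge0.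
Qed.

Lemma lebint_density (p : R) n (X : set 'rV[R]_n) (v : 'rV[R]_n -> R) (omega : 'rV[R]_n * R -> R) :
  C2plus_on (interior X) v -> continuous omega ->
  lebint (fun x => if x \in (interior X : set 'rV[R]_n) then (density p v omega x)%:E else 0%E) =
  (\int[leb n]_(x in interior X) (density p v omega x)%:E)%E.
Proof.
move=> C2 cw.
have mI : measurable (interior X : set (borel n)) by apply: open_borel; exact: open_interior.
have md := measurable_density p (@open_interior _ X) C2 cw.
have -> : (fun x => if x \in (interior X : set 'rV[R]_n) then (density p v omega x)%:E else 0%E) =
    (fun x => (density p v omega x)%:E) \_ (interior X).
  by apply/funext => x; rewrite patchE.
rewrite lebintE.
- by rewrite -integral_mkcond.
- by apply/(measurable_restrictT _ mI).
- by move=> x; rewrite patchE; case: ifP => // _; rewrite lee_fin density_ge0.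
Qed.

Lemma Pc_nonempty n m (X : set 'rV[R]_n) (v : 'rV[R]_n -> R) : (0 < m)%N ->
  compact X -> [lipschitz v x | x in X] -> exists l, Pc m X v l.
Proof.
move=> m0 coX lX; have [T hT] := lipschitz_bounded coX lX.
have [//|//||l Pl _] := @Pc_of_seq R n [:: (0, - T)] m X v; last by exists l.
move=> ab; rewrite inE => /eqP -> x Xx; rewrite affine_funE /= dotE big1 ?add0r.
  by have := hT x Xx; rewrite ler_norml => /andP[].
by move=> i _; rewrite mxE mulr0.
Qed.

Lemma penalty_null (p : R) n (X : set 'rV[R]_n) (v : 'rV[R]_n -> R) (omega : 'rV[R]_n * R -> R) l :
  compact X -> [lipschitz v x | x in X] -> continuous omega -> continuous l ->
  leb n X = 0%E -> (\int[leb n]_x penalty p X v omega l x)%E = 0%E.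
Proof.
move=> coX lX cw cl X0; have mX := compact_borel coX.
have mpen := measurable_penalty p coX lX cw cl.
have -> : (\int[leb n]_x penalty p X v omega l x = \int[leb n]_(x in X) penalty p X v omega l x)%E.
  rewrite [RHS]integral_mkcond; apply: eq_integral => x _.
  by rewrite patchE /penalty; case: ifP.
by apply: null_set_integral => //; exact: measurable_funTS.
Qed.

(** A finite limit [i] excludes [I = +oo] unless [D = 0], and then the left-hand side vanishes. *)
Lemma powR_le_lim (D i a th al p : R) (I : \bar R) : 0 <= D -> 0 < th -> 0 < al -> 0 <= a ->
  (0 <= I)%E -> (a%:E <= th%:E * I)%E ->
  ((D / 2 `^ p)%:E * I `^ (1 + al))%E = i%:E ->
  2 `^ (- p) * D * a `^ (1 + al) <= th `^ (1 + al) * i.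
Proof.
move=> D0 th0 al0 a0 I0 aI Ei.
have al1 : 0 < 1 + al by lra.
have [D00|Dn] := eqVneq D 0.
  have := Ei; rewrite D00 mul0r mul0e => -[<-].
  by rewrite !mulr0 mul0r.
have Dp : 0 < D / 2 `^ p by rewrite divr_gt0 ?powR_gt0// lt_neqAle eq_sym Dn.
case: I I0 aI Ei => [j||]//.
- rewrite lee_fin -EFinM lee_fin poweR_EFin -EFinM => j0 aj [<-].
  have : a `^ (1 + al) <= th `^ (1 + al) * j `^ (1 + al).
    rewrite -powRM ?(ltW th0)//; apply: ge0_ler_powR; rewrite ?nnegrE ?(ltW al1)//.
    by rewrite mulr_ge0 ?(ltW th0).
  move=> /(ler_wpM2l (ltW Dp)); rewrite powRN.
  move: (a `^ _) (th `^ _) (j `^ _) (2 `^ p)^-1 => *; lra.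
- by move=> _ _; rewrite poweRyr ?gt_eqF// gt0_muley ?lte_fin.
Qed.

(** Balance of the losses with [1 - e = th^-1]: [1 + p] from Hessian and weight; in the factor of
    [1 + al], [n] from shrinking the cubes and [1] from the Riemann sum; the last [al] from the [N0]
    additional points. *)
Lemma lower_exponents (th i D al p : R) n : 0 < th -> 0 <= i ->
  th `^ (- (1 + p + n.+1%:R * (1 + al) + al)) * (D / 2 `^ p * i `^ (1 + al)) =
  th^-1 `^ (1 + p) * 2 `^ (- p) * D * ((th `^ (- n.+1%:R) * i) `^ (1 + al) * th `^ (- al)).
Proof.
move=> th0 i0; rewrite powRM ?powR_ge0// -powRrM mulNr powR_invl ?(ltW th0)//.
rewrite 2!opprD [th `^ (_ + _ + _)]powRD; last by rewrite (gt_eqF th0) implybT.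
rewrite [th `^ (- (1 + p) + _)]powRD; last by rewrite (gt_eqF th0) implybT.
rewrite [2 `^ (- p)]powRN; move: (2 `^ p)^-1 => q; ring.
Qed.

Variables (p : R) (n : nat) (X : set 'rV[R]_n) (v : 'rV[R]_n -> R) (omega : 'rV[R]_n * R -> R) (x0 : 'rV[R]_n).
Hypotheses (p0 : 0 < p) (n0 : (0 < n)%N) (coX : compact X) (lX : [lipschitz v x | x in X])
  (cX : convex_set (X : set (convex_lmodType 'rV[R]_n)))
  (cv : convex_function (X : set (convex_lmodType 'rV[R]_n)) v)
  (C2 : C2plus_on (interior X) v) (cw : continuous omega) (w0 : forall z, 0 < omega z)
  (Ix0 : interior X x0).

Let al := 2 * p / n%:R.
Let I := (\int[leb n]_(x in interior X) (density p v omega x)%:E)%E.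
Let L := ((quantc p (1%:M : 'M[R]_n) / 2 `^ p)%:E * I `^ (1 + al))%E.

Lemma triangle_limsup (c : R) : (L < c%:E)%E -> exists m0 : nat, forall m, (m0 <= m)%N ->
  ((m%:R `^ al)%:E * triangle_p p X v omega m <= c%:E)%E.
Proof.
have nR : 0 < n%:R :> R by rewrite ltr0n.
have al0 : 0 < al by rewrite divr_gt0// mulr_gt0.
have I0 : (0 <= I)%E by apply: integral_ge0 => x _; rewrite lee_fin density_ge0.
have D0 := quantc_ge0 p (1%:M : 'M[R]_n).
have [D ED] : exists D, D = quantc p (1%:M : 'M[R]_n) by exists (quantc p (1%:M : 'M[R]_n)).
rewrite /L; rewrite -ED in D0 *.
have L0 : (0 <= (D / 2 `^ p)%:E * I `^ (1 + al))%E.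
  by rewrite mule_ge0 ?poweR_ge0// lee_fin divr_ge0 ?powR_ge0.
case EL : ((D / 2 `^ p)%:E * I `^ (1 + al))%E L0 => [y||]//; rewrite lee_fin lte_fin => y0 yc.
have yc2 : y < (y + c) / 2 by lra.
(* [1 + p + 2 al] is the loss in [upper_core]; [1 + al] comes from bounding [a] by [th] times the
   integral. *)
have E0 : 0 < 1 + p + 2 * al + (1 + al).
  by move: (al) al0 => q; move: p0; lra.
have [th th1 hth] := theta_exists y0 yc2 E0.
have th0 : 0 < th by lra.
(* The distance from [(y + c) / 2] to [c] is split evenly between [eta] and the contribution of
   [ka]. *)
have eta0 : 0 < (c - y) / 4 by lra.
have [a [a0 aI hm]] := upper_core p0 n0 coX lX cX cv C2 cw w0 Ix0 th1 eta0.
pose G := th `^ (1 + p + 2 * al) * 2 `^ (- p) * a `^ (1 + al).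
have G0 : 0 <= G by rewrite !mulr_ge0 ?powR_ge0.
have G1 : 0 < G + 1 by lra.
have ka0 : 0 < (c - y) / 4 / (G + 1) by rewrite divr_gt0.
have [m0 hm0] := hm _ ka0; exists m0 => m /hm0[l Pl hl].
have m0' : (0 <= (m%:R `^ al)%:E)%E by rewrite lee_fin powR_ge0.
apply: (le_trans (lee_wpmul2l m0' (triangle_le p coX lX cw w0 Pl))).
apply: (le_trans hl); rewrite -ED -/al lee_fin.
have h1 := powR_le_lim D0 th0 al0 (ltW a0) I0 aI EL.
have h2 : th `^ (1 + p + 2 * al) * (2 `^ (- p) * D * a `^ (1 + al)) <= th `^ (1 + p + 2 * al) * (th `^ (1 + al) * y).
  by apply: ler_wpM2l h1; exact: powR_ge0.
have h3 : th `^ (1 + p + 2 * al) * (th `^ (1 + al) * y) <= (y + c) / 2.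
  by rewrite mulrA -powRD ?(gt_eqF th0) ?implybT.
have h4 : G * ((c - y) / 4 / (G + 1)) <= (c - y) / 4.
  by rewrite mulrCA ger_pMr// ler_pdivrMr// mul1r; lra.
rewrite /G in h4 *; move: h2 h3 h4; move: (th `^ (1 + p + 2 * al)) (2 `^ (- p)) (a `^ _) ((c - y) / 4 / _) (th `^ (1 + al)).
move=> A B C0 E F h2 h3 h4; lra.
Qed.

Lemma triangle_liminf (c : R) : (c%:E < L)%E -> exists m0 : nat, forall m, (m0 <= m)%N ->
  (c%:E <= (m%:R `^ al)%:E * triangle_p p X v omega m)%E.
Proof.
have nR : 0 < n%:R :> R by rewrite ltr0n.
have al0 : 0 < al by rewrite divr_gt0// mulr_gt0.
have al1 : 0 < 1 + al by lra.
have I0 : (0 <= I)%E by apply: integral_ge0 => x _; rewrite lee_fin density_ge0.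
have D0 := quantc_ge0 p (1%:M : 'M[R]_n).
have [D ED] : exists D, D = quantc p (1%:M : 'M[R]_n) by exists (quantc p (1%:M : 'M[R]_n)).
rewrite /L; rewrite -ED in D0 *.
have m0' (m : nat) : (0 <= (m%:R `^ al)%:E)%E by rewrite lee_fin powR_ge0.
have [c0|c0] := leP c 0.
  move=> _; exists 0%N => m _; apply: (@le_trans _ _ 0%E); first by rewrite lee_fin.
  apply: mule_ge0 => //; apply: triangle_ge => // l _.
  by apply: integral_ge0 => x _; exact: penalty_ge0.
have [D00|Dn] := eqVneq D 0.
  by rewrite D00 mul0r mul0e lte_fin ltNge (ltW c0).
have Dp : 0 < D by rewrite lt_neqAle eq_sym Dn.
have p2 : 0 < 2 `^ p :> R by rewrite powR_gt0.
have Dp2 : 0 < D / 2 `^ p by rewrite divr_gt0.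
move=> hc.
(* [i0] is the value of the integral for which the limit would be exactly [c]; hence [i0 < I], and
   some compact part of the interior already carries more than [i0]. *)
pose i0 := (c / (D / 2 `^ p)) `^ (1 + al)^-1.
have Ei0 : i0 `^ (1 + al) = c / (D / 2 `^ p).
  by rewrite /i0 -powRrM mulVf ?gt_eqF// powRr1// divr_ge0 ?ltW.
have i0I : (i0%:E < I)%E.
  rewrite ltNge; apply/negP => hI; move: hc; rewrite ltNge => /negP; apply.
  move: hI I0; case: (I) => [j||]//; rewrite !lee_fin => ji j0.
  rewrite mulrC -ler_pdivlMr// -Ei0.
  by apply: ge0_ler_powR; rewrite ?nnegrE ?(ltW al1) ?powR_ge0.
have md := measurable_density p (@open_interior _ X) C2 cw.
have d0 x : (0 <= (density p v omega x)%:E)%E by rewrite lee_fin density_ge0.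
have [K [coK KI hK]] := interior_exhaust coX cX Ix0 md d0 i0I.
(* Finiteness of the integral over [K] is read off [lower_core] at [e = 1 / 2]. *)
have [i Ei] : exists i, (\int[leb n]_(x in K) (density p v omega x)%:E)%E = i%:E.
  have h2 : 0 < (2^-1 : R) < 1 by apply/andP; split; lra.
  have [a [_ ha _]] := lower_core p0 n0 coX lX cX C2 cw w0 coK KI h2.
  move: hK ha; case: (\int[leb n]_(x in K) _)%E => [i||]// _ _; by exists i.
rewrite Ei lte_fin in hK.
have i00 : 0 <= i0 by exact: powR_ge0.
have ip : 0 <= i by lra.
pose kap := D / 2 `^ p * i `^ (1 + al).
have ck : c < kap.
  rewrite /kap mulrC -ltr_pdivrMr// -Ei0.
  by apply: gt0_ltr_powR; rewrite ?nnegrE.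
have E0 : 0 < 1 + p + n.+1%:R * (1 + al) + al.
  have := mulr_gt0 (ltr0Sn R n) al1; move: (_ * _) => s.
  by move: (al) al0 => q; move: p0; lra.
have [th th1 hth] := theta_exists (ltW c0) ck E0.
have th0 : 0 < th by lra.
have [e01 Ee eth] := theta_gap th1.
have [a [a0 ha [N0 hN]]] := lower_core p0 n0 coX lX cX C2 cw w0 coK KI e01.
rewrite Ei lee_fin in ha.
have ai : i / th <= a.
  rewrite ler_pdivrMr//; apply: (le_trans ha); rewrite mulrC.
  by apply: ler_wpM2l.
have th10 : 0 < th - 1 by lra.
(* [N0 <= m (th - 1)] amounts to [m + N0 <= th m]. *)
have [m1 hm1] := eventually_ge N0%:R th10.
exists m1.+1 => m hm.
have mp : 0 < m%:R :> R by rewrite ltr0n (leq_trans _ hm).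
have mN : 0 < (m + N0)%:R :> R by rewrite ltr0n (leq_trans _ (leq_addr _ _))// -(ltr0n R).
have hmN : (m + N0)%:R <= th * m%:R :> R.
  by rewrite natrD; have := hm1 m (ltnW hm); lra.
have hpow : th `^ (- al) <= m%:R `^ al * (m + N0)%:R `^ (- al).
  rewrite !powRN ler_pdivlMr ?powR_gt0// mulrC ler_pdivrMr ?powR_gt0// mulrC -powRM ?(ltW th0)//.
  by apply: ge0_ler_powR; rewrite ?nnegrE ?(ltW al0) ?(ltW mN)// mulr_ge0 ?(ltW th0).
have thV0 : 0 < th^-1 by rewrite invr_gt0.
have hbase : (th `^ (- n.+1%:R) * i) `^ (1 + al) <= (th^-1 ^+ n * a) `^ (1 + al).
  apply: ge0_ler_powR; rewrite ?nnegrE ?(ltW al1) ?mulr_ge0 ?powR_ge0 ?exprn_ge0 ?(ltW thV0)//.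
  rewrite powRN powR_mulrn ?(ltW th0)// -exprVn exprSr -mulrA ler_wpM2l ?exprn_ge0 ?(ltW thV0)//.
  by rewrite mulrC.
pose b := th^-1 `^ (1 + p) * 2 `^ (- p) * D * ((th^-1 ^+ n * a) `^ (1 + al) * (m + N0)%:R `^ (- al)).
apply: (@le_trans _ _ ((m%:R `^ al)%:E * b%:E)%E); last first.
  apply: lee_wpmul2l => //; apply: triangle_ge => // l /hN.
  by rewrite Ee -ED.
rewrite -EFinM lee_fin /b.
have T0 : 0 <= th^-1 `^ (1 + p) * 2 `^ (- p) * D by rewrite !mulr_ge0 ?powR_ge0.
have step : (th `^ (- n.+1%:R) * i) `^ (1 + al) * th `^ (- al) <=
    (th^-1 ^+ n * a) `^ (1 + al) * (m%:R `^ al * (m + N0)%:R `^ (- al)).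
  by apply: ler_pM; rewrite ?powR_ge0.
have cth : c <= th `^ (- (1 + p + n.+1%:R * (1 + al) + al)) * kap.
  by rewrite powRN mulrC ler_pdivlMr ?powR_gt0// mulrC.
apply: (le_trans cth).
rewrite /kap (lower_exponents D al p n th0 ip).
have := ler_wpM2l T0 step.
move: (_ * D) (_ `^ (1 + al)) (_ `^ (1 + al)) (m%:R `^ al) (_ `^ (- al)) (_ `^ (- al)) => *; lra.
Qed.

End Asymptotics.

Unset Implicit Arguments.

Theorem theorem3 (R : realType) (n : nat) (p : R) :
  (1 <= n)%N -> 0 < p ->
  exists delta : R,
  forall (X : set 'rV[R]_n) (v : 'rV[R]_n -> R) (omega : 'rV[R]_n * R -> R),
    compact X ->
    [lipschitz v x | x in X] ->
    convex_set (X : set (convex_lmodType 'rV[R]_n)) ->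
    convex_function (X : set (convex_lmodType 'rV[R]_n)) v ->
    C2plus_on (interior X) v ->
    continuous omega ->
    (forall z, 0 < omega z) ->
    ((fun m : nat => (powR m%:R (2 * p / n%:R))%:E * triangle_p p X v omega m)
       @ \oo -->
     (delta / powR 2 p)%:E *
       poweR (lebint (fun x => if x \in (interior X : set 'rV[R]_n) then
                 (powR (\det (hessian v x)) (p / (n%:R + 2 * p)) *
                  powR (omega (x, v x)) (n%:R / (n%:R + 2 * p)))%:E
               else 0%E))
             ((n%:R + 2 * p) / n%:R))%E.
Proof.
move=> n0 p0; exists (quantc p (1%:M : 'M[R]_n)) => X v omega coX lX cX cv C2 cw w0.
have nR : 0 < n%:R :> R by rewrite ltr0n.
have al0 : 0 < 2 * p / n%:R by rewrite divr_gt0// mulr_gt0.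
have Eal : (n%:R + 2 * p) / n%:R = 1 + 2 * p / n%:R by rewrite mulrDl divff ?gt_eqF.
rewrite Eal (@lebint_density R p n X v omega C2 cw).
have L0 : (0 <= (quantc p (1%:M : 'M[R]_n) / 2 `^ p)%:E *
   (\int[leb n]_(x in interior X) (density p v omega x)%:E) `^ (1 + 2 * p / n%:R))%E.
  by rewrite mule_ge0 ?poweR_ge0// lee_fin divr_ge0 ?powR_ge0 ?quantc_ge0.
have [[x0 Ix0]|nI] := pselect (interior X !=set0).
  apply: cvge_squeeze => // c.
    exact: triangle_limsup p0 n0 coX lX cX cv C2 cw w0 Ix0 c.
  exact: triangle_liminf p0 n0 coX lX cX C2 cw w0 Ix0 c.
(* With empty interior [X] is a null set, and both sides of the limit are [0]. *)
have I0 : interior X = set0 by apply/seteqP; split => // x Ix; apply: nI; exists x.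
have X0 := convex_null cX coX I0.
have tri0 m : (0 < m)%N -> triangle_p p X v omega m = 0%E.
  move=> m0; have [l Pl] := Pc_nonempty m0 coX lX.
  have pen0 l' : Pc m X v l' -> (\int[leb n]_x penalty p X v omega l' x)%E = 0%E.
    by move=> /Pc_continuous cl; exact: penalty_null.
  apply/eqP; rewrite eq_le; apply/andP; split.
    by rewrite -(pen0 l Pl); exact: triangle_le.
  by apply: triangle_ge => // l' /pen0 ->.
rewrite I0 integral_set0 poweR0r ?mule0; last by rewrite gt_eqF// addr_gt0.
apply: cvge_squeeze => // c; rewrite lte_fin => c0; exists 1%N => m m0; rewrite tri0// mule0 lee_fin ltW//.
Qed.
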